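(* For each palette $(\mathcal C,\omega)$ there is an equivalence of categories $\mathsf{CA}^{(\mathcal C,\omega)}\simeq\mathsf{CO}^{(\mathcal C,\omega)}$ between $(\mathcal C,\omega)$-coloured circuit algebras in $\mathsf{Set}$ and circuit operads $S$ in $\mathsf{Set}$ with $(S_{\mathbb S},S_\tau)=(\mathcal C,\omega)$ (with colour-preserving morphisms). These extend to an equivalence $\mathsf{CA}\simeq\mathsf{CO}$ between the category of all circuit algebras in $\mathsf{Set}$ and the category of all circuit operads in $\mathsf{Set}$.
   Context: Graphical species: $\mathbf B$ is the groupoid of finite sets and bijections; $\mathbf B^{\mathbb S}$ adjoins an object $\mathbb S$ with $\mathrm{End}(\mathbb S)=\{\mathrm{id},\tau\}$, $\tau^2=\mathrm{id}$, and morphisms $ch_x:\mathbb S\to X$ ($x\in X$), $\mathrm{Hom}(\mathbb S,X)=\{ch_x,ch_x\tau\}$, $f ch_x=ch_{f(x)}$ for bijections $f$. A graphical species is a functor $S:(\mathbf B^{\mathbb S})^{op}\to\mathsf{Set}$. A circuit operad is a graphical species with an associative, unital, equivariant external product $\boxtimes_{X,Y}:S_X\times S_Y\to S_{X\sqcup Y}$ compatible with the maps $S(ch_x)$, an equivariant contraction $\zeta^{x\ddagger y}_X:S_X^{x\ddagger y}\to S_{X\setminus\{x,y\}}$ defined on $S_X^{x\ddagger y}=\{\phi: S(ch_x)\phi=S_\tau S(ch_y)\phi\}$, such that contractions at disjoint pairs commute, contraction commutes with $\boxtimes$, and with a unit-like $\epsilon:S_{\mathbb S}\to S_{\mathbf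 2}$ ($\epsilon S_\tau=S(\sigma_{\mathbf 2})\epsilon$, $S(ch_1)\epsilon=\mathrm{id}$) satisfying $\zeta^{x\ddagger 2}(\phi\boxtimes\epsilon(S(ch_x)\phi))=\phi$ for all $\phi\in S_X$, $x\in X$. Circuit algebras: a palette is a set $\mathcal C$ with an involution $\omega$; a $(\mathcal C,\omega)$-coloured circuit algebra in $\mathsf{Set}$ is a symmetric lax monoidal functor $\mathsf{BD}^{(\mathcal C,\omega)}\to(\mathsf{Set},\times)$, where $\mathsf{BD}^{(\mathcal C,\omega)}$ is the category whose objects are finite lists in $\mathcal C$ and whose morphisms $\mathbf c\to\mathbf d$ are Brauer diagrams (a pairing of the source and target points, together with a number of closed loops) with a colouring of points by $\mathcal C$ compatible with the pairing via $\omega$ and of closed loops by $\omega$-orbits, of type $(\mathbf c,\mathbf d)$; composition is by stacking. Equivalently it is an algebra over the operad of wiring diagrams $\mathrm{WD}^{(\mathcal C,\omega)}(\mathbf c_1,..,\mathbf c_k;\mathbf d)=\mathsf{BD}^{(\mathcal C,\omega)}(\mathbf c_1\oplus..\oplus\mathbf c_k,\mathbf d)$. $\mathsf{CA}$ is the Grothendieck construction over palettes (morphisms: involution-preserving maps of palettes plus a morphism of the pulled-back circuit algebras), and $\mathsf{CO}$ is the category of circuit operads in $\mathsf{Set}$.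
   Formalization: The external product of a circuit operad is also required to be commutative up to the swap of X⊔Y and Y⊔X; without this the claim fails (for the empty palette, circuit algebras are commutative monoids, while circuit operads would be all monoids). *)

(* Defs.v *)
From Stdlib Require Import List Permutation Relations JMeq.
From mathcomp Require Import all_boot.

Set Implicit Arguments.
Unset Strict Implicit.
Unset Printing Implicit Defensive.

(* Categories, functors, equivalences.  Composition and identities are given *)
(* as relations ("h is the composite of f then g", "i is an identity"); for   *)
(* the concrete categories below they are graphs of the usual operations.    *)

Record Cat := MkCat {
  ob : Type;
  hom : ob -> ob -> Type;
  is_id : forall X, hom X X -> Prop;
  is_comp : forall X Y Z, hom X Y -> hom Y Z -> hom X Z -> Prop }.
Arguments is_id {c X}.
Arguments is_comp {c X Y Z}.

Record Functor (C D : Cat) := MkFunctor {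
  fob : ob C -> ob D;
  fmor : forall X Y, hom X Y -> hom (fob X) (fob Y);
  fmor_id : forall X (f : hom X X), is_id f -> is_id (fmor f);
  fmor_comp : forall X Y Z (f : hom X Y) (g : hom Y Z) (h : hom X Z),
      is_comp f g h -> is_comp (fmor f) (fmor g) (fmor h) }.
Arguments fob {C D}.
Arguments fmor {C D} f0 {X Y}.

Definition inverse_pair (C : Cat) (X Y : ob C) (f : hom X Y) (g : hom Y X) :=
  (exists i : hom X X, is_comp f g i /\ is_id i) /\
  (exists j : hom Y Y, is_comp g f j /\ is_id j).

Record CatEquiv (C D : Cat) := MkCatEquiv {
  eF : Functor C D;
  eG : Functor D C;
  eta : forall X : ob C, hom X (fob eG (fob eF X));
  eta_inv : forall X : ob C, hom (fob eG (fob eF X)) X;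
  epsn : forall Y : ob D, hom (fob eF (fob eG Y)) Y;
  epsn_inv : forall Y : ob D, hom Y (fob eF (fob eG Y));
  eta_iso : forall X, inverse_pair (eta X) (eta_inv X);
  epsn_iso : forall Y, inverse_pair (epsn Y) (epsn_inv Y);
  eta_nat : forall X Y (f : hom X Y), exists k : hom X (fob eG (fob eF Y)),
      is_comp f (eta Y) k /\ is_comp (eta X) (fmor eG (fmor eF f)) k;
  epsn_nat : forall X Y (f : hom X Y), exists k : hom (fob eF (fob eG X)) Y,
      is_comp (fmor eF (fmor eG f)) (epsn Y) k /\ is_comp (epsn X) f k }.

Record palette := Palette {
  pcol :> Type;
  pinv : pcol -> pcol;
  pinvK : forall c, pinv (pinv c) = c }.
Arguments pinv {p}.

Record palmap (P Q : palette) := Palmap {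
  pm :> P -> Q;
  pm_inv : forall c, pm (pinv c) = pinv (pm c) }.

Definition palmap_id (P : palette) : palmap P P :=
  @Palmap P P (fun c => c) (fun c => erefl).

(* The groupoid B is represented by finite types and bijections.            *)

Record bij (X Y : finType) := Bij {
  bfun :> X -> Y;
  binv : Y -> X;
  bfunK : cancel bfun binv;
  binvK : cancel binv bfun }.

Definition rem2 (X : finType) (x y : X) : finType :=
  {z : X | (z != x) && (z != y)}.

Definition pt1 : 'I_2 := ord0.
Definition pt2 : 'I_2 := ord_max.

(* Data of a graphical species S with (S_SS, S_tau) = (P, pinv), together
   with the operations of a circuit operad. *)
Record CircOpData (P : palette) := MkCircOpData {
  S :> finType -> Type;
  act : forall X Y : finType, bij X Y -> S Y -> S X;
  (* S(ch_x) : S_X -> S_SS = P *)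
  ch : forall X : finType, X -> S X -> P;
  xprod : forall X Y : finType, S X -> S Y -> S (X + Y)%type;
  xunit : S void;
  zeta : forall (X : finType) (x y : X), x != y ->
           forall phi : S X, ch x phi = pinv (ch y phi) -> S (rem2 x y);
  epsu : P -> S 'I_2 }.
Arguments act {P} _ {X Y}.
Arguments ch {P} _ {X}.
Arguments xprod {P} _ {X Y}.
Arguments xunit {P} _.
Arguments zeta {P} _ {X x y}.
Arguments epsu {P} _.

Record is_circuit_operad (P : palette) (s : CircOpData P) : Prop := {
  act_id : forall (X : finType) (e : bij X X), (forall z, e z = z) ->
      forall phi : s X, act s e phi = phi;
  act_comp : forall (X Y Z : finType) (e1 : bij X Y) (e2 : bij Y Z) (e3 : bij X Z),
      (forall z, e3 z = e2 (e1 z)) ->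
      forall phi : s Z, act s e1 (act s e2 phi) = act s e3 phi;
  ch_act : forall (X Y : finType) (e : bij X Y) (x : X) (phi : s Y),
      ch s x (act s e phi) = ch s (e x) phi;
  xprod_act : forall (X X' Y Y' : finType) (e1 : bij X X') (e2 : bij Y Y')
      (e : bij (X + Y)%type (X' + Y')%type),
      (forall x, e (inl x) = inl (e1 x)) -> (forall y, e (inr y) = inr (e2 y)) ->
      forall (phi : s X') (psi : s Y'),
      act s e (xprod s phi psi) = xprod s (act s e1 phi) (act s e2 psi);
  xprod_assoc : forall (X Y Z : finType) (e : bij ((X + Y) + Z)%type (X + (Y + Z))%type),
      (forall x, e (inl (inl x)) = inl x) ->
      (forall y, e (inl (inr y)) = inr (inl y)) ->
      (forall z, e (inr z) = inr (inr z)) ->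
      forall (phi : s X) (psi : s Y) (chi : s Z),
      act s e (xprod s phi (xprod s psi chi)) = xprod s (xprod s phi psi) chi;
  xprod_unitr : forall (X : finType) (e : bij X (X + void)%type), (forall x, e x = inl x) ->
      forall phi : s X, act s e (xprod s phi (xunit s)) = phi;
  xprod_unitl : forall (X : finType) (e : bij X (void + X)%type), (forall x, e x = inr x) ->
      forall phi : s X, act s e (xprod s (xunit s) phi) = phi;
  xprod_comm : forall (X Y : finType) (e : bij (X + Y)%type (Y + X)%type),
      (forall x, e (inl x) = inr x) -> (forall y, e (inr y) = inl y) ->
      forall (phi : s X) (psi : s Y),
      act s e (xprod s psi phi) = xprod s phi psi;
  ch_xprodl : forall (X Y : finType) (x : X) (phi : s X) (psi : s Y),
      ch s (inl x) (xprod s phi psi) = ch s x phi;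
  ch_xprodr : forall (X Y : finType) (y : Y) (phi : s X) (psi : s Y),
      ch s (inr y) (xprod s phi psi) = ch s y psi;
  zeta_act : forall (X Y : finType) (e : bij X Y) (x y : X) (nxy : x != y)
      (nexy : e x != e y) (phi : s Y)
      (H : ch s (e x) phi = pinv (ch s (e y) phi))
      (H' : ch s x (act s e phi) = pinv (ch s y (act s e phi)))
      (e' : bij (rem2 x y) (rem2 (e x) (e y))),
      (forall z, val (e' z) = e (val z)) ->
      act s e' (zeta s nexy phi H) = zeta s nxy (act s e phi) H';
  ch_zeta : forall (X : finType) (x y : X) (nxy : x != y) (phi : s X)
      (H : ch s x phi = pinv (ch s y phi)) (z : rem2 x y),
      ch s z (zeta s nxy phi H) = ch s (val z) phi;
  zeta_zeta : forall (X : finType) (x y w z : X) (nxy : x != y) (nwz : w != z)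
      (w1 z1 : rem2 x y) (x2 y2 : rem2 w z) (n1 : w1 != z1) (n2 : x2 != y2)
      (phi : s X)
      (H1 : ch s x phi = pinv (ch s y phi))
      (H3 : ch s w phi = pinv (ch s z phi))
      (H2 : ch s w1 (zeta s nxy phi H1) = pinv (ch s z1 (zeta s nxy phi H1)))
      (H4 : ch s x2 (zeta s nwz phi H3) = pinv (ch s y2 (zeta s nwz phi H3)))
      (e : bij (rem2 w1 z1) (rem2 x2 y2)),
      val w1 = w -> val z1 = z -> val x2 = x -> val y2 = y ->
      (forall u, val (val (e u)) = val (val u)) ->
      act s e (zeta s n2 (zeta s nwz phi H3) H4) =
      zeta s n1 (zeta s nxy phi H1) H2;
  zeta_xprod : forall (X Y : finType) (x y : X) (nxy : x != y)
      (nxy' : inl x != inl y :> (X + Y)%type) (phi : s X) (psi : s Y)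
      (H : ch s x phi = pinv (ch s y phi))
      (H' : ch s (inl x) (xprod s phi psi) = pinv (ch s (inl y) (xprod s phi psi)))
      (e : bij (rem2 (inl x : (X + Y)%type) (inl y)) (rem2 x y + Y)%type),
      (forall u, val u = match e u with inl v => inl (val v) | inr w => inr w end) ->
      zeta s nxy' (xprod s phi psi) H' = act s e (xprod s (zeta s nxy phi H) psi);
  epsu_inv : forall (c : P) (e : bij 'I_2 'I_2), e pt1 = pt2 -> e pt2 = pt1 ->
      epsu s (pinv c) = act s e (epsu s c);
  ch_epsu : forall c : P, ch s pt1 (epsu s c) = c;
  zeta_epsu : forall (X : finType) (x : X) (n : inl x != inr pt2 :> (X + 'I_2)%type)
      (phi : s X)
      (H : ch s (inl x) (xprod s phi (epsu s (ch s x phi))) =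
           pinv (ch s (inr pt2) (xprod s phi (epsu s (ch s x phi)))))
      (e : bij X (rem2 (inl x : (X + 'I_2)%type) (inr pt2))),
      (forall z, val (e z) = if z == x then inr pt1 else inl z) ->
      act s e (zeta s n (xprod s phi (epsu s (ch s x phi))) H) = phi }.

Record CircOp (P : palette) := MkCircOp {
  co_data :> CircOpData P;
  co_ax : is_circuit_operad co_data }.

Record COhom (P Q : palette) (g : palmap P Q) (s : CircOp P) (t : CircOp Q) :=
  MkCOhom {
  cm :> forall X : finType, s X -> t X;
  cm_act : forall (X Y : finType) (e : bij X Y) (phi : s Y),
      cm (act s e phi) = act t e (cm phi);
  cm_ch : forall (X : finType) (x : X) (phi : s X), ch t x (cm phi) = g (ch s x phi);
  cm_xprod : forall (X Y : finType) (phi : s X) (psi : s Y),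
      cm (xprod s phi psi) = xprod t (cm phi) (cm psi);
  cm_xunit : cm (xunit s) = xunit t;
  cm_zeta : forall (X : finType) (x y : X) (nxy : x != y) (phi : s X)
      (H : ch s x phi = pinv (ch s y phi))
      (H' : ch t x (cm phi) = pinv (ch t y (cm phi))),
      cm (zeta s nxy phi H) = zeta t nxy (cm phi) H';
  cm_epsu : forall c : P, cm (epsu s c) = epsu t (g c) }.
Arguments cm {P Q g s t} _ {X}.

Definition COcat (P : palette) : Cat :=
  @MkCat (CircOp P) (fun s t => COhom (palmap_id P) s t)
    (fun s f => forall (X : finType) (phi : s X), cm f phi = phi)
    (fun s t u f g h => forall (X : finType) (phi : s X), cm h phi = cm g (cm f phi)).

Definition COobj := {P : palette & CircOp P}.
Record COmor (s t : COobj) := MkCOmor {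
  co_pal : palmap (projT1 s) (projT1 t);
  co_hom : COhom co_pal (projT2 s) (projT2 t) }.

Definition COgcat : Cat :=
  @MkCat COobj COmor
    (fun s f => (forall c, co_pal f c = c) /\
                forall (X : finType) (phi : projT2 s X), cm (co_hom f) phi = phi)
    (fun s t u f g h => (forall c, co_pal h c = co_pal g (co_pal f c)) /\
        forall (X : finType) (phi : projT2 s X),
          cm (co_hom h) phi = cm (co_hom g) (cm (co_hom f) phi)).

(* A diagram c -> d has boundary points 0 .. size c + size d - 1 (first the  *)
(* source c, then the target d); the pairing is a fixed-point-free           *)
(* involution on these points (extended by the identity elsewhere).  Points  *)
(* paired on the same side carry colours related by omega, points paired    *)
(* across carry equal colours.  Closed loops are recorded by a list of       *)
(* colours, each standing for its omega-orbit; diagrams are identified up to *)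
(* reordering of the loops and replacing loop colours within their orbit.   *)

Definition bd_ok (P : palette) (c d : seq P) (p : nat -> nat) : Prop :=
  let N := size c + size d in
  (forall i, i < N -> p i < N /\ p i <> i /\ p (p i) = i) /\
  (forall i, N <= i -> p i = i) /\
  (forall i, i < N ->
     onth (c ++ d) (p i) =
     (if (i < size c) == (p i < size c) then omap (@pinv P) else id)
       (onth (c ++ d) i)).

Record BDiag (P : palette) (c d : seq P) := MkBDiag {
  bpair : nat -> nat;
  bloops : seq P;
  bpair_ok : bd_ok c d bpair }.
Arguments bpair {P c d}.
Arguments bloops {P c d}.

(* equality of loop collections (multisets of omega-orbits) *)
Definition loops_eqv (P : palette) (l1 l2 : seq P) : Prop :=
  exists l : seq P, Permutation l l2 /\
    Forall2 (fun a b => b = a \/ b = pinv a) l1 l.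

Definition BDeq (P : palette) (c d : seq P) (f f' : BDiag c d) : Prop :=
  (forall i, bpair f i = bpair f' i) /\ loops_eqv (bloops f) (bloops f').

Definition BDis_id (P : palette) (c : seq P) (f : BDiag c c) : Prop :=
  (forall i, i < size c -> bpair f i = i + size c) /\ bloops f = [::].

Definition BDis_comp (P : palette) (c d e : seq P)
    (f : BDiag c d) (g : BDiag d e) (h : BDiag c e) : Prop :=
  let a := size c in let b := size d in let k := size e in
  (* points of c ++ d ++ e, edges of f and of g (shifted) *)
  let edge := fun i j => (i < a + b /\ j = bpair f i) \/
                         (a <= i /\ i < a + b + k /\ j = a + bpair g (i - a)) in
  let conn := clos_refl_trans nat edge in
  let emb := fun p => if p < a then p else p + b in
  let inner := fun i => (a <= i /\ i < a + b) /\
                        forall q, conn i q -> a <= q /\ q < a + b in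
  (forall p q, p < a + k -> q < a + k -> p <> q ->
     (bpair h p = q <-> conn (emb p) (emb q))) /\
  exists (ks : seq nat) (L : seq P),
    Forall2 (fun i col => onth (c ++ d ++ e) i = Some col) ks L /\
    (forall i, In i ks -> inner i) /\
    (forall i, inner i -> exists j, In j ks /\ conn i j) /\
    (forall i j, In i ks -> In j ks -> conn i j -> i = j) /\
    NoDup ks /\
    loops_eqv (bloops h) (bloops f ++ bloops g ++ L).

Definition BDis_tensor (P : palette) (c d c' d' ce de : seq P)
    (f : BDiag c d) (f' : BDiag c' d') (h : BDiag ce de) : Prop :=
  let a := size c in let b := size d in let a' := size c' in
  let b' := size d' in
  let embF := fun i => if i < a then i else i + a' in
  let embF' := fun i => if i < a' then a + i else a + b + i in
  (forall i, i < a + b -> bpair h (embF i) = embF (bpair f i)) /\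
  (forall i, i < a' + b' -> bpair h (embF' i) = embF' (bpair f' i)) /\
  bloops h = bloops f ++ bloops f'.

Definition BDis_swap (P : palette) (c d cd dc : seq P) (h : BDiag cd dc) : Prop :=
  let a := size c in let b := size d in
  (forall i, i < a -> bpair h i = a + b + b + i) /\
  (forall j, j < b -> bpair h (a + j) = a + b + j) /\
  bloops h = [::].

(* Circuit algebras: symmetric lax monoidal functors BD^(C,omega) -> Set.     *)
(* The lax structure map A_c x A_d -> A_(c ++ d) is written with an explicit *)
(* (propositional) witness e = c ++ d of the target object.                 *)

Record CircAlgData (P : palette) := MkCircAlgData {
  A :> seq P -> Type;
  amap : forall c d : seq P, BDiag c d -> A c -> A d;
  mu : forall c d e : seq P, e = c ++ d -> A c -> A d -> A e;
  mu0 : A [::] }.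
Arguments amap {P} _ {c d}.
Arguments mu {P} _ {c d e}.
Arguments mu0 {P} _.

Record is_circuit_algebra (P : palette) (a : CircAlgData P) : Prop := {
  amap_eqv : forall c d (f f' : BDiag c d), BDeq f f' ->
      forall x, amap a f x = amap a f' x;
  amap_id : forall c (f : BDiag c c), BDis_id f -> forall x, amap a f x = x;
  amap_comp : forall c d e (f : BDiag c d) (g : BDiag d e) (h : BDiag c e),
      BDis_comp f g h -> forall x, amap a h x = amap a g (amap a f x);
  mu_nat : forall c d c' d' ce de (H1 : ce = c ++ c') (H2 : de = d ++ d')
      (f : BDiag c d) (f' : BDiag c' d') (h : BDiag ce de),
      BDis_tensor f f' h -> forall x x',
      amap a h (mu a H1 x x') = mu a H2 (amap a f x) (amap a f' x');
  mu_assoc : forall c d e cd de cde (H1 : cd = c ++ d) (H2 : cde = cd ++ e)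
      (H3 : de = d ++ e) (H4 : cde = c ++ de) x y z,
      mu a H2 (mu a H1 x y) z = mu a H4 x (mu a H3 y z);
  mu_unitl : forall c (H : c = [::] ++ c) x, mu a H (mu0 a) x = x;
  mu_unitr : forall c (H : c = c ++ [::]) x, mu a H x (mu0 a) = x;
  mu_sym : forall c d cd dc (H1 : cd = c ++ d) (H2 : dc = d ++ c)
      (h : BDiag cd dc), BDis_swap c d h -> forall x y,
      amap a h (mu a H1 x y) = mu a H2 y x }.

Record CircAlg (P : palette) := MkCircAlg {
  ca_data :> CircAlgData P;
  ca_ax : is_circuit_algebra ca_data }.

(* morphisms A -> g^* B of circuit algebras over a palette map g
   (monoidal natural transformations); the component at c is written with
   an explicit witness c' = map g c of the target object *)
Record CAhom (P Q : palette) (g : palmap P Q) (a : CircAlg P) (b : CircAlg Q) :=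
  MkCAhom {
  am :> forall (c : seq P) (c' : seq Q), c' = map g c -> a c -> b c';
  am_nat : forall c d c' d' (Hc : c' = map g c) (Hd : d' = map g d)
      (f : BDiag c d) (f' : BDiag c' d'),
      (forall i, bpair f' i = bpair f i) -> bloops f' = map g (bloops f) ->
      forall x, am Hd (amap a f x) = amap b f' (am Hc x);
  am_mu : forall c d e c' d' e' (H : e = c ++ d) (H' : e' = c' ++ d')
      (Hc : c' = map g c) (Hd : d' = map g d) (He : e' = map g e) x y,
      am He (mu a H x y) = mu b H' (am Hc x) (am Hd y);
  am_mu0 : forall (H : [::] = map g [::]), am H (mu0 a) = mu0 b }.
Arguments am {P Q g a b} _ {c c'}.

Definition CAcat (P : palette) : Cat :=
  @MkCat (CircAlg P) (fun a b => CAhom (palmap_id P) a b)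
    (fun a f => forall c (H : c = map (palmap_id P) c) x, am f H x = x)
    (fun a b u f g h => forall c c' c'' (H1 : c' = map (palmap_id P) c)
        (H2 : c'' = map (palmap_id P) c') (H3 : c'' = map (palmap_id P) c) x,
        am h H3 x = am g H2 (am f H1 x)).

Definition CAobj := {P : palette & CircAlg P}.
Record CAmor (a b : CAobj) := MkCAmor {
  ca_pal : palmap (projT1 a) (projT1 b);
  ca_hom : CAhom ca_pal (projT2 a) (projT2 b) }.

Definition CAgcat : Cat :=
  @MkCat CAobj CAmor
    (fun a f => (forall p, ca_pal f p = p) /\
        forall c (H : c = map (ca_pal f) c) x, am (ca_hom f) H x = x)
    (fun a b u f g h => (forall p, ca_pal h p = ca_pal g (ca_pal f p)) /\
        forall c c' c'' (H1 : c' = map (ca_pal f) c)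
          (H2 : c'' = map (ca_pal g) c') (H3 : c'' = map (ca_pal h) c) x,
        am (ca_hom h) H3 x = am (ca_hom g) H2 (am (ca_hom f) H1 x)).

(* Main.v *)
(** An element of S_X whose inputs are named by the numbers 0 .. size c - 1, with colours
    c, is an element of the associated circuit algebra at c; a Brauer diagram c -> d acts by
    adjoining a wire epsilon for every target point and contracting along the pairing.
    Functoriality is elimination of wires: by the axiom zeta(phi * epsilon) = phi,
    contracting against a family of wires amounts to contracting along the matching that
    short-cuts the wires, every circle of wires splitting off one loop zeta(epsilon).

    Conversely a circuit algebra A gives S_X := pairs of a colouring k of X and an element of
    A at the list of the values of k, in a fixed enumeration of X. Relabelling and
    contraction are then diagrams without cups, and epsilon is a cup applied to the unit.

    The round trip S -> A -> S is the identity up to naming: apart from epsilon only diagrams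
    without cups occur, and these need no wire. In the round trip A -> S -> A one has to see that a diagram acts
    through wires as it did in A: without closed loops, wires and contractions are composed
    one at a time into a single diagram, which ends up with the given pairing; closed loops
    are split off as a tensor factor [::] -> [::]. *)

Require Import Defs.
From Stdlib Require Import JMeq List Relations Permutation.
From Stdlib Require Import ProofIrrelevance FunctionalExtensionality ClassicalEpsilon.
From mathcomp Require Import all_boot.
From mathcomp Require Import finmap zify.

Set Implicit Arguments.
Unset Strict Implicit.
Unset Printing Implicit Defensive.

(** * Elements with named inputs *)

(** The operad axioms speak of sums and complements of finite types, so an iterated contraction
    would live on nested subtypes; with names it lives on a finite set of numbers. A second
    mismatch: composition of Brauer diagrams is specified by connectivity in a graph, whereas an
    operad contracts one pair at a time. Wire elimination therefore carries connectivity, and the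
    representatives of the circles, through every step. No axiom states that contraction is
    symmetric in its two inputs; symmetry is derived from the wire axiom, and independence of a
    contraction from the order and orientation of the pairs rests on it. In the other direction the
    danger is a loop closing in the middle of a computation in a circuit algebra; the invariant kept
    there says that a point still to be contracted is joined to an outer point, so that no cap
    closes a strand. Proof irrelevance absorbs the witnesses carried by [zeta], [mu] and [am],
    function extensionality identifies colourings, and a choice principle inverts the two comparison
    morphisms once they are known to be bijective. *)

Definition bij_id (X : finType) : bij X X := @Bij X X id id (fun=> erefl) (fun=> erefl).

Definition bij_sym (X Y : finType) (e : bij X Y) : bij Y X :=
  @Bij Y X (@binv _ _ e) e (@binvK _ _ e) (@bfunK _ _ e).

Definition bij_comp (X Y Z : finType) (e : bij X Y) (f : bij Y Z) : bij X Z :=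
  @Bij X Z (f \o e) (@binv _ _ e \o @binv _ _ f)
    (can_comp (@bfunK _ _ f) (@bfunK _ _ e)) (can_comp (@binvK _ _ e) (@binvK _ _ f)).

Section BijOf.
Variables (X Y : finType) (f : X -> Y).
Hypothesis fi : injective f.
Hypothesis fs : forall y, [exists x, f x == y].

Definition surj_inv y := xchoose (existsP (fs y)).
Lemma surj_invK : cancel surj_inv f.
Proof. by move=> y; apply/eqP; exact: (xchooseP (existsP (fs y))). Qed.
Lemma inj_surj_invK : cancel f surj_inv.
Proof. by move=> x; apply: fi; rewrite surj_invK. Qed.
Definition bij_of : bij X Y := Bij inj_surj_invK surj_invK.
End BijOf.

(** Many operad axioms take as a parameter a bijection constrained by its values, so applying one
    means producing that bijection. Finite choice yields it from two injective namings with the same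
    image. *)
Lemma naming_bij (T : eqType) (X Y : finType) (r : X -> T) (r' : Y -> T) :
  injective r -> injective r' -> (forall x, exists y, r' y = r x) ->
  (forall y, exists x, r x = r' y) -> exists e : bij X Y, forall x, r' (e x) = r x.
Proof.
move=> ri ri' h h'.
pose f x := xchoose (existsP (introT existsP
   (let: ex_intro y e := h x in ex_intro (fun y => r' y == r x) y (introT eqP e)))).
have fE x : r' (f x) = r x.
  by apply/eqP; rewrite /f; set H := existsP _; exact: (xchooseP H).
have fi : injective f by move=> x y e; apply: (ri); rewrite -!fE e.
have fs y : [exists x, f x == y].
  by case: (h' y) => x e; apply/existsP; exists x; apply/eqP/ri'; rewrite fE.
by exists (bij_of fi fs).
Qed.

Lemma bij_inj (X Y : finType) (e : bij X Y) : injective e.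
Proof. exact: can_inj (@bfunK _ _ e). Qed.

Lemma rem2_bij (X Y : finType) (e : bij X Y) (x y : X) :
  exists e' : bij (rem2 x y) (rem2 (e x) (e y)), forall z, val (e' z) = e (val z).
Proof.
apply: (naming_bij (r := e \o val) (r' := val)) => [||z|z].
- exact: inj_comp (@bij_inj _ _ e) val_inj.
- exact: val_inj.
- have h : (e (val z) != e x) && (e (val z) != e y).
    by rewrite !(inj_eq (@bij_inj _ _ e)); exact: (valP z).
  by exists (exist (fun w => (w != e x) && (w != e y)) _ h).
- case: z => w /= /andP[h1 h2].
  have h : (binv e w != x) && (binv e w != y).
    by rewrite -!(inj_eq (@bij_inj _ _ e)) binvK h1.
  by exists (exist (fun w => (w != x) && (w != y)) _ h); rewrite /= binvK.
Qed.

Section Nominal.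
Variables (P : palette) (s : CircOp P).
Implicit Types (X Y : finType).

Let ax := co_ax s.

Lemma act_bij_id X (e : bij X X) (phi : s X) : (forall x, e x = x) -> act s e phi = phi.
Proof. by move=> h; apply: (act_id ax). Qed.

Lemma zeta_eq X (x y : X) (n n' : x != y) (phi phi' : s X) H H' :
  phi = phi' -> zeta s n phi H = zeta s n' phi' H'.
Proof.
move=> e; case: _ / e H' => H'.
by rewrite (bool_irrelevance n n') (proof_irrelevance _ H H').
Qed.

(* Naming the inputs by natural numbers makes juxtaposition and contraction associative
   and commutative on the nose; the bijections of the axioms disappear. *)
Definition nom := {A : {fset nat} & s (A : finType)}.
Implicit Types (t u v : nom).

Section Nm.
Variables (X : finType) (r : X -> nat).
Hypothesis ri : injective r.

Definition nmset : {fset nat} := [fset r x | x in X]%fset.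
Definition nmf (x : X) : nmset := [` in_imfset imfset_key r (isT : x \in mem X) ]%fset.
Lemma nmf_inj : injective nmf.
Proof. by move=> x y /(congr1 val) /= /ri. Qed.
Lemma nmf_surj (a : nmset) : [exists x, nmf x == a].
Proof.
apply/existsP; case/imfsetP: (valP a) => x _ e; exists x.
by apply/eqP/val_inj; rewrite /= e.
Qed.
Lemma nmb_spec : {e : bij nmset X | forall a, r (e a) = val a}.
Proof.
exists (bij_sym (bij_of nmf_inj nmf_surj)) => a.
by rewrite -[in RHS](surj_invK nmf_surj a).
Qed.
Definition nmb := sval nmb_spec.
Lemma nmbE (a : nmset) : r (nmb a) = val a.
Proof. exact: (svalP nmb_spec). Qed.
(** The name set is the image of [r], which is awkward to compute with. By [nmP] every nominal
    element has this form, and the operations are computed on such presentations. *)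
Definition nm (phi : s X) : nom := existT _ nmset (act s nmb phi).
End Nm.

(** A bijection fixing every name forces the two finite sets to coincide; after that it is the
    identity and acts trivially. *)
Lemma nom_eq (A B : {fset nat}) (phi : s A) (psi : s B) (e : bij A B) :
  (forall a, val (e a) = val a) -> act s e psi = phi -> existT _ A phi = existT _ B psi :> nom.
Proof.
move=> h; have E : A = B.
  apply/fsetP => k; apply/idP/idP => H.
    by have := valP (e [` H]%fset); rewrite h.
  by have := valP (bij_sym e [` H]%fset); rewrite -(h (bij_sym e _)) /= binvK.
case: _ / E in psi e h *; rewrite act_bij_id ?(eq_sym psi) => [-> //|a].
exact/val_inj/h.
Qed.

Lemma nm_eq X Y (r : X -> nat) (ri : injective r) (r' : Y -> nat) (ri' : injective r')
   (e : bij X Y) phi psi :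
  (forall x, r' (e x) = r x) -> act s e psi = phi -> nm ri phi = nm ri' psi.
Proof.
move=> h <-; rewrite /nm.
pose e' : bij (nmset r) (nmset r') := bij_comp (nmb ri) (bij_comp e (bij_sym (nmb ri'))).
apply: (nom_eq (e := e')) => [a|].
  by rewrite -(nmbE ri a) -h -(nmbE ri') /= binvK.
rewrite (act_comp ax (e3 := bij_comp (nmb ri) e)) ?(act_comp ax (e3 := bij_comp (nmb ri) e)) //.
by move=> a; rewrite /= binvK.
Qed.

Lemma nm_val (A : {fset nat}) (phi : s A) : existT _ A phi = nm val_inj phi :> nom.
Proof.
rewrite /nm; apply: (nom_eq (e := bij_sym (nmb (r := val : A -> nat) val_inj))) => [a|].
  by rewrite -(nmbE val_inj) /= binvK.
by rewrite (act_comp ax (e3 := bij_id A)) ?act_bij_id // => a; rewrite /= binvK.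
Qed.

Lemma nmP t : exists X (r : X -> nat) (ri : injective r) phi, t = nm ri phi.
Proof. by case: t => A phi; exists A, val, val_inj, phi; rewrite nm_val. Qed.

Lemma nm_inj X Y (r : X -> nat) (ri : injective r) (r' : Y -> nat) (ri' : injective r')
   phi psi : nm ri phi = nm ri' psi ->
  (exists e : bij X Y, forall x, r' (e x) = r x) /\
  (forall e : bij X Y, (forall x, r' (e x) = r x) -> act s e psi = phi).
Proof.
move=> E.
(* [Q] is a property of an arbitrary nominal element, so that [E] can be rewritten in it although
   the underlying name sets are different types. *)
pose Q t := (exists e : bij X (tag t), forall x, val (e x) = r x) /\
  (forall e : bij X (tag t), (forall x, val (e x) = r x) -> act s e (tagged t) = phi).
have QX : Q (nm ri phi).
  split; first by exists (bij_sym (nmb ri)) => x; rewrite -(nmbE ri) /= binvK.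
  move=> e he; rewrite (act_comp ax (e3 := bij_id X)) ?act_bij_id // => x.
  by apply: (ri); rewrite nmbE he.
move: QX; rewrite E => -[[e1 h1] H2]; split.
  by exists (bij_comp e1 (nmb ri')) => x; rewrite -h1 -(nmbE ri').
move=> e he; rewrite -(H2 (bij_comp e (bij_sym (nmb ri')))) => [|x]; last by rewrite -(nmbE ri') /= binvK.
rewrite (act_comp ax (e3 := e)) // => x.
by rewrite /= binvK.
Qed.

(** The partial colouring of names. [chn t k = None] doubles as freshness of [k] for [t], so
    supports are not handled as finite sets. *)
Definition chn t (k : nat) : option P :=
  if (insub k : option (tag t)) is Some a then Some (ch s a (tagged t)) else None.

Lemma chn_nm X (r : X -> nat) (ri : injective r) phi x : chn (nm ri phi) (r x) = Some (ch s x phi).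
Proof.
rewrite /chn /=; case: insubP => [a _ e|]; last by rewrite in_imfset.
by rewrite (ch_act ax); congr (Some (ch s _ _)); apply: (ri); rewrite nmbE e.
Qed.

Lemma chn_nm_None X (r : X -> nat) (ri : injective r) phi k :
  (forall x, r x <> k) -> chn (nm ri phi) k = None.
Proof.
rewrite /chn /= => h; case: insubP => [a|//]; case/imfsetP=> x _ e.
by case: (h x).
Qed.

Lemma chn_nmP X (r : X -> nat) (ri : injective r) phi k :
  (exists2 x, r x = k & chn (nm ri phi) k = Some (ch s x phi)) \/
  ((forall x, r x <> k) /\ chn (nm ri phi) k = None).
Proof.
case: (boolP [exists x, r x == k]) => [/existsP [x /eqP <-]|/existsP h].
  by left; exists x => //; exact: chn_nm.
by right; split=> [x e|]; [|apply: chn_nm_None => x e]; apply: h; exists x; apply/eqP.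
Qed.

Definition nu : nom := nm (r := fun x : void => match x with end) (fun x => match x with end) (xunit s).

Definition sumr X Y (r : X -> nat) (r' : Y -> nat) (z : X + Y) :=
  match z with inl x => r x | inr y => r' y end.

(* [np], [ren] and [zt] return [t] when the names clash, when [f] is not injective on
   names, and when [x] and [y] are not distinct names of matching colours. *)
Definition np t u : nom :=
  match @injectiveP _ _ (sumr (val : tag t -> nat) (val : tag u -> nat)) with
  | ReflectT H => nm H (xprod s (tagged t) (tagged u)) | _ => t end.

Definition ren (f : nat -> nat) t : nom :=
  match @injectiveP _ _ (f \o (val : tag t -> nat)) with
  | ReflectT H => nm H (tagged t) | _ => t end.

Definition zt (x y : nat) t : nom :=
  match (insub x : option (tag t)), (insub y : option (tag t)) with
  | Some a, Some b =>
    match excluded_middle_informative (a != b) with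
    | left n =>
      match excluded_middle_informative (ch s a (tagged t) = pinv (ch s b (tagged t))) with
      | left H => nm (inj_comp (val_inj : injective (val : tag t -> nat))
                        (val_inj : injective (val : rem2 a b -> tag t)))
                     (zeta s n (tagged t) H)
      | right _ => t end
    | _ => t end
  | _, _ => t end.

Lemma np_nm X Y (r : X -> nat) (ri : injective r) (r' : Y -> nat) (ri' : injective r') phi psi
  (H : injective (sumr r r')) : np (nm ri phi) (nm ri' psi) = nm H (xprod s phi psi).
Proof.
rewrite /np; case: injectiveP => [H'|[]].
  have ei : injective (fun z : nmset r + nmset r' =>
     match z with inl a => inl (nmb ri a) | inr b => inr (nmb ri' b) end : (X + Y)%type).
    by move=> [a|b] [c|d] // [/bij_inj ->].
  have es z : [exists w : nmset r + nmset r',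
     match w with inl a => inl (nmb ri a) | inr b => inr (nmb ri' b) end == z :> (X + Y)%type].
    apply/existsP; case: z => [x|y]; [exists (inl (bij_sym (nmb ri) x))|exists (inr (bij_sym (nmb ri') y))];
      by rewrite /= binvK.
  apply: (@nm_eq _ _ _ _ _ _ (bij_of ei es)) => [[a|b] /=|]; rewrite -?(nmbE ri) -?(nmbE ri') //.
  by rewrite (xprod_act ax (e1 := nmb ri) (e2 := nmb ri')).
move=> [a|b] [c|d] /= e.
- by congr inl; apply: val_inj.
- by have := H (inl (nmb ri a)) (inr (nmb ri' d)); rewrite /= !nmbE => /(_ e).
- by have := H (inr (nmb ri' b)) (inl (nmb ri c)); rewrite /= !nmbE => /(_ e).
- by congr inr; apply: val_inj.
Qed.

Lemma ren_nm X (r : X -> nat) (ri : injective r) f (H : injective (f \o r)) phi :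
  ren f (nm ri phi) = nm H phi.
Proof.
rewrite /ren; case: injectiveP => [H'|[]].
  by apply: (@nm_eq _ _ _ _ _ _ (nmb ri)) => // a /=; rewrite nmbE.
move=> a b /= e; apply: (@bij_inj _ _ (nmb ri)); apply: H.
by rewrite /= !nmbE.
Qed.

Lemma zt_nm X (r : X -> nat) (ri : injective r) (x y : X) (n : x != y) (phi : s X) H :
  zt (r x) (r y) (nm ri phi) = nm (inj_comp ri (val_inj : injective (val : rem2 x y -> X))) (zeta s n phi H).
Proof.
rewrite /zt /=; case: insubP => [a _ ea|]; last by rewrite in_imfset.
case: insubP => [b _ eb|]; last by rewrite in_imfset.
have xa : nmb ri a = x by apply: (ri); rewrite nmbE.
have yb : nmb ri b = y by apply: (ri); rewrite nmbE.
case: _ / xa in n H ea *; case: _ / yb in n H eb *.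
case: excluded_middle_informative => [n'|[]]; last by apply: contraNneq n => ->.
case: excluded_middle_informative => [H'|[]]; last by rewrite !(ch_act ax).
have [e' he'] := rem2_bij (nmb ri) a b.
apply: (@nm_eq _ _ _ _ _ _ e') => [z /=|]; first by rewrite he' nmbE.
exact: (zeta_act ax (e := nmb ri)).
Qed.

Lemma nm_ext X (r r' : X -> nat) (ri : injective r) (ri' : injective r') phi :
  r =1 r' -> nm ri phi = nm ri' phi.
Proof. by move=> h; apply: (@nm_eq _ _ _ _ _ _ (bij_id X)); [move=> x; rewrite /= h|exact: act_bij_id]. Qed.

End Nominal.

(** * The operad axioms in nominal form *)

Section NominalAlgebra.
Variables (P : palette) (s : CircOp P).
Implicit Types (X Y : finType) (t u v : nom s).
Let ax := co_ax s.

Definition zok x y t := x <> y /\ exists2 c, chn t x = Some c & chn t y = Some (pinv c).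
Definition disj t u := forall k, chn t k = None \/ chn u k = None.
Definition rinj (f : nat -> nat) t :=
  forall k l, chn t k <> None -> chn t l <> None -> f k = f l -> k = l.

Lemma zok_sym x y t : zok x y t -> zok y x t.
Proof.
by move=> [n [c hx hy]]; split; [exact/nesym|exists (pinv c); rewrite ?pinvK].
Qed.

Lemma zokE x y t : zok x y t -> exists X (r : X -> nat) (ri : injective r) (a b : X) (n : a != b) phi H,
  [/\ t = nm ri phi, r a = x, r b = y &
      zt x y t = nm (inj_comp ri (val_inj : injective (val : rem2 a b -> X))) (zeta s n phi H)].
Proof.
case: (nmP t) => X [r [ri [phi ->]]] [xy [c]].
have [[a ex ->] [ea]|[_ ->]//] := chn_nmP ri phi x.
have [[b ey ->] [eb]|[_ ->]//] := chn_nmP ri phi y.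
subst x y.
have n : a != b by apply/eqP => e; apply: xy; rewrite e.
have H : ch s a phi = pinv (ch s b phi) by rewrite ea eb pinvK.
by exists X, r, ri, a, b, n, phi, H; split => //; exact: zt_nm.
Qed.

(** This clause lets the commutation, renaming and juxtaposition laws be stated for arbitrary
    elements: on a pair that cannot be contracted both sides collapse. *)
Lemma zt_nok x y t : ~ zok x y t -> zt x y t = t.
Proof.
move=> h; rewrite /zt; case: insubP => [a _ ea|//]; case: insubP => [b _ eb|//].
case: excluded_middle_informative => // n.
case: excluded_middle_informative => // H.
case: h; rewrite -ea -eb; split; first by move/val_inj => e; rewrite e eqxx in n.
by exists (ch s a (tagged t)); rewrite /chn valK ?H ?pinvK.
Qed.

Lemma chn_zt x y t k : zok x y t ->
  chn (zt x y t) k = if (k == x) || (k == y) then None else chn t k.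
Proof.
case/zokE => X [r [ri [a [b [n [phi [H [-> <- <- ->]]]]]]]].
have [[z /= <- ->]|[/= h ->]] :=
  chn_nmP (inj_comp ri (val_inj : injective (val : rem2 a b -> X))) (zeta s n phi H) k.
  rewrite !(inj_eq ri) -if_neg negb_or (valP z) chn_nm.
  by rewrite (ch_zeta ax).
case: ifP => // /norP [ka kb]; symmetry; apply: chn_nm_None => z e.
have hz : (z != a) && (z != b) by rewrite -!(inj_eq ri) e ka.
exact: (h (exist (fun z => (z != a) && (z != b)) z hz)).
Qed.

Lemma chn_zt_other x y t k : k <> x -> k <> y -> chn (zt x y t) k = chn t k.
Proof.
move=> kx ky; case: (classic (zok x y t)) => [|/zt_nok -> //] /chn_zt ->.
by case: eqP => // _; case: eqP.
Qed.

Lemma zok_zt x y w z t : x <> w -> x <> z -> y <> w -> y <> z -> zok x y (zt w z t) <-> zok x y t.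
Proof. by move=> *; rewrite /zok !chn_zt_other. Qed.

(** If one pair cannot be contracted it drops out of both sides, since a contraction at other names
    does not affect [zok]. Otherwise both sides are iterated contractions on nested complements with
    the same underlying points, compared by [zeta_zeta]. *)
Lemma zt_comm x y w z t : x <> w -> x <> z -> y <> w -> y <> z ->
  zt x y (zt w z t) = zt w z (zt x y t).
Proof.
move=> xw xz yw yz.
case: (classic (zok x y t)) => [ok1|nok]; last first.
  by rewrite [in RHS](zt_nok nok) [LHS]zt_nok // zok_zt.
case: (classic (zok w z t)) => [ok2|nok]; last first.
  by rewrite [in LHS](zt_nok nok) [RHS]zt_nok // zok_zt; [|exact/nesym..].
have [X [r [ri [a [b [n [phi [H [Et ea eb Ez]]]]]]]]] := zokE ok1.
have [c1 [d1 [ec ed]]] : exists c d, r c = w /\ r d = z.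
  case: ok2 => _ [c]; rewrite Et.
  have [[c1 <- _] _|[_ ->]//] := chn_nmP ri phi w.
  have [[d1 <- _] _|[_ ->]//] := chn_nmP ri phi z.
  by exists c1, d1.
subst x y w z.
have ac : a != c1 by apply/eqP => e; apply: xw; rewrite e.
have ad : a != d1 by apply/eqP => e; apply: xz; rewrite e.
have bc : b != c1 by apply/eqP => e; apply: yw; rewrite e.
have bd : b != d1 by apply/eqP => e; apply: yz; rewrite e.
have cd : c1 != d1 by apply/eqP => e; case: ok2 => + _; rewrite e.
have H' : ch s c1 phi = pinv (ch s d1 phi).
  by case: ok2 => _ [c]; rewrite Et !chn_nm => -[->] [->]; rewrite pinvK.
rewrite Ez Et (zt_nm ri cd H').
have ha : (a != c1) && (a != d1) by rewrite ac.
have hb : (b != c1) && (b != d1) by rewrite bc.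
have hc : (c1 != a) && (c1 != b) by rewrite !(eq_sym c1) ac.
have hd : (d1 != a) && (d1 != b) by rewrite !(eq_sym d1) ad.
pose a2 : rem2 c1 d1 := exist (fun z => (z != c1) && (z != d1)) a ha.
pose b2 : rem2 c1 d1 := exist (fun z => (z != c1) && (z != d1)) b hb.
pose c2 : rem2 a b := exist (fun z => (z != a) && (z != b)) c1 hc.
pose d2 : rem2 a b := exist (fun z => (z != a) && (z != b)) d1 hd.
have n1 : a2 != b2 by [].
have n2 : c2 != d2 by [].
have H1 : ch s a2 (zeta s cd phi H') = pinv (ch s b2 (zeta s cd phi H')).
  by rewrite !(ch_zeta ax).
have H2 : ch s c2 (zeta s n phi H) = pinv (ch s d2 (zeta s n phi H)).
  by rewrite !(ch_zeta ax).
rewrite (zt_nm (inj_comp ri (val_inj : injective (val : rem2 c1 d1 -> X))) n1 H1).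
rewrite (zt_nm (inj_comp ri (val_inj : injective (val : rem2 a b -> X))) n2 H2).
have [e he] : exists e : bij (rem2 a2 b2) (rem2 c2 d2), forall x, val (val (e x)) = val (val x).
  apply: (naming_bij (r := val \o val) (r' := val \o val)).
  - exact: inj_comp val_inj val_inj.
  - exact: inj_comp val_inj val_inj.
  - move=> [[x /= hx] /= hxx].
    have h1 : (x != a) && (x != b) by [].
    have h2 : (exist (fun z => (z != a) && (z != b)) x h1 != c2) &&
              (exist (fun z => (z != a) && (z != b)) x h1 != d2) by [].
    by exists (exist (fun z => (z != c2) && (z != d2)) _ h2).
  - move=> [[x /= hx] /= hxx].
    have h1 : (x != c1) && (x != d1) by [].
    have h2 : (exist (fun z => (z != c1) && (z != d1)) x h1 != a2) &&
              (exist (fun z => (z != c1) && (z != d1)) x h1 != b2) by [].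
    by exists (exist (fun z => (z != a2) && (z != b2)) _ h2).
apply: (@nm_eq _ _ _ _ _ _ _ _ (e)) => [x /=|]; first by rewrite he.
exact: (zeta_zeta ax (x := c1) (y := d1) (w := a) (z := b)).
Qed.

Lemma disj_sym t u : disj t u -> disj u t.
Proof. by move=> h k; case: (h k); auto. Qed.

Lemma disj_nm X Y (r : X -> nat) (ri : injective r) (r' : Y -> nat) (ri' : injective r') phi psi :
  disj (nm ri phi) (nm ri' psi) -> injective (sumr r r').
Proof.
move=> h [a|b] [c|d] /= e.
- by congr inl; apply: (ri).
- by case: (h (r a)); rewrite ?chn_nm // e chn_nm.
- by case: (h (r c)); rewrite ?chn_nm // -e chn_nm.
- by congr inr; apply: (ri').
Qed.

Lemma npE t u : disj t u -> exists X Y (r : X -> nat) (ri : injective r) (r' : Y -> nat)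
   (ri' : injective r') phi psi (H : injective (sumr r r')),
  [/\ t = nm ri phi, u = nm ri' psi & np t u = nm H (xprod s phi psi)].
Proof.
case: (nmP t) => X [r [ri [phi ->]]]; case: (nmP u) => Y [r' [ri' [psi ->]]] d.
exists X, Y, r, ri, r', ri', phi, psi, (disj_nm d); split => //; exact: np_nm.
Qed.

Lemma chn_np t u k : disj t u ->
  chn (np t u) k = if chn t k is Some c then Some c else chn u k.
Proof.
case/npE => X [Y [r [ri [r' [ri' [phi [psi [H [-> -> ->]]]]]]]]].
have [[[x|y] /= <- ->]|[/= h ->]] := chn_nmP H (xprod s phi psi) k.
- by rewrite (ch_xprodl ax) chn_nm.
- rewrite (ch_xprodr ax) (chn_nm_None ri) ?chn_nm // => x e.
  by have := H (inl x) (inr y) e.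
rewrite !chn_nm_None // => x e; [exact: (h (inr x) e)|exact: (h (inl x) e)].
Qed.

Lemma chn_np_None t u k : disj t u -> chn (np t u) k = None <-> chn t k = None /\ chn u k = None.
Proof. by move=> d; rewrite chn_np //; case: (chn t k) => [c|]; split=> // -[]. Qed.

Lemma disj_np t u v : disj t u -> disj t v -> disj u v -> disj (np t u) v.
Proof.
move=> d1 d2 d3 k; rewrite chn_np_None //.
by case: (d2 k); case: (d3 k); auto.
Qed.

Lemma disj_npr t u v : disj t u -> disj t v -> disj u v -> disj t (np u v).
Proof. by move=> d1 d2 d3; apply/disj_sym/disj_np => //; exact/disj_sym. Qed.

Lemma np_comm t u : disj t u -> np t u = np u t.
Proof.
case: (nmP t) => X [r [ri [phi ->]]]; case: (nmP u) => Y [r' [ri' [psi ->]]] d.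
rewrite (np_nm _ _ _ _ (disj_nm d)) (np_nm _ _ _ _ (disj_nm (disj_sym d))).
pose f (z : X + Y) : Y + X := match z with inl x => inr x | inr y => inl y end.
pose g (z : Y + X) : X + Y := match z with inl x => inr x | inr y => inl y end.
have K1 : cancel f g by case. have K2 : cancel g f by case.
by apply: (@nm_eq _ _ _ _ _ _ _ _ (Bij K1 K2 : bij (X + Y)%type (Y + X)%type)) => [[]//|]; exact: (xprod_comm ax).
Qed.

Lemma np_assoc t u v : disj t u -> disj t v -> disj u v -> np (np t u) v = np t (np u v).
Proof.
case: (nmP t) => X [r [ri [phi ->]]]; case: (nmP u) => Y [r' [ri' [psi ->]]].
case: (nmP v) => Z [r'' [ri'' [chi ->]]] d1 d2 d3.
have i1 := disj_nm d1; have i3 := disj_nm d3.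
have d12 := disj_np d1 d2 d3; have d23 := disj_npr d1 d2 d3.
rewrite (np_nm _ _ _ _ i1) in d12 *; rewrite (np_nm _ _ _ _ i3) in d23 *.
rewrite (np_nm _ _ _ _ (disj_nm d12)) (np_nm _ _ _ _ (disj_nm d23)).
pose f (z : (X + Y) + Z) : X + (Y + Z) :=
  match z with inl (inl x) => inl x | inl (inr y) => inr (inl y) | inr z => inr (inr z) end.
pose g (z : X + (Y + Z)) : (X + Y) + Z :=
  match z with inl x => inl (inl x) | inr (inl y) => inl (inr y) | inr (inr z) => inr z end.
have K1 : cancel f g by case=> [[]|]. have K2 : cancel g f by case=> [|[]].
apply: (@nm_eq _ _ _ _ _ _ _ _ (Bij K1 K2 : bij ((X + Y) + Z)%type (X + (Y + Z))%type)) => [[[]|]//|].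
exact: (xprod_assoc ax).
Qed.

Lemma chn_nu k : chn (nu s) k = None.
Proof. by apply: chn_nm_None; case. Qed.

Lemma disj_nu t : disj t (nu s).
Proof. by move=> k; right; exact: chn_nu. Qed.

Lemma np_nu t : np t (nu s) = t.
Proof.
have := disj_nu t; case: (nmP t) => X [r [ri [phi ->]]] d.
rewrite (np_nm _ _ _ _ (disj_nm d)); symmetry.
pose g (z : X + void) : X := match z with inl x => x | inr y => match y with end end.
have K1 : cancel inl g by []. have K2 : cancel g inl by case=> [|[]].
apply: (@nm_eq _ _ _ _ _ _ _ _ (Bij K1 K2 : bij X (X + void)%type)) => //.
exact: (xprod_unitr ax).
Qed.

Lemma nu_np t : np (nu s) t = t.
Proof. by rewrite np_comm ?np_nu //; exact/disj_sym/disj_nu. Qed.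

Lemma disj_zt x y t u : disj t u -> disj (zt x y t) u.
Proof.
case: (classic (zok x y t)) => [ok|/zt_nok ->//] h k; rewrite chn_zt //.
by case: ifP => _; auto.
Qed.

Lemma zok_np x y t u : disj t u -> chn u x = None -> chn u y = None -> zok x y (np t u) <-> zok x y t.
Proof.
by move=> d hx hy; rewrite /zok !chn_np // hx hy; case: (chn t x) => //; case: (chn t y).
Qed.

Lemma zt_npl x y t u : disj t u -> chn u x = None -> chn u y = None ->
  zt x y (np t u) = np (zt x y t) u.
Proof.
move=> d hx hy; case: (classic (zok x y t)) => ok; last by rewrite !zt_nok // zok_np.
have [X [r [ri [a [b [n [phi [H [Et <- <- Ez]]]]]]]]] := zokE ok.
have d2 := disj_zt (r a) (r b) d.
rewrite Ez {ok hx hy} in d2 *; subst t.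
case: (nmP u) d d2 => Y [r' [ri' [psi ->]]] d d2.
have i := disj_nm d; rewrite (np_nm _ _ _ _ i) (np_nm _ _ _ _ (disj_nm d2)).
have n' : inl a != inl b :> (X + Y)%type by [].
have H' : ch s (inl a) (xprod s phi psi) = pinv (ch s (inl b) (xprod s phi psi)).
  by rewrite !(ch_xprodl ax).
rewrite (zt_nm i n' H').
have [e he] : exists e : bij (rem2 (inl a : (X + Y)%type) (inl b)) (rem2 a b + Y)%type,
   forall z, match e z with inl z => inl (val z) | inr w => inr w end = val z.
  apply: (naming_bij (r := val) (r' := fun z : rem2 a b + Y =>
    match z with inl z => inl (val z) | inr w => inr w end)).
  - exact: val_inj.
  - by move=> [z|z] [w|w] // [] => [/val_inj ->|->].
  - by move=> [[z|z] hz]; [exists (inl (exist (fun z => (z != a) && (z != b)) z hz))|exists (inr z)].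
  - case=> [[z hz]|z].
      have h : (inl z != inl a :> (X + Y)%type) && (inl z != inl b :> (X + Y)%type) by [].
      by exists (exist (fun z => (z != inl a :> (X + Y)%type) && (z != inl b :> (X + Y)%type)) _ h).
    by exists (exist (fun z => (z != inl a :> (X + Y)%type) && (z != inl b :> (X + Y)%type)) (inr z) erefl).
apply: (@nm_eq _ _ _ _ _ _ _ _ (e)) => [z /=|].
  by rewrite -he; case: (e z).
by symmetry; apply: (zeta_xprod ax) => z; rewrite -he.
Qed.

Lemma rinj_nm X (r : X -> nat) (ri : injective r) f phi : rinj f (nm ri phi) -> injective (f \o r).
Proof. by move=> h a b e; apply: (ri); apply: h e; rewrite chn_nm. Qed.

Lemma inj_rinj f t : injective f -> rinj f t.
Proof. by move=> h k l _ _ /h. Qed.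

Lemma chn_ren_names f t k : rinj f t -> chn t k <> None -> chn (ren f t) (f k) = chn t k.
Proof.
case: (nmP t) => X [r [ri [phi ->]]] h; rewrite (ren_nm ri (rinj_nm h)).
have [[x <- ->] _|[_ ->]//] := chn_nmP ri phi k.
exact: (chn_nm (rinj_nm h) phi x).
Qed.

Lemma chn_ren_None f t k : rinj f t -> (forall l, chn t l <> None -> f l <> k) -> chn (ren f t) k = None.
Proof.
case: (nmP t) => X [r [ri [phi ->]]] h; rewrite (ren_nm ri (rinj_nm h)) => h'.
by apply: chn_nm_None => x; apply: h'; rewrite chn_nm.
Qed.

Lemma chn_ren f t k : injective f -> chn (ren f t) (f k) = chn t k.
Proof.
move=> fi; case E : (chn t k) => [c|].
  by rewrite chn_ren_names ?E //; exact: inj_rinj.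
by apply: chn_ren_None => [|l h /fi e]; [exact: inj_rinj|rewrite e E in h].
Qed.

Lemma chn_renP f t k : rinj f t ->
  (exists2 l, f l = k /\ chn t l <> None & chn (ren f t) k = chn t l) \/
  ((forall l, chn t l <> None -> f l <> k) /\ chn (ren f t) k = None).
Proof.
move=> h; case: (classic (exists l, f l = k /\ chn t l <> None)) => [[l [<- e]]|n].
  by left; exists l => //; exact: chn_ren_names.
right; have h' l : chn t l <> None -> f l <> k by move=> e e'; apply: n; exists l.
by split=> //; exact: chn_ren_None.
Qed.

Lemma ren_ext f g t : rinj f t -> (forall k, chn t k <> None -> f k = g k) -> ren f t = ren g t.
Proof.
case: (nmP t) => X [r [ri [phi ->]]] h E.
have hg : rinj g (nm ri phi) by move=> k l hk hl; rewrite -!E //; exact: h.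
rewrite (ren_nm ri (rinj_nm h)) (ren_nm ri (rinj_nm hg)).
by apply: nm_ext => x /=; apply: E; rewrite chn_nm.
Qed.

Lemma ren_comp f g t : rinj (f \o g) t -> ren f (ren g t) = ren (f \o g) t.
Proof.
move=> h; have hg : rinj g t by move=> k l hk hl e; apply: h => //=; rewrite e.
have hf : rinj f (ren g t).
  move=> k l; have [[k' [<- hk] -> _]|[_ ->]//] := chn_renP k hg.
  by have [[l' [<- hl] -> _]|[_ ->]//] := chn_renP l hg => e; congr g; apply: h.
case: (nmP t) h hg hf => X [r [ri [phi ->]]] h hg hf.
rewrite (ren_nm ri (rinj_nm hg)) in hf *.
by rewrite (ren_nm _ (rinj_nm hf)) (ren_nm _ (rinj_nm h)); apply: nm_ext.
Qed.

Lemma ren_id f t : (forall k, chn t k <> None -> f k = k) -> ren f t = t.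
Proof.
move=> h; have hi : rinj f t by move=> k l hk hl; rewrite !h.
rewrite (ren_ext (g := id)) //.
case: (nmP t) => X [r [ri [phi ->]]].
by rewrite (@ren_nm P s X r ri id ri).
Qed.

(** Injectivity on all numbers is the right condition: were [f] injective on names only, [f x] could
    be a name of the renamed element without [x] being one, and the right side could contract where
    the left does not. *)
Lemma ren_zt f x y t : injective f -> ren f (zt x y t) = zt (f x) (f y) (ren f t).
Proof.
move=> fi; case: (classic (zok x y t)) => ok; last first.
  rewrite !zt_nok // => -[n]; rewrite !chn_ren // => h; apply: ok; split => //.
  by move=> e; apply: n; rewrite e.
have [X [r [ri [a [b [n [phi [H [Et <- <- Ez]]]]]]]]] := zokE ok.
rewrite Ez Et (ren_nm ri (inj_comp fi ri)) (zt_nm (inj_comp fi ri) n H).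
rewrite (ren_nm _ (inj_comp fi (inj_comp ri (val_inj : injective (val : rem2 a b -> X))))).
exact: nm_ext.
Qed.

Lemma ren_np f t u : disj t u -> rinj f (np t u) -> ren f (np t u) = np (ren f t) (ren f u).
Proof.
case/npE => X [Y [r [ri [r' [ri' [phi [psi [H [-> -> ->]]]]]]]]] h.
have i := rinj_nm h; rewrite (ren_nm _ i).
have i1 : injective (f \o r) by move=> a b e; have [] := i (inl a) (inl b) e.
have i2 : injective (f \o r') by move=> a b e; have [] := i (inr a) (inr b) e.
have i3 : injective (sumr (f \o r) (f \o r')) by move=> [a|a] [b|b] e; apply: i.
rewrite (ren_nm _ i1) (ren_nm _ i2) (np_nm _ _ _ _ i3).
by apply: nm_ext; case.
Qed.

Lemma disj_ren f t u : disj t u -> rinj f (np t u) -> disj (ren f t) (ren f u).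
Proof.
move=> d h.
have ht : rinj f t by move=> k l hk hl; apply: h; rewrite chn_np_None // => -[].
have hu : rinj f u by move=> k l hk hl; apply: h; rewrite chn_np_None // => -[].
move=> k; have [[l [<- hl] _]|[_ ->]] := chn_renP k ht; last by left.
have [[l' [e hl'] _]|[_ ->]] := chn_renP (f l) hu; last by right.
have E : l' = l by apply: h => //; rewrite chn_np_None // => -[].
by subst l'; case: (d l).
Qed.

Definition wrn (a b : nat) (i : 'I_2) := if i == pt1 then a else b.
Lemma wrn_inj a b : a <> b -> injective (wrn a b).
Proof.
move=> ab i j; rewrite /wrn; have := ord_inj (n := 2).
by case: i => [[|[|i]] hi] //; case: j => [[|[|j]] hj] //= _ e; try (by case: ab);
  apply: val_inj.
Qed.

(** The unit-like element [epsu] as a wire: its end [a] carries [c], its end [b] carries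
    [pinv c]. *)
Definition wr a b c : nom s :=
  match excluded_middle_informative (a <> b) with
  | left H => nm (wrn_inj H) (epsu s c) | right _ => nu s end.

Lemma wr_nm a b c (H : injective (wrn a b)) : a <> b -> wr a b c = nm H (epsu s c).
Proof.
by move=> h; rewrite /wr; case: excluded_middle_informative => // ?; exact: nm_ext.
Qed.

Definition swap2 (i : 'I_2) : 'I_2 := if i == pt1 then pt2 else pt1.
Lemma swap2K : cancel swap2 swap2.
Proof. by move=> [[|[|i]] hi] //; apply: val_inj. Qed.

Lemma wr_sym a b c : a <> b -> wr a b (pinv c) = wr b a c.
Proof.
move=> ab; rewrite (wr_nm _ (wrn_inj ab) ab) (wr_nm _ (wrn_inj (nesym ab)) (nesym ab)).
apply: (@nm_eq _ _ _ _ _ _ _ _ (Bij swap2K swap2K)).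
  by move=> [[|[|i]] hi].
by symmetry; apply: (epsu_inv ax).
Qed.

Lemma chn_wr a b c k : a <> b ->
  chn (wr a b c) k = if k == a then Some c else if k == b then Some (pinv c) else None.
Proof.
move=> ab; case: eqP => [->|ka].
  rewrite (wr_nm _ (wrn_inj ab) ab).
  by rewrite -[X in chn _ X]/(wrn a b pt1) chn_nm (ch_epsu ax).
case: eqP => [->|kb].
  (* The axioms give the colour at [pt1] only; the other end is read off after reversing the
     wire. *)
  rewrite -[in wr _ _ _](pinvK c) wr_sym // (wr_nm _ (wrn_inj (nesym ab)) (nesym ab)).
  by rewrite -[X in chn _ X]/(wrn b a pt1) chn_nm (ch_epsu ax).
rewrite (wr_nm _ (wrn_inj ab) ab); apply: chn_nm_None => i.
by rewrite /wrn; case: ifP => _ /esym.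
Qed.

Lemma ren_wr f a b c : a <> b -> f a <> f b -> ren f (wr a b c) = wr (f a) (f b) c.
Proof.
move=> ab h; rewrite (wr_nm _ (wrn_inj ab) ab) (wr_nm _ (wrn_inj h) h).
have H : injective (f \o wrn a b).
  by move=> i j e; apply: (wrn_inj h); move: e; rewrite /= /wrn; do 2 case: ifP.
by rewrite (ren_nm _ H); apply: nm_ext => i; rewrite /= /wrn; case: ifP.
Qed.

Definition upd (x a k : nat) := if k == x then a else k.

(** The axiom [zeta_epsu] with names: contracting an input against one end of a wire renames it to
    the other end. All removal of wires goes back to this. *)
Lemma zt_wr x a b c t : chn t x = Some c -> a <> b -> chn t a = None -> chn t b = None ->
  zt x b (np t (wr a b c)) = ren (upd x a) t.
Proof.
move=> hx ab ha hb.
have d : disj t (wr a b c).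
  move=> k; rewrite chn_wr //; case: eqP => [->|_]; first by left.
  by case: eqP => [->|_]; [left|right].
rewrite (wr_nm _ (wrn_inj ab) ab) in d *.
case: (nmP t) hx ha hb d => X [r [ri [phi ->]]] hx ha hb d.
have i := disj_nm d; rewrite (np_nm _ _ _ _ i).
have [[z ez E]|[_ E]] := chn_nmP ri phi x; last by rewrite E in hx.
rewrite E in hx; case: hx => hx {E}; subst x c.
have n : inl z != inr pt2 :> (X + 'I_2)%type by [].
have H : ch s (inl z) (xprod s phi (epsu s (ch s z phi))) =
           pinv (ch s (inr pt2) (xprod s phi (epsu s (ch s z phi)))).
  rewrite (ch_xprodl ax) (ch_xprodr ax).
  have -> : epsu s (ch s z phi) = act s (Bij swap2K swap2K) (epsu s (pinv (ch s z phi))).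
    by rewrite -(epsu_inv ax) ?pinvK.
  by rewrite (ch_act ax) (ch_epsu ax) pinvK.
rewrite -[r z]/(sumr r (wrn a b) (inl z)) -[X in zt _ X]/(sumr r (wrn a b) (inr pt2)).
rewrite (zt_nm i n H).
have na w : r w <> a by move=> e; move: ha; rewrite -e chn_nm.
have i2 : injective (upd (r z) a \o r).
  move=> w w'; rewrite /= /upd !(inj_eq ri).
  case: eqP => [->|_]; case: eqP => [->|_] //.
  - by move/esym/na.
  - by move/na.
  - by move/ri.
rewrite (ren_nm ri i2).
have [e he] : exists e : bij X (rem2 (inl z : (X + 'I_2)%type) (inr pt2)),
   forall w, val (e w) = if w == z then inr pt1 else inl w.
  apply: (naming_bij (r := fun w => if w == z then inr pt1 else inl w : (X + 'I_2)%type)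
          (r' := val : rem2 (inl z : (X + 'I_2)%type) (inr pt2) -> _)).
  - by move=> v w; case: eqP => [->|_]; case: eqP => [->|_] // [].
  - exact: val_inj.
  - move=> w; case: eqP => [_|/eqP wz].
      by exists (exist (fun w : X + 'I_2 => (w != inl z) && (w != inr pt2)) (inr pt1) erefl).
    have h : (inl w != inl z :> (X + 'I_2)%type) && (inl w != inr pt2 :> (X + 'I_2)%type).
      by rewrite andbT.
    by exists (exist (fun w : X + 'I_2 => (w != inl z) && (w != inr pt2)) (inl w) h).
  - move=> [[w|w] hw].
      have /andP [/eqP wz _] := hw.
      by exists w; case: eqP => // e; case: wz; rewrite e.
    exists z; rewrite eqxx; congr inr; apply: val_inj.
    by case: w hw => [[|[|w]] hw'].
symmetry; apply: (@nm_eq _ _ _ _ _ _ _ _ (e)) => [w /=|].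
  by rewrite he /upd (inj_eq ri); case: ifP.
exact: (zeta_epsu ax).
Qed.

End NominalAlgebra.

(** * Matchings and elimination of wires *)

Lemma loops_eqv_refl (P : palette) (l : seq P) : loops_eqv l l.
Proof. by exists l; split=> //; elim: l => [|c l IH]; constructor; auto. Qed.

Lemma loops_eqv_cons (P : palette) (c c' : P) l l1 l2 :
  c' = c \/ c' = pinv c -> loops_eqv l (l1 ++ l2) -> loops_eqv (c :: l) (l1 ++ c' :: l2).
Proof.
move=> h [k [p f]]; exists (c' :: k); split; last by constructor.
exact: Permutation_cons_app.
Qed.

Fixpoint ends (m : seq (nat * nat)) : seq nat :=
  if m is p :: m' then p.1 :: p.2 :: ends m' else [::].

(** A list of pairs with distinct ends represents a matching; [pmem] forgets order and orientation,
    and two lists are compared through it. *)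
Definition pmem (m : seq (nat * nat)) x y := ((x, y) \in m) || ((y, x) \in m).

Lemma pmem_sym m x y : pmem m x y = pmem m y x.
Proof. exact: orbC. Qed.

Lemma pmem_cons p m x y : pmem (p :: m) x y = [|| (x, y) == p, (y, x) == p | pmem m x y].
Proof. by rewrite /pmem !inE -!orbA; case: eqP => //= _; rewrite orbCA. Qed.

Lemma pmem_cat m m' x y : pmem (m ++ m') x y = pmem m x y || pmem m' x y.
Proof. by rewrite /pmem !mem_cat orbACA. Qed.

Lemma ends_cat m m' : ends (m ++ m') = ends m ++ ends m'.
Proof. by elim: m => //= p m ->. Qed.

Lemma endsP m x : reflect (exists y, pmem m x y) (x \in ends m).
Proof.
elim: m => [|[a b] m IH]; first by constructor => -[y].
rewrite /= !inE; apply: (iffP or3P) => [[/eqP ->|/eqP ->|/IH [y h]]|[y]].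
- by exists b; rewrite pmem_cons eqxx.
- by exists a; rewrite pmem_cons eqxx orbT.
- by exists y; rewrite pmem_cons h !orbT.
rewrite pmem_cons => /or3P [/eqP [-> _]|/eqP [_ ->]|h].
- by constructor 1.
- by constructor 2.
- by constructor 3; apply/IH; exists y.
Qed.

Lemma mem_ends m x y : pmem m x y -> x \in ends m.
Proof. by move=> h; apply/endsP; exists y. Qed.

Lemma mem_ends2 m x y : (x, y) \in m -> (x \in ends m) && (y \in ends m).
Proof.
move=> h; rewrite (mem_ends (y := y)) ?(mem_ends (y := x)) //; rewrite /pmem h ?orbT //.
Qed.

Lemma pmem_ends m m' : pmem m =2 pmem m' -> ends m =i ends m'.
Proof. by move=> h x; apply/endsP/endsP => -[y hy]; exists y; rewrite ?h // -h. Qed.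

Lemma ends_perm_mid m1 p m2 : perm_eq (ends (m1 ++ p :: m2)) (ends (p :: m1 ++ m2)).
Proof.
rewrite /= !ends_cat /=.
apply/permP => a; rewrite !count_cat /= !count_cat; lia.
Qed.

Lemma pmem_mid m1 p m2 : pmem (m1 ++ p :: m2) =2 pmem (p :: m1 ++ m2).
Proof.
move=> x y; rewrite !(pmem_cat, pmem_cons).
by case: (pmem m1 x y) => //=; rewrite ?orbT.
Qed.

Lemma ends_extract m x : uniq (ends m) -> x \in ends m ->
  exists y m0, uniq (ends ((x, y) :: m0)) /\ pmem m =2 pmem ((x, y) :: m0).
Proof.
move=> u /endsP [y h].
have [h1|h1] := orP h; case/splitPr: h1 u h => m1 m2 u h.
  exists y, (m1 ++ m2); split; last exact: pmem_mid.
  by rewrite -(perm_uniq (ends_perm_mid _ _ _)).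
exists y, (m1 ++ m2); split.
  have := ends_perm_mid m1 (y, x) m2.
  move/perm_uniq; rewrite u /= => /esym; rewrite !inE !negb_or !(eq_sym y).
  by case/and3P => /andP [-> ->] -> ->.
move=> a b; rewrite pmem_mid !pmem_cons !xpair_eqE.
by do 4 case: eqP => //= _; rewrite ?orbT ?orbF.
Qed.

Lemma pmem_cons_rest m x y a b : uniq (ends ((x, y) :: m)) ->
  pmem m a b = [&& pmem ((x, y) :: m) a b, a != x & a != y].
Proof.
rewrite /= inE negb_or => /and3P [/andP [xy hx] hy u].
apply/idP/idP => [h|].
  have ea := mem_ends h; have eb : b \in ends m by apply: (mem_ends (y := a)); rewrite pmem_sym.
  rewrite pmem_cons h !orbT /=; apply/andP; split.
    by apply: contraNneq hx => <-.
  by apply: contraNneq hy => <-.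
case/and3P; rewrite pmem_cons !xpair_eqE => /or3P [/andP [/eqP-> _]|/andP[_ /eqP ->]|//].
  by rewrite eqxx.
by rewrite eqxx.
Qed.

Lemma pmem_fun m x y y' : uniq (ends m) -> pmem m x y -> pmem m x y' -> y = y'.
Proof.
elim: m => [|[a b] m IH] //= /[dup] u; rewrite inE negb_or => /and3P [/andP [ab ha] hb um].
rewrite !pmem_cons !xpair_eqE.
have hx z : pmem m x z -> (x == a = false) /\ (x == b = false).
  by move=> /mem_ends h; split; apply/negP => /eqP e; [case/negP: ha|case/negP: hb]; rewrite -e.
case/or3P => [/andP [/eqP e1 /eqP e2]|/andP [/eqP e1 /eqP e2]|h].
- subst; rewrite eqxx (negbTE ab) /= !andbF /= => /orP [/eqP->//|/hx []].
  by rewrite eqxx.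
- subst; rewrite eqxx eq_sym (negbTE ab) /= andbT => /orP [/eqP->//|/hx []].
  by rewrite eqxx.
have [-> ->] := hx _ h; rewrite /= andbF /=; exact: IH.
Qed.

(** * Connectivity of edge lists *)

Definition conn (e : seq (nat * nat)) := clos_refl_sym_trans nat (fun i j => (i, j) \in e).

Lemma conn_refl e i : conn e i i.
Proof. exact: rst_refl. Qed.
Lemma conn_sym e i j : conn e i j -> conn e j i.
Proof. exact: rst_sym. Qed.
Lemma conn_trans e j i k : conn e i j -> conn e j k -> conn e i k.
Proof. exact: rst_trans. Qed.
Lemma conn_pm e i j : pmem e i j -> conn e i j.
Proof. by case/orP => h; [|apply: rst_sym]; apply: rst_step. Qed.

Lemma conn_map e e' (f : nat -> nat) : (forall i j, (i, j) \in e -> conn e' (f i) (f j)) ->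
  forall i j, conn e i j -> conn e' (f i) (f j).
Proof.
move=> h i j; elim=> {i j} [i j /h //|i|i j _|i j k _ h1 _ h2].
- exact: conn_refl.
- exact: conn_sym.
- exact: conn_trans h1 h2.
Qed.

Lemma conn_sub e e' : (forall i j, pmem e i j -> pmem e' i j) -> forall i j, conn e i j -> conn e' i j.
Proof.
move=> h; apply: conn_map => i j hij; apply: conn_pm; apply: h.
by rewrite /pmem hij.
Qed.

Lemma conn_ends e i j : conn e i j -> i = j \/ (i \in ends e) && (j \in ends e).
Proof.
elim=> {i j} [i j h|i|i j _ [->|]|i j k _ [->|h] _ [<-|h']]; auto.
- by right; exact: mem_ends2.
- by rewrite andbC; auto.
- by right; case/andP: h => ->; case/andP: h'.
Qed.

(** Components of a matching are single points and single edges, so a matching can be recovered from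
    its connectivity relation. This is how the pairing of a composite is identified. *)
Lemma conn_matching m i j : uniq (ends m) -> conn m i j -> i = j \/ pmem m i j.
Proof.
move=> u; elim=> {i j} [i j h|i|i j _ [->|]|i j k _ [->|h] _ [<-|h']]; auto.
- by right; rewrite /pmem h.
- by rewrite pmem_sym; auto.
- by left; apply: (@pmem_fun m j) => //; rewrite pmem_sym.
Qed.

Section Splice.
Variables (x y z w : nat) (e e0 : seq (nat * nat)).
Hypotheses (hx : x \notin ends e0) (hy : y \notin ends e0).
Hypotheses (zx : z != x) (zy : z != y) (wx : w != x) (wy : w != y).
Hypothesis he : pmem e =2 pmem [:: (x, z), (y, w), (x, y) & e0].

(** The wire between [x] and [y] is matched to [z] at [x] and to [w] at [y]; removing it leaves the
    short cut between [w] and [z]. [splice] retracts the points onto the surviving ones along these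
    edges. *)
Definition splice k := if k == x then z else if k == y then w else k.

Let in_e i j : pmem [:: (x, z), (y, w), (x, y) & e0] i j -> conn e i j.
Proof. by rewrite -he; exact: conn_pm. Qed.

Lemma splice_conn i : conn e i (splice i).
Proof.
rewrite /splice; case: eqP => [->|_]; last case: eqP => [->|_]; last exact: conn_refl;
  by apply: in_e; rewrite !pmem_cons eqxx ?orbT.
Qed.

Lemma splice_neq i : (splice i != x) && (splice i != y).
Proof.
rewrite /splice; case: (altP (i =P x)) => [_|ix]; first by rewrite zx zy.
by case: (altP (i =P y)) => [_|iy]; [rewrite wx wy|rewrite ix iy].
Qed.

Lemma splice_id i : i != x -> i != y -> splice i = i.
Proof. by rewrite /splice => /negbTE -> /negbTE ->. Qed.

Lemma conn_unsplice i j : conn ((w, z) :: e0) i j -> conn e i j.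
Proof.
apply: (@conn_map _ _ id) => {i j} i j; rewrite inE => /orP [/eqP [-> ->]|h].
  apply: (@conn_trans _ y); first by apply: in_e; rewrite !pmem_cons eqxx ?orbT.
  apply: (@conn_trans _ x); last by apply: in_e; rewrite !pmem_cons eqxx ?orbT.
  by apply: in_e; rewrite !pmem_cons eqxx ?orbT.
by apply: in_e; rewrite /pmem !inE h !orbT.
Qed.

(** Of the three edges at the wire, two are collapsed to a point by [splice] and the third becomes
    the new edge; the edges of [e0] avoid [x] and [y] and stay in place. *)
Lemma conn_spliced i j : conn e i j -> conn ((w, z) :: e0) (splice i) (splice j).
Proof.
apply: conn_map => {i j}.
have wz : conn ((w, z) :: e0) w z by apply: conn_pm; rewrite pmem_cons eqxx.
have sx : splice x = z by rewrite /splice eqxx.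
have sy : conn ((w, z) :: e0) (splice y) w.
  by rewrite /splice eqxx; case: eqP => _; [exact: conn_sym|exact: conn_refl].
have sz := splice_id zx zy; have sw := splice_id wx wy.
suff h i j : pmem e i j -> conn ((w, z) :: e0) (splice i) (splice j).
  by move=> i j hij; apply: h; rewrite /pmem hij.
have zy' := conn_trans (conn_sym wz) (conn_sym sy).
rewrite he !pmem_cons !xpair_eqE.
case/or3P => [||/or3P [||/or3P [||h]]];
  try by case/andP => /eqP -> /eqP ->; rewrite ?sx ?sz ?sw; (exact: conn_refl || exact: conn_sym || done).
have ei := mem_ends h; have ej : j \in ends e0 by apply: (@mem_ends _ _ i); rewrite pmem_sym.
rewrite !splice_id; try by [apply: contraTneq ei => ->|apply: contraTneq ej => ->].
by apply: conn_pm; rewrite pmem_cons h !orbT.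
Qed.

Lemma conn_new_neq i j : conn ((w, z) :: e0) i j -> i != x -> i != y -> (j != x) && (j != y).
Proof.
case/conn_ends => [<-|/andP [_ h]]; first by move=> -> ->.
have [jx jy] : x \notin ends ((w, z) :: e0) /\ y \notin ends ((w, z) :: e0).
  by rewrite /= !inE !negb_or (eq_sym x) wx (eq_sym x) zx hx (eq_sym y) wy (eq_sym y) zy hy.
by move=> _ _; apply/andP; split; apply: contraTneq h => ->.
Qed.
End Splice.

Section Loop.
Variables (x y : nat) (e e0 : seq (nat * nat)).
Hypotheses (hx : x \notin ends e0) (hy : y \notin ends e0).
Hypothesis he : pmem e =2 pmem [:: (x, y), (x, y) & e0].

Lemma conn_loop_sub i j : conn e0 i j -> conn e i j.
Proof. by apply: conn_sub => {i j} i j; rewrite he !pmem_cons => ->; rewrite !orbT. Qed.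

Lemma conn_loop : conn e x y.
Proof. by apply: conn_pm; rewrite he pmem_cons eqxx. Qed.

Lemma conn_loop_neq i j : conn e0 i j -> i \notin [:: x; y] -> j \notin [:: x; y].
Proof.
case/conn_ends => [<-//|/andP [_ h]] _; rewrite !inE negb_or.
by apply/andP; split; apply: contraTneq h => ->.
Qed.

(** The double edge between [x] and [y] is a component of its own, because [e0] does not meet it. *)
Lemma conn_loopE i j : conn e i j ->
  conn e0 i j \/ (i \in [:: x; y]) && (j \in [:: x; y]).
Proof.
elim=> {i j} [i j h|i|i j _ [h|]|i j k _ h1 _ h2].
- have := he i j; rewrite {1}/pmem h /= !pmem_cons !xpair_eqE => /esym.
  case/or3P => [h'|h'|/or3P [h'|h'|/conn_pm]]; auto; right;
    by case/andP: h' => /eqP -> /eqP ->; rewrite !inE !eqxx ?orbT.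
- by left; exact: conn_refl.
- by left; exact: conn_sym.
- by rewrite andbC; auto.
case: h1 => [h1|/andP [h1 h1']]; case: h2 => [h2|/andP [h2 h2']]; rewrite ?h2' ?h1; auto.
- by left; exact: conn_trans h1 h2.
- right; rewrite andbT; apply/negPn/negP => ni.
  by have := conn_loop_neq h1 ni; rewrite h2.
- right; rewrite /=; apply/negPn/negP => nk.
  by have := conn_loop_neq (conn_sym h2) nk; rewrite h1'.
Qed.
End Loop.

(** * Contraction along matchings, circles and adjoined wires *)

Section Contraction.
Variables (P : palette) (s : CircOp P).
Implicit Types (t u v : nom s) (m : seq (nat * nat)) (l : seq P).

Lemma nom_fresh t : exists N, forall k, N <= k -> chn t k = None.
Proof.
case: (nmP t) => X [r [ri [phi ->]]]; exists (\max_x r x).+1 => k h.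
apply: chn_nm_None => x e; have := leq_bigmax (F := r) x; lia.
Qed.

(** Agrees with [upd a b] on the names of an element for which [b] is fresh, but is injective on all
    numbers, as [ren_zt] demands. *)
Definition transp (a b k : nat) := if k == a then b else if k == b then a else k.
Lemma transp_inj a b : injective (transp a b).
Proof. by move=> i j; rewrite /transp; do ! case: eqP; lia. Qed.

(** Attaching the fresh wire at [x] merely renames [x] to [a], so contracting [y] with [a]
    afterwards is the contraction of [y] with [x]. *)
Lemma zt_wr2 x y a b c t : zok x y t -> chn t x = Some c -> a <> b -> chn t a = None ->
  chn t b = None -> zt y a (zt x b (np t (wr s a b c))) = zt y x t.
Proof.
move=> ok hx ab ha hb; rewrite zt_wr //.
have xa : x <> a by move=> e; rewrite -e hx in ha.
have ya : y <> a by move=> e; case: ok => _ [? _]; rewrite e ha.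
have xy : x <> y by case: ok.
have i : rinj (upd x a) t.
  move=> k l hk hl; rewrite /upd; case: eqP => [->|_]; case: eqP => [->|_] //.
    by move=> e; case: hl; rewrite -e.
  by move=> e; case: hk; rewrite e.
rewrite (ren_ext (g := transp x a)) //; last first.
  by move=> k hk; rewrite /upd /transp; case: eqP => // _; case: eqP => // e; case: hk; rewrite e.
have tx : transp x a x = a by rewrite /transp eqxx.
have ty : transp x a y = y by rewrite /transp; do ! case: eqP; lia.
rewrite -{1}tx -{1}ty -ren_zt; last exact: transp_inj.
apply: ren_id => k; rewrite chn_zt; last exact: zok_sym.
rewrite /transp; case: (k =P x) => [->|_]; first by rewrite orbT.
by case: (k =P a) => // ->; rewrite ha; case: ifP.
Qed.

(** Put a fresh wire between [x] and [y] and contract [x] with one end and [y] with the other. By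
    [zt_wr2] one order of these two contractions computes [zt y x t] and the other, with the wire
    read backwards, [zt x y t]; the two contractions commute. *)
Lemma zt_sym x y t : zt x y t = zt y x t.
Proof.
case: (classic (zok x y t)) => [ok|n]; last by rewrite !zt_nok // => /zok_sym.
have [N hN] := nom_fresh t.
have [xy [c hx hy]] := ok.
have ha := hN N (leqnn _); have hb := hN N.+1 (leqnSn _).
have ab : N <> N.+1 by lia.
have xN : x <> N by move=> e; rewrite e ha in hx.
have xN' : x <> N.+1 by move=> e; rewrite e hb in hx.
have yN : y <> N by move=> e; rewrite e ha in hy.
have yN' : y <> N.+1 by move=> e; rewrite e hb in hy.
rewrite -(zt_wr2 ok hx ab ha hb) -(zt_wr2 (zok_sym ok) hy (nesym ab) hb ha).
rewrite wr_sym; last exact: nesym.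
rewrite zt_comm //; by [exact/nesym | lia].
Qed.

Definition lop c : nom s := zt 0 1 (wr s 0 1 c).

Lemma zok_wr a b c : a <> b -> zok a b (wr s a b c).
Proof.
move=> ab; split=> //; exists c; rewrite chn_wr ?eqxx //.
by case: eqP => // e; case: ab.
Qed.

Lemma chn_lop c k : chn (lop c) k = None.
Proof.
rewrite /lop chn_zt; last exact: zok_wr.
by case: ifP => // h; rewrite chn_wr // -(negbK (_ == _)); case/norP: (negbT h) => -> /negbTE ->.
Qed.

Lemma zt_wr_self a b c : a <> b -> zt a b (wr s a b c) = lop c.
Proof.
(* An injection of all numbers with [0] and [1] sent to [a] and [b]; from [2] on its values exceed
   both. *)
move=> ab; pose f k := if k == 0 then a else if k == 1 then b else k + a + b.
have fi : injective f by move=> i j; rewrite /f; do ! case: eqP; lia.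
rewrite -[RHS](ren_id (f := f)) => [|k]; last by rewrite chn_lop.
by rewrite /lop ren_zt // ren_wr.
Qed.

(** A circle can be cut open into a wire read in either direction. This is why loop colours matter
    only up to the involution, as in [loops_eqv]. *)
Lemma lop_inv c : lop (pinv c) = lop c.
Proof. by rewrite -[RHS](@zt_wr_self 1 0) // /lop wr_sym // zt_sym. Qed.

Lemma disj_lop t c : disj t (lop c).
Proof. by move=> k; right; exact: chn_lop. Qed.

Definition lops l t := foldr (fun c u => np u (lop c)) t l.

Lemma chn_lops l t k : chn (lops l t) k = chn t k.
Proof.
elim: l => //= c l IH; rewrite chn_np ?IH; last exact: disj_lop.
by rewrite chn_lop; case: (chn t k).
Qed.

Lemma disj_lops l t u : disj (lops l t) u <-> disj t u.
Proof. by split=> h k; case: (h k); rewrite ?chn_lops; auto. Qed.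

Lemma zt_lops x y l t : zt x y (lops l t) = lops l (zt x y t).
Proof.
by elim: l => //= c l IH; rewrite zt_npl ?IH ?chn_lop //; exact: disj_lop.
Qed.

Lemma np_lops l t u : disj t u -> np (lops l t) u = lops l (np t u).
Proof.
move=> d; elim: l => //= c l IH.
have d1 : disj (lops l t) u by apply/disj_lops.
rewrite np_assoc //; [|exact: disj_lop|exact/disj_sym/disj_lop].
rewrite -IH (np_comm (t := lop c)); last exact/disj_sym/disj_lop.
rewrite np_assoc //; exact: disj_lop.
Qed.

Lemma np_lopsr l t u : disj t u -> np t (lops l u) = lops l (np t u).
Proof.
move=> d; rewrite np_comm; last by apply/disj_sym/disj_lops/disj_sym.
by rewrite np_lops 1?np_comm //; exact: disj_sym.
Qed.

Lemma rinj_lops f l t : rinj f (lops l t) <-> rinj f t.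
Proof. by split=> h k k'; have := h k k'; rewrite !chn_lops. Qed.

Lemma ren_lops f l t : rinj f t -> ren f (lops l t) = lops l (ren f t).
Proof.
move=> h; elim: l => //= c l IH.
have d := disj_lop (lops l t) c.
have E : lops (c :: l) t = np (lops l t) (lop c) by [].
rewrite ren_np // ?IH; last by rewrite -E; apply/rinj_lops.
by rewrite (@ren_id _ _ _ (lop c)) // => k; rewrite chn_lop.
Qed.

Lemma lops_cat l l' t : lops (l ++ l') t = lops l (lops l' t).
Proof. exact: foldr_cat. Qed.

Lemma lops_perm l l' t : Permutation l l' -> lops l t = lops l' t.
Proof.
elim=> {l l'} //= [c l l' _ -> //|c c' l|l1 l2 l3 _ -> _ -> //].
rewrite np_assoc; try exact: disj_lop.
rewrite (np_comm (t := lop c)); last exact: disj_lop.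
by rewrite -np_assoc //; exact: disj_lop.
Qed.

Lemma lops_eqv l l' t : loops_eqv l l' -> lops l t = lops l' t.
Proof.
case=> k [/lops_perm <- f]; elim: f => //= c c' l1 l2 h _ ->.
by case: h => ->; rewrite ?lop_inv.
Qed.

Definition contr m t := foldl (fun t p => zt p.1 p.2 t) t m.

Arguments contr : simpl never.

Lemma contr_cons p m t : contr (p :: m) t = contr m (zt p.1 p.2 t).
Proof. by []. Qed.

Lemma contr_cat m m' t : contr (m ++ m') t = contr m' (contr m t).
Proof. exact: foldl_cat. Qed.

Lemma contr_zt x y m t : x \notin ends m -> y \notin ends m ->
  contr m (zt x y t) = zt x y (contr m t).
Proof.
elim: m t => [|[a b] m IH] t //=; rewrite !inE !negb_or.
case/and3P => /eqP xa /eqP xb hx /and3P [/eqP ya /eqP yb hy].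
by rewrite !contr_cons /= -IH // zt_comm //; exact/nesym.
Qed.

Lemma contr_mid m1 p m2 t : uniq (ends (m1 ++ p :: m2)) ->
  contr (m1 ++ p :: m2) t = contr (p :: m1 ++ m2) t.
Proof.
rewrite (perm_uniq (ends_perm_mid _ _ _)) /= inE negb_or ends_cat !mem_cat !negb_or.
case/and3P => /andP [_ /andP [h1 _]] /andP [h2 _] _.
by rewrite contr_cat !contr_cons contr_cat (@contr_zt _ _ m1).
Qed.

(** Pairs of a matching have disjoint ends, so [zt_comm] brings any of them to the front, and
    [zt_sym] corrects its orientation. *)
Lemma contr_pmem m m' t : uniq (ends m) -> uniq (ends m') -> pmem m =2 pmem m' ->
  contr m t = contr m' t.
Proof.
elim: m m' t => [|[x y] m IH] m' t u u' h.
  case: m' u' h => // -[x y] m' _ h.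
  by have := h x y; rewrite pmem_cons eqxx.
have : pmem m' x y by rewrite -h pmem_cons eqxx.
move=> hp; have [q [hq hin]] : exists q, (q = (x, y) \/ q = (y, x)) /\ q \in m'.
  by case/orP: hp => hp; [exists (x, y)|exists (y, x)]; auto.
case/splitPr: hin u' h hp => m1 m2 u' h _.
rewrite (contr_mid _ u') !contr_cons (IH (m1 ++ m2)).
- by case: hq => -> //=; rewrite zt_sym.
- by move: u => /= /and3P [].
- by move: u'; rewrite (perm_uniq (ends_perm_mid _ _ _)) => /= /and3P [].
move=> a b; rewrite (pmem_cons_rest a b u) h pmem_mid.
move: u'; rewrite (perm_uniq (ends_perm_mid _ _ _)) => u'.
case: hq => e; subst q; first by rewrite -pmem_cons_rest.
by rewrite (pmem_cons_rest a b u') [(a != x) && _]andbC.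
Qed.

Lemma disj_contr m t u : disj t u -> disj (contr m t) u.
Proof. by elim: m t => // p m IH t d; apply: IH; exact: disj_zt. Qed.

Lemma contr_npl m t u : disj t u -> (forall k, k \in ends m -> chn u k = None) ->
  contr m (np t u) = np (contr m t) u.
Proof.
elim: m t => //= p m IH t d h; rewrite !contr_cons zt_npl ?h ?inE ?eqxx ?orbT //.
by rewrite IH //; [exact: disj_zt|move=> k hk; rewrite h // !inE hk !orbT].
Qed.

Lemma contr_lops m l t : contr m (lops l t) = lops l (contr m t).
Proof. by elim: m t => // p m IH t; rewrite !contr_cons zt_lops IH. Qed.

Definition mapp (f : nat -> nat) m := [seq (f p.1, f p.2) | p <- m].

Lemma contr_ren f m t : injective f -> ren f (contr m t) = contr (mapp f m) (ren f t).
Proof. by move=> fi; elim: m t => //= p m IH t; rewrite !contr_cons IH ren_zt. Qed.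

Lemma chn_contr_other m t k : k \notin ends m -> chn (contr m t) k = chn t k.
Proof.
elim: m t => //= p m IH t; rewrite !inE !negb_or => /and3P [/eqP h1 /eqP h2 h].
by rewrite contr_cons IH // chn_zt_other.
Qed.

Definition mok m t := forall x y, (x, y) \in m -> zok x y t.

Lemma mok_pmem m t x y : mok m t -> pmem m x y -> zok x y t.
Proof. by move=> h /orP [/h|/h/zok_sym]. Qed.

Lemma pmem_mok m t : (forall x y, pmem m x y -> zok x y t) -> mok m t.
Proof. by move=> h x y hm; apply: h; rewrite /pmem hm. Qed.

Lemma mok_zt p m t : uniq (ends (p :: m)) -> mok (p :: m) t -> mok m (zt p.1 p.2 t).
Proof.
case: p => a b /=; rewrite inE negb_or => /and3P [/andP [ab ha] hb _] h x y hxy.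
have /andP [ex ey] := mem_ends2 hxy.
apply/zok_zt; last by apply: h; rewrite inE hxy orbT.
all: by apply/eqP; first [apply: contraNneq ha => <-|apply: contraNneq hb => <-].
Qed.

Lemma chn_contr m t k : uniq (ends m) -> mok m t ->
  chn (contr m t) k = if k \in ends m then None else chn t k.
Proof.
elim: m t => // p m IH t u h; rewrite contr_cons IH; last exact: mok_zt.
  rewrite chn_zt; last by apply: h; rewrite inE -surjective_pairing eqxx.
  by rewrite /= !inE; case: (k \in ends m); rewrite ?orbT // orbF.
by move: u => /= /and3P [].
Qed.

Implicit Types ws : seq (nat * nat * P).

(** An entry [(a, b, c)] stands for a wire with colour [c] at [a] and the dual colour at [b]. *)
Definition wp t ws := foldr (fun w u => np u (wr s w.1.1 w.1.2 w.2)) t ws.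
Definition wl ws := [seq w.1 | w <- ws].

Definition wfresh ws t := uniq (ends (wl ws)) /\ forall k, k \in ends (wl ws) -> chn t k = None.

Lemma wfresh_cons w ws t : wfresh (w :: ws) t -> wfresh ws t.
Proof.
case=> /= /and3P [_ _ u] h; split=> // k hk; apply: h; by rewrite !inE hk !orbT.
Qed.

Lemma disj_wr a b c t : a <> b -> chn t a = None -> chn t b = None -> disj t (wr s a b c).
Proof.
move=> ab ha hb k; rewrite chn_wr //; case: eqP => [->|_]; first by left.
by case: eqP => [->|_]; [left|right].
Qed.

Lemma chn_wp ws t k : wfresh ws t -> k \notin ends (wl ws) -> chn (wp t ws) k = chn t k.
Proof.
elim: ws k => //= w ws IH k /[dup] /wfresh_cons fr [/=].
rewrite !inE !negb_or => /and3P [/andP [/eqP ab ha] hb u] h /and3P [h1 h2 hk].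
rewrite chn_np; last by apply: disj_wr; rewrite ?IH ?h ?inE ?eqxx ?orbT.
by rewrite chn_wr // (negbTE h1) (negbTE h2) IH //; case: (chn t k).
Qed.

Lemma wfresh_hd w ws t : wfresh (w :: ws) t ->
  [/\ w.1.1 <> w.1.2, chn (wp t ws) w.1.1 = None & chn (wp t ws) w.1.2 = None].
Proof.
move=> /[dup] /wfresh_cons fr [/=]; rewrite !inE !negb_or => /and3P [/andP [/eqP ab ha] hb u] h.
by split=> //; rewrite chn_wp ?h ?inE ?eqxx ?orbT.
Qed.

Lemma disj_wp w ws t : wfresh (w :: ws) t -> disj (wp t ws) (wr s w.1.1 w.1.2 w.2).
Proof. by case/wfresh_hd => *; exact: disj_wr. Qed.
End Contraction.
Arguments contr : simpl never.

Lemma Forall2_map_l (T U V : Type) (f : T -> U) (R : U -> V -> Prop) l k :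
  Forall2 (fun x y => R (f x) y) l k -> Forall2 R (map f l) k.
Proof. by elim=> //= x y l' k' h _ IH; constructor. Qed.

Lemma Forall2_weaken (T : eqType) (V : Type) (R R' : T -> V -> Prop) (l : seq T) k :
  (forall x y, x \in l -> R x y -> R' x y) -> Forall2 R l k -> Forall2 R' l k.
Proof.
move=> h f; elim: f h => //= x y l' k' hxy _ IH h; constructor; first by apply: h; rewrite ?inE ?eqxx.
by apply: IH => a b ha; apply: h; rewrite inE ha orbT.
Qed.

(** * Removing wires while tracking connectivity and circles *)

Section Elimination.
Variables (P : palette) (s : CircOp P).
Implicit Types (t u v : nom s) (m : seq (nat * nat)) (l : seq P) (ws : seq (nat * nat * P)).

Definition inner (e : seq (nat * nat)) (W : seq nat) i := forall q, conn e i q -> q \in W.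

(** A transversal [ks] of the components of [e] lying entirely in [W], with colours [Ls] up to the
    involution. When [W] consists of the wire ends, these components are the circles formed by
    wires. *)
Definition reps e (W : seq nat) t (ks : seq nat) (Ls : seq P) :=
  [/\ Forall2 (fun k c => chn t k = Some c \/ chn t k = Some (pinv c)) ks Ls,
      (forall k, k \in ks -> inner e W k),
      (forall i, inner e W i -> exists2 k, k \in ks & conn e i k),
      (forall i j, i \in ks -> j \in ks -> conn e i j -> i = j) & uniq ks].

(** The invariant of elimination: contracting [m] against the wires is contracting [m'] without
    them, up to the loops [L]. Connectivity of the surviving points is recorded because composites
    of diagrams are specified by it; [L] is compared with every system of representatives because
    that specification brings its own. *)
Definition elim_to m ws u m' L :=
  [/\ contr m (wp u ws) = lops L (contr m' u), uniq (ends m'),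
      (forall k, (k \in ends m') = (k \in ends m) && (k \notin ends (wl ws))),
      (forall x y, x \notin ends (wl ws) -> y \notin ends (wl ws) ->
         conn (m ++ wl ws) x y <-> conn m' x y) &
      (forall ks Ls, reps (m ++ wl ws) (ends (wl ws)) (wp u ws) ks Ls -> loops_eqv L Ls)].

Lemma reps_conn e e' W t ks Ls : (forall i j, conn e i j <-> conn e' i j) ->
  reps e W t ks Ls -> reps e' W t ks Ls.
Proof.
move=> h [h1 h2 h3 h4 h5]; split=> // [k hk q /h|i hi|i j hi hj /h]; try exact: h2; try exact: h4.
by have [q /h/hi //|k hk /h] := h3 i; exists k.
Qed.

Lemma elim_pmem m m' ws u m1 L : uniq (ends m) -> uniq (ends m') -> pmem m =2 pmem m' ->
  elim_to m' ws u m1 L -> elim_to m ws u m1 L.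
Proof.
move=> um um' h [h1 h2 h3 h4 h5].
have hc i j : conn (m ++ wl ws) i j <-> conn (m' ++ wl ws) i j.
  by split; apply: conn_sub => {i j} i j; rewrite !pmem_cat h.
split=> //.
- by rewrite (contr_pmem _ um um' h).
- by move=> k; rewrite h3 (pmem_ends h).
- by move=> x y hx hy; rewrite -h4 // hc.
- by move=> ks Ls /(reps_conn hc)/h5.
Qed.

Lemma elim_nil m u : uniq (ends m) -> elim_to m [::] u m [::].
Proof.
move=> um; split=> //= [k|x y _ _|ks Ls].
- by rewrite andbT.
- by rewrite cats0.
case=> f h _ _ _; case: f h => [_|k c ks' Ls' _ _ h]; first exact: loops_eqv_refl.
by have := h k (mem_head _ _) k (conn_refl _ _).
Qed.

(** A wire whose two ends are matched to each other is a circle: it yields one loop, and its ends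
    form one extra component made of wires. A system of representatives therefore loses exactly one
    member, while the rest represent the smaller problem. *)
Lemma elim_loop x y c m0 ws u m' L :
  uniq (ends ((x, y) :: m0)) -> wfresh ((x, y, c) :: ws) u ->
  elim_to m0 ws u m' L ->
  elim_to ((x, y) :: m0) ((x, y, c) :: ws) u m' (c :: L).
Proof.
move=> um fr [h1 h2 h3 h4 h5].
have [/= xy hx hy] := wfresh_hd fr.
have d := disj_wp fr; have /= dw := disj_wp fr.
have [um0 [nx ny]] : uniq (ends m0) /\ (x \notin ends m0 /\ y \notin ends m0).
  by move: um; rewrite /= inE negb_or => /and3P [/andP [_ ->] -> ->].
have [uw [wx wy]] : uniq (ends (wl ws)) /\ (x \notin ends (wl ws) /\ y \notin ends (wl ws)).
  by case: fr => /=; rewrite inE negb_or => /and3P [/andP [_ ->] -> ->].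
have ex : x \notin ends (m0 ++ wl ws) by rewrite ends_cat mem_cat negb_or nx.
have ey : y \notin ends (m0 ++ wl ws) by rewrite ends_cat mem_cat negb_or ny.
have he : pmem (((x, y) :: m0) ++ wl ((x, y, c) :: ws)) =2 pmem [:: (x, y), (x, y) & m0 ++ wl ws].
  move=> i j; rewrite /= !(pmem_cons, pmem_cat) /=.
  by case: (pmem m0 i j); rewrite ?orbT //= !orbA; congr orb; rewrite -!orbA.
have W2 k : k \in ends (wl ((x, y, c) :: ws)) = (k \in [:: x; y]) || (k \in ends (wl ws)).
  by rewrite /= !inE orbA.
have xyW k : k \in ends (wl ws) -> k \notin [:: x; y].
  by move=> hk; rewrite !inE negb_or; apply/andP; split; apply: contraTneq hk => ->.
set e := _ ++ _ in he *.
have [cl [cs [cn cE]]] := (conn_loop he, (conn_loop_sub he, (conn_loop_neq ex ey, conn_loopE ex ey he))).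
split=> //.
- rewrite contr_cons /= np_comm // zt_npl //; last exact: disj_sym.
  have dl := disj_lop (wp u ws) c.
  rewrite zt_wr_self // np_comm; last exact: disj_sym.
  by rewrite contr_npl // => [|k _]; rewrite ?h1 ?chn_lop.
- move=> k; rewrite h3 W2 /= !inE.
  case: eqP => [->|_]; first by rewrite (negbTE nx).
  by case: eqP => [->|_]; first by rewrite (negbTE ny).
- move=> a b; rewrite !W2 !negb_or => /andP [a1 a2] /andP [b1 b2].
  rewrite -h4 //; split; last exact: cs.
  by case/cE => // /andP [h _]; move: h a1; rewrite !inE => /orP [] ->; rewrite ?andbF.
move=> ks Ls [f r1 r2 r3 r4].
have [k kk xk] : exists2 k, k \in ks & conn e x k.
  apply: r2 => q /cE [/conn_ends [<-|/andP [h _]]|/andP [_ h]]; rewrite W2 ?h // ?inE ?eqxx //.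
  by rewrite h in ex.
have kxy : k \in [:: x; y].
  by case/cE: xk => [/conn_ends [<-|/andP [h _]]|/andP [] //]; rewrite ?inE ?eqxx // h in ex *.
have xyk q : q \in [:: x; y] -> conn e q k.
  by rewrite !inE => /orP [] /eqP -> //; apply: conn_trans (conn_sym cl) xk.
case/splitPr: kk f r1 r2 r3 r4 => k1 k2 f r1 r2 r3 r4.
have [l1 [l2' [f1 [f2 ->]]]] := Forall2_app_inv_l _ _ f.
inversion f2 as [|k' col k2' l2 hc f3]; subst.
(* The representative may be either end of the wire, so the recorded colour is [c] or its dual. *)
have kc : col = c \/ col = pinv c.
  have ncw : chn (wp u ((x, y, c) :: ws)) k = Some c \/ chn (wp u ((x, y, c) :: ws)) k = Some (pinv c).
    rewrite /= chn_np // chn_wr //.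
    move: kxy; rewrite !inE => /orP [] /eqP ->; rewrite ?hx ?hy ?eqxx; auto.
    by case: eqP => _; auto.
  case: ncw => E; rewrite E in hc; case: hc => [[e1]|[e1]].
  - by left.
  - by right; rewrite e1 pinvK.
  - by right; rewrite e1.
  - by left; rewrite -(pinvK c) e1 pinvK.
apply: loops_eqv_cons => //; apply: (h5 (k1 ++ k2)).
have nk i : i \in k1 ++ k2 -> i \in k1 ++ k :: k2 by rewrite !mem_cat inE => /orP [->|->]; rewrite ?orbT.
have uk : uniq (k :: k1 ++ k2).
  by rewrite -[k :: _]/([:: k] ++ k1 ++ k2) (perm_uniq (permEl (perm_catCA [:: k] k1 k2))).
have ki i : i \in k1 ++ k2 -> i <> k.
  by move=> h e'; move: uk; rewrite /= -e' h.
have kn i : i \in k1 ++ k2 -> i \notin [:: x; y].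
  move=> h; apply/negP => hi; apply: (ki i) => //.
  by apply: r3; [exact: nk|rewrite mem_cat inE eqxx orbT|exact: xyk].
split=> //.
- apply: (@Forall2_weaken _ _ (fun k c0 => chn (wp u ((x, y, c) :: ws)) k = Some c0 \/ chn (wp u ((x, y, c) :: ws)) k = Some (pinv c0))); last exact: Forall2_app.
  move=> i b hi; rewrite /= chn_np // chn_wr //.
  have := kn i hi; rewrite !inE negb_or => /andP [/negbTE -> /negbTE ->].
  by case: (chn (wp u ws) i).
- move=> i hi q hq; have := r1 i (nk i hi) q (cs _ _ hq).
  by rewrite W2 (negbTE (cn _ _ hq (kn i hi))).
- move=> i hi; have hiW : i \in ends (wl ws) by apply: hi; exact: conn_refl.
  have [q /cE [/hi h|/andP [h _]]|k' + hk] := r2 i; first by rewrite W2 h orbT.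
    by have := xyW _ hiW; rewrite h.
  case/cE: hk => [hk|/andP [h _]]; last by have := xyW _ hiW; rewrite h.
  rewrite mem_cat inE orbCA => /orP [/eqP e'|h]; last by exists k'; rewrite // mem_cat.
  by have := cn _ _ hk (xyW _ hiW); rewrite e' kxy.
- by move=> i j /nk hi /nk hj /cs; exact: r3.
- by case/andP: uk.
Qed.

(** The contractions at both ends of the wire merge into one contraction of [w] with [z], by
    [zt_wr2]. No component disappears, so no loop is produced. *)
Lemma elim_splice x y z w c m1 ws u m' L :
  uniq (ends [:: (x, z), (y, w) & m1]) -> wfresh ((x, y, c) :: ws) u ->
  mok [:: (x, z), (y, w) & m1] (wp u ((x, y, c) :: ws)) ->
  elim_to ((w, z) :: m1) ws u m' L ->
  elim_to [:: (x, z), (y, w) & m1] ((x, y, c) :: ws) u m' L.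
Proof.
move=> um fr ok [h1 h2 h3 h4 h5].
have [/= xy hx hy] := wfresh_hd fr.
have /= dw := disj_wp fr.
have [zx [zy [wx [wy [nx [ny zw]]]]]] : z != x /\ z != y /\ w != x /\ w != y /\ x \notin ends m1 /\ y \notin ends m1 /\ z != w.
  move: um; rewrite /= !inE !negb_or => /and5P [/and4P [xz' xy' xw' x1] /and3P [zy' zw' z1] /andP [yw' y1] _ _].
  by rewrite x1 y1 (eq_sym z x) (eq_sym w x) (eq_sym w y) xz' xw' zy' yw' zw'.
have [uw [xW yW]] : uniq (ends (wl ws)) /\ (x \notin ends (wl ws) /\ y \notin ends (wl ws)).
  by case: fr => /=; rewrite inE negb_or => /and3P [/andP [_ ->] -> ->].
have ex : x \notin ends (m1 ++ wl ws) by rewrite ends_cat mem_cat negb_or nx.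
have ey : y \notin ends (m1 ++ wl ws) by rewrite ends_cat mem_cat negb_or ny.
have he : pmem ([:: (x, z), (y, w) & m1] ++ wl ((x, y, c) :: ws)) =2 pmem [:: (x, z), (y, w), (x, y) & m1 ++ wl ws].
  move=> i j; rewrite /= !(pmem_cons, pmem_cat) /=.
  by case: (pmem m1 i j); rewrite ?orbT //= !orbA; congr orb; rewrite -!orbA.
have W2 k : k \in ends (wl ((x, y, c) :: ws)) = [|| k == x, k == y | k \in ends (wl ws)].
  by rewrite /= !inE.
set tt := wp u ((x, y, c) :: ws) in ok *.
have ttx : chn tt x = Some c by rewrite /tt /= chn_np // hx chn_wr // eqxx.
have tty : chn tt y = Some (pinv c).
  by rewrite /tt /= chn_np // hy chn_wr // eqxx; case: eqP => // e; case: xy.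
have tto k : k != x -> k != y -> chn tt k = chn (wp u ws) k.
  move=> kx ky; rewrite /tt /= chn_np // chn_wr // (negbTE kx) (negbTE ky).
  by case: (chn (wp u ws) k).
have okx : zok x z tt by apply: ok; rewrite inE eqxx.
have oky : zok y w tt by apply: ok; rewrite !inE eqxx orbT.
have tz : chn (wp u ws) z = Some (pinv c).
  by case: okx => _ [c']; rewrite ttx -tto // => -[<-].
have tw : chn (wp u ws) w = Some c.
  by case: oky => _ [c']; rewrite tty -tto // => -[<-]; rewrite pinvK.
have okzw : zok z w (wp u ws).
  by split; [apply/eqP|exists (pinv c); rewrite ?pinvK].
pose f := splice x y z w.
set e := _ ++ _ in he *.
have [sc [sn [sid [us [sp nn]]]]] := (splice_conn he, (splice_neq zx zy wx wy,
  (@splice_id x y z w, (conn_unsplice he, (conn_spliced ex ey zx zy wx wy he,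
   conn_new_neq ex ey zx zy wx wy))))).
split=> //.
- rewrite 2!contr_cons /= zt_sym [zt x z _]zt_sym /tt /=.
  rewrite -[c in wr s x y c]pinvK wr_sym //.
  by rewrite zt_wr2 // -?h1 //; exact: nesym.
- move=> k; rewrite h3 W2 /= !inE !negb_or.
  case: (k =P x) => [->|_].
    by rewrite !(eq_sym x) (negbTE zx) (negbTE wx) (negbTE nx) andbF.
  case: (k =P y) => [->|_].
    by rewrite !(eq_sym y) (negbTE zy) (negbTE wy) (negbTE ny) andbF.
  by rewrite /= orbCA.
- move=> a b; rewrite !W2 !negb_or => /and3P [ax ay aW] /and3P [bx b_y bW].
  rewrite -h4 //; split; last exact: us.
  by move/sp; rewrite !sid.
(* A representative that is an end of the removed wire moves to its partner [z] or [w] in the same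
   component, which has the same colour up to the involution. *)
move=> ks Ls [F r1 r2 r3 r4]; apply: (h5 (map f ks)).
have fW i : inner e (ends (wl ((x, y, c) :: ws))) i -> inner ((w, z) :: m1 ++ wl ws) (ends (wl ws)) (f i).
  move=> hi q hq; have /andP [fx fy] := sn i.
  have /andP [qx qy] := nn _ _ hq fx fy.
  have := hi q; rewrite W2 (negbTE qx) (negbTE qy); apply.
  by apply: (conn_trans (sc i)); apply: us.
have fi i j : i \in ks -> j \in ks -> conn ((w, z) :: m1 ++ wl ws) (f i) (f j) -> i = j.
  move=> hi hj h; apply: r3 => //; apply: conn_trans (sc i) _.
  by apply: conn_trans (us _ _ h) (conn_sym (sc j)).
split.
- apply: Forall2_map_l; apply: Forall2_weaken F => k col hk.
  rewrite /f /splice; case: (k =P x) => [->|/eqP kx].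
    by rewrite ttx tz => -[[->]|[->]]; rewrite ?pinvK; auto.
  case: (k =P y) => [->|/eqP ky]; last by rewrite tto.
  by rewrite tty tw => -[[<-]|[/(congr1 pinv)]]; rewrite !pinvK; [auto|move=> ->; auto].
- by move=> _ /mapP [k hk ->]; apply: fW; exact: r1.
- move=> i hi; have hiW : i \in ends (wl ws) by apply: hi; exact: conn_refl.
  have ix : i != x by apply: contraTneq hiW => ->.
  have iy : i != y by apply: contraTneq hiW => ->.
  have [q /sp|k hk /sp] := r2 i; rewrite sid // => hq.
    have := hi _ hq; rewrite W2 /splice; case: eqP => //= _; case: eqP => //=.
  by exists (f k); rewrite ?map_f.
- by move=> _ _ /mapP [i hi ->] /mapP [j hj ->] /fi -> .
by rewrite map_inj_in_uniq // => i j hi hj h; apply: fi => //; rewrite h; exact: conn_refl.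
Qed.

(** Induction on the wires. Both ends of a wire occur in the matching: if they are partners of each
    other, [elim_loop] applies; otherwise their partners are two further points and [elim_splice]
    applies. *)
Theorem wire_elimination ws m u :
  uniq (ends m) -> wfresh ws u -> {subset ends (wl ws) <= ends m} -> mok m (wp u ws) ->
  exists m' L, elim_to m ws u m' L.
Proof.
elim: ws m => [|[[x y] c] ws IH] m um fr sub ok.
  by exists m, [::]; exact: elim_nil.
have [/= xy hx hy] := wfresh_hd fr.
have /= dw := disj_wp fr.
have ex : x \in ends m by apply: sub; rewrite /= inE eqxx.
have ey : y \in ends m by apply: sub; rewrite /= !inE eqxx orbT.
have [z [m0 [um0 hm]]] := ends_extract um ex.
have wn k : k \in ends (wl ws) -> (k != x) && (k != y).
  case: fr => /=; rewrite inE negb_or => /and3P [/andP [_ h1] h2 _] _ hk.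
  by apply/andP; split; apply: contraTneq hk => ->.
have chn0 k : k != x -> k != y -> chn (wp u ws) k = chn (wp u ((x, y, c) :: ws)) k.
  move=> kx ky; rewrite /= chn_np // chn_wr // (negbTE kx) (negbTE ky).
  by case: (chn (wp u ws) k).
have zok0 a b : a != x -> a != y -> b != x -> b != y ->
    zok a b (wp u ((x, y, c) :: ws)) -> zok a b (wp u ws).
  by move=> *; rewrite /zok !chn0.
case: (z =P y) => [e|/eqP zy].
  subst z.
  have [m' [L h]] : exists m' L, elim_to m0 ws u m' L.
    apply: IH; [|exact: wfresh_cons fr| |].
    - by move: um0 => /= /and3P [].
    - move=> k hk; have /andP [/negbTE kx /negbTE ky] := wn k hk.
      have := sub k; rewrite (pmem_ends hm) /= !inE kx ky /= => -> //.
    - move=> a b hab; have pab : pmem m0 a b by rewrite /pmem hab.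
      have := pmem_cons_rest a b um0; rewrite pab => /esym /and3P [pm' ax ay].
      have pba : pmem m0 b a by rewrite pmem_sym.
      have := pmem_cons_rest b a um0; rewrite pba => /esym /and3P [_ bx b_y].
      by apply: zok0 => //; apply: (mok_pmem ok); rewrite hm.
  exists m', (c :: L); apply: (elim_pmem um um0 hm); exact: (elim_loop um0 fr h).
have ey0 : y \in ends m0.
  move: ey; rewrite (pmem_ends hm) /= !inE (eq_sym y z) (negbTE zy) /= => /orP [/eqP e|//].
  by case: xy; rewrite e.
have um0' : uniq (ends m0) by move: um0 => /= /and3P [].
have [w [m1 [um1 hm1]]] := ends_extract um0' ey0.
have hm2 : pmem m =2 pmem [:: (x, z), (y, w) & m1].
  by move=> a b; rewrite hm [LHS]pmem_cons (hm1 a b) -pmem_cons.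
have um2 : uniq (ends [:: (x, z), (y, w) & m1]).
  move: um0 um1; rewrite /= !inE !negb_or !(pmem_ends hm1) /= !inE !negb_or => /and3P [-> -> _].
  by case/and3P => -> -> ->.
have ok2 : mok [:: (x, z), (y, w) & m1] (wp u ((x, y, c) :: ws)).
  by apply: pmem_mok => a b; rewrite -hm2; exact: mok_pmem.
have [h1 h2] : zok x z (wp u ((x, y, c) :: ws)) /\ zok y w (wp u ((x, y, c) :: ws)).
  by split; apply: ok2; rewrite !inE eqxx ?orbT.
have ttx : chn (wp u ((x, y, c) :: ws)) x = Some c by rewrite /= chn_np // hx chn_wr // eqxx.
have tty : chn (wp u ((x, y, c) :: ws)) y = Some (pinv c).
  by rewrite /= chn_np // hy chn_wr // eqxx; case: eqP => // e; case: xy.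
have := um2; rewrite /= !inE !negb_or => /and5P [/and4P [xz xy' xw nx] /and3P [_ zw nz] /andP [yw ny] nw u1].
have [m' [L h]] : exists m' L, elim_to ((w, z) :: m1) ws u m' L.
  apply: IH; [|exact: wfresh_cons fr| |].
  - by rewrite /= !inE !negb_or nw nz u1 (eq_sym w) zw.
  - move=> k hk; have /andP [/negbTE kx /negbTE ky] := wn k hk.
    have := sub k; rewrite (pmem_ends hm2) /= !inE kx ky /= hk.
    by rewrite orbCA; apply.
  - apply: pmem_mok => a b; rewrite pmem_cons => /or3P [/eqP [-> ->]|/eqP [-> ->]|hab].
    + apply: zok_sym; split; first exact/eqP; exists (pinv c); rewrite ?pinvK chn0 // 1?eq_sym //.
        by case: h1 => _ [c']; rewrite ttx => -[<-].
      by case: h2 => _ [c']; rewrite tty => -[<-]; rewrite pinvK.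
    + split; first exact/eqP; exists (pinv c); rewrite ?pinvK chn0 // 1?eq_sym //.
        by case: h1 => _ [c']; rewrite ttx => -[<-].
      by case: h2 => _ [c']; rewrite tty => -[<-]; rewrite pinvK.
    + have ea := mem_ends hab; have eb : b \in ends m1 by apply: (@mem_ends _ _ a); rewrite pmem_sym.
      apply: zok0; try by [apply: contraTneq ea => ->|apply: contraTneq eb => ->].
      by apply: (mok_pmem ok2); rewrite !pmem_cons hab !orbT.
exists m', L; apply: (elim_pmem um um2 hm2); exact: (elim_splice um2 fr ok2 h).
Qed.
End Elimination.

(** * The action of Brauer diagrams *)

Definition pairing (N : nat) (p : nat -> nat) :=
  forall i, i < N -> p i < N /\ p i <> i /\ p (p i) = i.

Definition prs (p : nat -> nat) N := [seq (i, p i) | i <- iota 0 N & i < p i].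

Lemma mem_prs p N x y : ((x, y) \in prs p N) = [&& x < N, x < p x & y == p x].
Proof.
apply/mapP/and3P => [[i]|[h1 h2 /eqP ->]].
  by rewrite mem_filter mem_iota => /andP [h1 h2] [-> ->]; rewrite eqxx.
by exists x => //; rewrite mem_filter mem_iota h2.
Qed.

Lemma pmem_prs p N x y : pairing N p -> pmem (prs p N) x y = (x < N) && (y == p x).
Proof.
move=> hp; rewrite /pmem !mem_prs; apply/idP/idP.
  case/orP => /and3P [h1 h2 /eqP ->]; rewrite ?h1 ?eqxx //.
  by have [h3 [_ h4]] := hp _ h1; rewrite h3 h4 eqxx.
case/andP => h1 /eqP ->; have [h2 [h3 h4]] := hp _ h1.
rewrite h1 h2 h4 !eqxx !andbT /=; lia.
Qed.

Lemma mem_ends_prs p N x : pairing N p -> (x \in ends (prs p N)) = (x < N).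
Proof.
move=> hp; apply/endsP/idP => [[y]|h]; first by rewrite pmem_prs // => /andP [].
by exists (p x); rewrite pmem_prs // h eqxx.
Qed.

Lemma ends_uniq_map (l : seq nat) (f : nat -> nat) :
  uniq l -> (forall i j, i \in l -> j \in l -> f i = f j -> i = j) ->
  (forall i j, i \in l -> j \in l -> i <> f j) -> uniq (ends [seq (i, f i) | i <- l]).
Proof.
elim: l => //= i l IH /andP [il ul] fi fn.
have E x : (x \in ends [seq (i, f i) | i <- l]) -> exists2 j, j \in l & x = j \/ x = f j.
  by case/endsP => y /orP [] /mapP [j hj [ex ey]]; exists j => //; auto.
rewrite inE negb_or; apply/and3P; split.
- apply/andP; split; first by apply/eqP; apply: fn; rewrite inE eqxx.
  apply/negP => /E [j hj [e|e]]; first by rewrite e hj in il.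
  by apply: (fn i j) => //; rewrite inE ?eqxx // hj orbT.
- apply/negP => /E [j hj [e|e]].
    by apply: (fn j i) => //; rewrite inE ?eqxx // hj orbT.
  have ij : i = j by apply: fi => //; rewrite inE ?eqxx // hj orbT.
  by rewrite ij hj in il.
apply: IH => // [j k hj hk|j k hj hk]; [apply: fi|apply: fn]; by rewrite inE ?hj ?hk orbT.
Qed.

Lemma uniq_prs p N : pairing N p -> uniq (ends (prs p N)).
Proof.
move=> hp; apply: ends_uniq_map => [|i j|i j].
- by rewrite filter_uniq // iota_uniq.
- rewrite !mem_filter !mem_iota => /andP [_ /= h1] /andP [_ /= h2] e.
  have [_ [_ e1]] := hp _ h1; have [_ [_ e2]] := hp _ h2.
  by rewrite -e1 e e2.
rewrite !mem_filter !mem_iota => /andP [h0 /= h1] /andP [h2 /= h3] e.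
have [_ [_ e2]] := hp _ h3; move: h0; rewrite e e2; lia.
Qed.

Lemma ends_mapp f m : ends (mapp f m) = map f (ends m).
Proof. by elim: m => //= p m ->. Qed.

Lemma pmem_mapp f m x y : pmem (mapp f m) x y <-> exists i j, [/\ x = f i, y = f j & pmem m i j].
Proof.
split.
  by case/orP => /mapP [[i j] h [-> ->]]; [exists i, j|exists j, i]; rewrite /pmem h ?orbT.
case=> i [j [-> -> /orP [] h]]; rewrite /pmem; [apply/orP; left|apply/orP; right].
  by apply: (map_f (fun p => (f p.1, f p.2)) h).
by apply: (map_f (fun p => (f p.1, f p.2)) h).
Qed.

(** * Wires at the target points and evaluation of a diagram *)

Section Wires.
Variables (P : palette) (s : CircOp P).
Implicit Types (t u v : nom s) (m : seq (nat * nat)) (c d e : seq P) (ws : seq (nat * nat * P)).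

(** The [j]-th wire runs from the inner end [i + j] to the outer end [o + j]. The inner end carries
    the dual of the target colour, because contraction joins dual colours; the outer end then
    carries the target colour itself. *)
Fixpoint wires (i o : nat) d : seq (nat * nat * P) :=
  if d is c :: d' then (i, o, pinv c) :: wires i.+1 o.+1 d' else [::].

Lemma mem_wires i o d x y : ((x, y) \in wl (wires i o d)) = [&& i <= x, x < i + size d & y == o + (x - i)].
Proof.
elim: d i o => [|c d IH] i o /=; first by rewrite in_nil; lia.
rewrite inE IH xpair_eqE; lia.
Qed.

Lemma mem_ends_wires i o d k :
  (k \in ends (wl (wires i o d))) = (i <= k < i + size d) || (o <= k < o + size d).
Proof. elim: d i o => [|c d IH] i o //=; rewrite ?in_nil ?inE ?IH; lia. Qed.

Lemma uniq_wires i o d : i + size d <= o -> uniq (ends (wl (wires i o d))).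
Proof.
elim: d i o => [|c d IH] i o //= h; rewrite IH ?andbT; last lia.
rewrite inE !mem_ends_wires; lia.
Qed.

Lemma wfresh_wires i o d t : i + size d <= o ->
  (forall k, (i <= k < i + size d) || (o <= k < o + size d) -> chn t k = None) ->
  wfresh (wires i o d) t.
Proof. by move=> h hf; split=> [|k]; [exact: uniq_wires|rewrite mem_ends_wires; exact: hf]. Qed.

Lemma chn_wires i o d t k : wfresh (wires i o d) t ->
  chn (wp t (wires i o d)) k =
  if i <= k < i + size d then omap pinv (onth d (k - i)) else
  if o <= k < o + size d then onth d (k - o) else chn t k.
Proof.
elim: d i o => [|c d IH] i o fr; rewrite ?[wp _ _]/=.
  by rewrite !ifF //=; lia.
have /= d1 := disj_wp fr; have [/= io hi ho] := wfresh_hd fr.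
have [/= u _] := fr.
rewrite chn_np // chn_wr // pinvK.
case: (k =P i) => [->|ki].
  by rewrite hi subnn ifT //=; lia.
case: (k =P o) => [->|ko].
  rewrite ho ifF; last by move: u; rewrite !inE !negb_or !mem_ends_wires; lia.
  by rewrite ifT ?subnn //=; lia.
rewrite IH; last exact: wfresh_cons fr.
clear hi ho.
have [hi|hi] := boolP (i.+1 <= k < i.+1 + size d).
  rewrite [RHS]ifT; last lia.
  have -> : k - i = (k - i.+1).+1 by lia.
  by rewrite /=; case: (onth d _).
rewrite [X in _ = X]ifF; last by move: hi; lia.
have [ho|ho] := boolP (o.+1 <= k < o.+1 + size d).
  rewrite [RHS]ifT; last lia.
  have -> : k - o = (k - o.+1).+1 by lia.
  by rewrite /=; case: (onth d _).
rewrite [X in _ = X]ifF; last by move: ho; lia.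
by case: (chn t k).
Qed.

Lemma wp_np ws t : wfresh ws t -> disj t (wp (nu s) ws) /\ wp t ws = np t (wp (nu s) ws).
Proof.
move=> fr; have fr0 : wfresh ws (nu s) by case: fr => u _; split=> // k _; exact: chn_nu.
have : disj t (wp (nu s) ws).
  move=> k; have [h|h] := boolP (k \in ends (wl ws)); first by left; apply: (proj2 fr).
  by right; rewrite chn_wp // chn_nu.
move=> d; split=> //; elim: ws fr fr0 d => [|w ws IH] fr fr0 d /=; first by rewrite np_nu.
have d1 : disj t (wp (nu s) ws).
  move=> k; case: (d k) => [|/=]; auto; rewrite chn_np_None; first by case; auto.
  exact: disj_wp fr0.
rewrite IH //; try exact: wfresh_cons fr || exact: wfresh_cons fr0.
rewrite np_assoc //; last exact: disj_wp fr0.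
move=> k; case: (d k) => [|/=]; auto; rewrite chn_np_None; first by case; auto.
exact: disj_wp fr0.
Qed.

Lemma wfresh_wp ws1 ws2 t : wfresh ws1 t -> wfresh ws2 t ->
  (forall k, k \in ends (wl ws1) -> k \notin ends (wl ws2)) -> wfresh ws2 (wp t ws1).
Proof.
move=> f1 f2 h; split=> [|k hk]; first by case: f2.
rewrite chn_wp //; first by apply: (proj2 f2).
by apply/negP => /h; rewrite hk.
Qed.

Lemma wp_comm ws1 ws2 t : wfresh ws1 t -> wfresh ws2 t ->
  (forall k, k \in ends (wl ws1) -> k \notin ends (wl ws2)) ->
  wp (wp t ws1) ws2 = wp (wp t ws2) ws1.
Proof.
move=> f1 f2 h.
have f12 := wfresh_wp f1 f2 h.
have f21 : wfresh ws1 (wp t ws2).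
  by apply: wfresh_wp => // k hk; apply/negP => /h; rewrite hk.
have [d1 e1] := wp_np f1; have [d2 e2] := wp_np f2.
have [d12 e12] := wp_np f12; have [d21 e21] := wp_np f21.
rewrite e12 e21 e1 e2.
have d : disj (wp (nu s) ws1) (wp (nu s) ws2).
  by move=> k; case: (d12 k) => hk; auto; left; move: hk; rewrite e1 chn_np_None // => -[].
rewrite !np_assoc //; last exact: disj_sym.
by rewrite (np_comm d).
Qed.

Lemma contr_wp m ws t : wfresh ws t -> (forall k, k \in ends m -> k \notin ends (wl ws)) ->
  contr m (wp t ws) = wp (contr m t) ws.
Proof.
elim: ws => //= w ws IH fr h.
rewrite contr_npl; first by rewrite IH //; [exact: wfresh_cons fr|move=> k /h; rewrite !inE !negb_or => /and3P []].
  exact: disj_wp.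
move=> k /h; rewrite !inE !negb_or => /and3P [h1 h2 _]; rewrite chn_wr ?(negbTE h1) ?(negbTE h2) //.
by case: (wfresh_hd fr).
Qed.

Lemma wp_lops ws l t : wfresh ws t -> wp (lops l t) ws = lops l (wp t ws).
Proof.
elim: ws => //= w ws IH fr; rewrite IH; last exact: wfresh_cons fr.
rewrite np_lops //; exact: disj_wp.
Qed.

Definition mapw (f : nat -> nat) ws : seq (nat * nat * P) := [seq (f w.1.1, f w.1.2, w.2) | w <- ws].

Lemma ren_wp f ws t : injective f -> wfresh ws t -> ren f (wp t ws) = wp (ren f t) (mapw f ws).
Proof.
move=> fi; elim: ws => //= w ws IH fr; have [h1 h2 h3] := wfresh_hd fr.
rewrite ren_np; [|exact: disj_wp|exact: inj_rinj].
by rewrite IH ?ren_wr //; [move/fi|exact: wfresh_cons fr].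
Qed.

Lemma mapw_wires f i o i' o' d : (forall j, j < size d -> f (i + j) = i' + j /\ f (o + j) = o' + j) ->
  mapw f (wires i o d) = wires i' o' d.
Proof.
elim: d i o i' o' => //= c d IH i o i' o' h.
have [] := h 0 isT; rewrite !addn0 => -> ->; congr cons; apply: IH => j hj.
have [] := h j.+1 hj; by rewrite !addSnnS.
Qed.

Definition relab (xs : seq nat) o n := if n \in xs then o + index n xs else n.

Lemma rinj_relab xs o t : (forall j, j < size xs -> chn t (o + j) = None) -> rinj (relab xs o) t.
Proof.
move=> h k l hk hl; rewrite /relab; case: ifP => kx; case: ifP => lx //.
- by move/addnI => e; rewrite -(nth_index 0 kx) e nth_index.
- by move=> e; case: hl; rewrite -e h // index_mem.
- by move=> e; case: hk; rewrite e h // index_mem.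
Qed.

(** Iterates [zt_wr]: each input in [xs] absorbs one wire and takes over the name of its outer
    end. *)
Lemma contr_relabel xs i o d t : size xs = size d -> uniq xs -> i + size d <= o ->
  (forall k, (i <= k < i + size d) || (o <= k < o + size d) -> chn t k = None) ->
  (forall j, j < size d -> chn t (nth 0 xs j) = onth d j) ->
  contr (zip xs (iota i (size d))) (wp t (wires i o d)) = ren (relab xs o) t.
Proof.
elim: d xs i o => [|c d IH] [|x xs] i o //=; first by move=> *; rewrite ren_id.
move=> [es] /andP [xx ux] io hf hc.
have fr : wfresh ((i, o, pinv c) :: wires i.+1 o.+1 d) t by exact: (@wfresh_wires i o (c :: d)).
have [/= h1 h2 h3] := wfresh_hd fr.
have fr' := wfresh_cons fr.
have hx : chn t x = Some c by apply: (hc 0).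
have xf k : (i <= k < i + (size d).+1) || (o <= k < o + (size d).+1) -> x <> k.
  by move=> hk e; rewrite e hf in hx.
have xe : x \notin ends (wl (wires i.+1 o.+1 d)).
  rewrite mem_ends_wires; apply/negP => h; apply: (xf x) => //; lia.
have ux0 : chn (wp t (wires i.+1 o.+1 d)) x = Some c by rewrite chn_wp.
rewrite contr_cons /= wr_sym // zt_wr //; last exact: nesym.
set u0 := wp t _ in h2 h3 ux0 *.
have xo : x <> o by apply: xf; lia.
(* Replacing the renaming by a transposition makes it injective on all numbers, so it can be moved
   past the remaining contractions, whose pairs it fixes. *)
rewrite (ren_ext (g := transp x o)); first last.
- by move=> k hk; rewrite /upd /transp; case: eqP => // _; case: eqP => // e; case: hk; rewrite e.
- move=> k l hk hl; rewrite /upd; case: eqP => [->|_]; case: eqP => [->|_] //.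
    by move=> e; case: hl; rewrite -e.
  by move=> e; case: hk; rewrite e.
have hm : mapp (transp x o) (zip xs (iota i.+1 (size d))) = zip xs (iota i.+1 (size d)).
  apply: map_id_in => -[a b] /= hab.
  have ha : a \in xs.
    by rewrite -(@unzip1_zip _ _ xs (iota i.+1 (size d))) ?size_iota ?es // (map_f fst hab).
  have hb : b \in iota i.+1 (size d).
    by rewrite -(@unzip2_zip _ _ xs (iota i.+1 (size d))) ?size_iota ?es // (map_f snd hab).
  move: hb; rewrite mem_iota => hb.
  have bx : x <> b by apply: xf; lia.
  have ax : a <> x by move=> e; rewrite -e ha in xx.
  have ao : a <> o.
    move=> e; rewrite e in ha; have hj : index o xs < size d by rewrite -es index_mem.
    have := hc (index o xs).+1; rewrite ltnS => /(_ hj); rewrite /= nth_index // hf; last lia.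
    by move: hj; rewrite -onthTE; case: (onth d _).
  by rewrite /transp; congr pair; do ! case: eqP; lia.
rewrite -hm -contr_ren; last exact: transp_inj.
have ri : rinj (relab xs o.+1) t.
  by apply: rinj_relab => j hj; apply: hf; lia.
rewrite /u0 IH //; [|lia|by move=> k hk; apply: hf; lia|by move=> j hj; exact: (hc j.+1)].
have rc : rinj (transp x o \o relab xs o.+1) t by move=> k l hk hl /transp_inj; exact: ri.
rewrite ren_comp //; apply: ren_ext => // k hk.
have ko : k <> o by move=> e; case: hk; rewrite e hf //; lia.
rewrite /= /relab inE; case: (k =P x) => [->|kx].
  by rewrite (negbTE xx) /= eqxx /transp eqxx addn0.
rewrite orFb; case: ifP => kxs; last by rewrite /transp; do ! case: eqP; lia.
have hj : index k xs < size d by rewrite -es index_mem.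
rewrite /= (_ : x == k = false); last by apply/eqP; exact: nesym.
have : x <> o.+1 + index k xs by apply: xf; lia.
rewrite /transp; do ! case: eqP; lia.
Qed.

(** Sources are named from [0] and the inner ends of the wires from [size c], so the boundary
    numbering of the diagram serves verbatim as a matching of names. The outer ends follow from
    [size c + size d] on. *)
Definition raw c d (f : BDiag c d) t :=
  contr (prs (bpair f) (size c + size d)) (wp t (wires (size c) (size c + size d) d)).

(** For typed [t] only outer ends survive in [raw f t], all named at least [size c + size d], so the
    truncated subtraction is injective on its names. *)
Definition ev c d (f : BDiag c d) t :=
  lops (bloops f) (ren (subn^~ (size c + size d)) (raw f t)).

Definition typed c t := forall k, chn t k = onth c k.

Lemma typed_names c t k : typed c t -> chn t k <> None <-> k < size c.
Proof. by move=> h; rewrite h -onthTE; case: (onth c k). Qed.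

Lemma typed_None c t k : typed c t -> size c <= k -> chn t k = None.
Proof. by move=> h hk; rewrite h onth_default. Qed.

Lemma bd_pairing c d (f : BDiag c d) : pairing (size c + size d) (bpair f).
Proof. by case: (bpair_ok f). Qed.

Lemma wfresh_typed c d t : typed c t -> wfresh (wires (size c) (size c + size d) d) t.
Proof. by move=> h; apply: wfresh_wires => // k hk; apply: (typed_None h); lia. Qed.

Lemma chn_wires_typed c d t k : typed c t ->
  chn (wp t (wires (size c) (size c + size d) d)) k =
  if k < size c then onth c k else if k < size c + size d then omap pinv (onth d (k - size c))
  else onth d (k - (size c + size d)).
Proof.
move=> h; rewrite chn_wires; last exact: wfresh_typed.
rewrite h; case: (ltnP k (size c)) => h1; first by rewrite !ifF //; lia.
case: (ltnP k (size c + size d)) => h2 /=; first by [].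
case: ifP => // h3; rewrite !onth_default //; lia.
Qed.

(** Inner ends carry dual colours: equal colours across the diagram thus become dual, and dual
    colours on the target side stay dual. In each of the four cases the colour condition of [bd_ok]
    is contractibility. *)
Lemma mok_typed c d (f : BDiag c d) t : typed c t ->
  mok (prs (bpair f) (size c + size d)) (wp t (wires (size c) (size c + size d) d)).
Proof.
move=> h x y; rewrite mem_prs => /and3P [hx hxp /eqP ->].
have hp := bd_pairing f; have [p1 [p2 p3]] := hp _ hx.
have [_ [_ /(_ x hx) hcol]] := bpair_ok f.
split; first by exact/nesym.
rewrite !chn_wires_typed // hx p1.
move: hcol; rewrite !onth_cat.
have : onth (c ++ d) x by rewrite onthTE size_cat.
rewrite onth_cat; case: ifP => h1; case: ifP => h2 /=.
- by case: (onth c x) => // a _ ->; exists a.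
- by case: (onth c x) => // a _ ->; exists a.
- by case: (onth d (x - size c)) => //= a _ ->; exists (pinv a); rewrite /= ?pinvK.
- by case: (onth d (x - size c)) => //= a _ ->; exists (pinv a); rewrite /= ?pinvK.
Qed.

Lemma chn_raw c d (f : BDiag c d) t k : typed c t ->
  chn (raw f t) k = if k < size c + size d then None else onth d (k - (size c + size d)).
Proof.
move=> h; rewrite chn_contr; [|exact/uniq_prs/bd_pairing|exact: mok_typed].
rewrite mem_ends_prs; last exact: bd_pairing.
case: ifP => // hk; rewrite chn_wires_typed // hk ifF //; lia.
Qed.

Lemma rinj_sub_raw c d (f : BDiag c d) t : typed c t -> rinj (subn^~ (size c + size d)) (raw f t).
Proof. by move=> h k l; rewrite !chn_raw //; do 2 case: ltnP => //; lia. Qed.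

Lemma typed_ev c d (f : BDiag c d) t : typed c t -> typed d (ev f t).
Proof.
move=> h k; rewrite /ev chn_lops.
have [[l [<- hl] ->]|[h1 ->]] := chn_renP k (@rinj_sub_raw _ _ f _ h).
  by move: hl; rewrite !chn_raw //; case: ltnP.
case E: (onth d k) => [a|//].
have := h1 (k + (size c + size d)); rewrite chn_raw // ltnNge leq_addl /= addnK E.
by case.
Qed.

Lemma ev_eqv c d (f f' : BDiag c d) t : BDeq f f' -> ev f t = ev f' t.
Proof.
case=> h1 h2; rewrite /ev (lops_eqv _ h2); congr (lops _ (ren _ _)).
rewrite /raw; congr contr; rewrite /prs (eq_filter (a2 := fun i => i < bpair f' i)).
  by apply: eq_map => i; rewrite h1.
by move=> i; rewrite h1.
Qed.

(* When every target point is joined to a source point, the wires only rename. *)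
Lemma ev_cupless c d (f : BDiag c d) t m : typed c t ->
  (forall j, j < size d -> bpair f (size c + j) < size c) ->
  uniq (ends m) ->
  (forall x y, pmem m x y = [&& x < size c, y < size c & y == bpair f x]) ->
  ev f t = lops (bloops f) (ren (fun n => bpair f n - size c) (contr m t)).
Proof.
set a := size c; set b := size d; set p := bpair f => ht hcup um hm.
have hp : pairing (a + b) p := bd_pairing f.
(* The source joined to each target point. The matching splits into [m], inside the source, and the
   pairs of [xs] with the inner wire ends; the latter are absorbed by [contr_relabel]. *)
pose xs := [seq p (a + j) | j <- iota 0 b].
have em k : (k \in ends m) = (k < a) && (p k < a).
  apply/endsP/andP => [[y]|[h1 h2]]; first by rewrite hm => /and3P [h1 h2 /eqP <-].
  by exists (p k); rewrite hm h1 h2 eqxx.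
have sxs : size xs = b by rewrite size_map size_iota.
have uxs : uniq xs.
  rewrite map_inj_in_uniq ?iota_uniq // => i j; rewrite !mem_iota => hi hj e.
  have [_ [_ e1]] := hp (a + i) ltac:(lia); have [_ [_ e2]] := hp (a + j) ltac:(lia).
  by apply: (@addnI a); rewrite -e1 e e2.
have nxs j : j < b -> nth 0 xs j = p (a + j).
  by move=> hj; rewrite (nth_map 0) ?size_iota // nth_iota.
have xsP k : (k \in xs) = (k < a) && (a <= p k).
  apply/mapP/andP => [[j]|[h1 h2]].
    rewrite mem_iota => hj ->; have [_ [_ ->]] := hp (a + j) ltac:(lia).
    by rewrite hcup; lia.
  have [h3 [_ h4]] := hp k (ltn_addr _ h1).
  by exists (p k - a); rewrite ?mem_iota ?subnKC ?h4 //; lia.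
have ixs k : k \in xs -> index k xs = p k - a.
  rewrite xsP => /andP [h1 h2]; have [h3 [_ h4]] := hp k (ltn_addr _ h1).
  have hj : p k - a < b by lia.
  by rewrite -[in LHS]h4 -(subnKC h2) -nxs // index_uniq ?sxs // subnKC.
have ez : perm_eq (ends (zip xs (iota a b))) (xs ++ iota a b).
  have : size xs = size (iota a b) by rewrite size_iota.
  elim: (xs) (iota a b) => [|x l IH] [|y l'] //= [/IH h].
  rewrite perm_cons -cat1s -[_ :: l']cat1s perm_sym perm_catCA perm_cat2l perm_sym //.
have u1 : uniq (ends (m ++ zip xs (iota a b))).
  rewrite ends_cat cat_uniq um (perm_uniq ez) cat_uniq uxs iota_uniq andbT /=.
  apply/andP; split; apply/hasPn => k.
    rewrite (perm_mem ez) mem_cat xsP mem_iota /= em; lia.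
  rewrite mem_iota /= xsP; lia.
have pz x y : pmem (zip xs (iota a b)) x y = ((x < a) && (a <= p x) && (y == p x)) || ((y < a) && (a <= p y) && (x == p y)).
  have H n k : ((n, k) \in zip xs (iota a b)) = (n < a) && (a <= p n) && (k == p n).
    apply/(nthP (0, 0))/idP => [[j]|/andP []].
      rewrite size1_zip ?sxs ?size_iota // => hj; rewrite nth_zip ?size_iota // nxs // nth_iota // => -[<- <-].
      have [_ [_ ->]] := hp (a + j) ltac:(lia); rewrite hcup // eqxx; lia.
    rewrite -xsP => hu /eqP ->; exists (index n xs); first by rewrite size1_zip ?index_mem // size_iota sxs.
    rewrite nth_zip ?size_iota // nth_index // nth_iota; last by rewrite -sxs index_mem.
    by rewrite ixs // subnKC //; move: hu; rewrite xsP => /andP [].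
  by rewrite /pmem !H.
have hf : wfresh (wires a (a + b) d) t by exact: wfresh_typed.
rewrite /ev /raw -/a -/b -/p; congr lops.
rewrite (contr_pmem _ (uniq_prs hp) u1); last first.
  move=> x y; rewrite pmem_prs // pmem_cat hm pz.
  case: (ltnP x a) => xa /=.
    rewrite ltn_addr //=; have [h1 [h2 h3]] := hp x (ltn_addr _ xa).
    case: (y =P p x) => [->|n]; rewrite ?andbT ?andbF /=.
      by case: ltnP; rewrite ?orbT //= => ->; rewrite orbT.
    apply/esym/negP => /andP [/andP [h4 h5] /eqP e].
    by have [_ [_ h6]] := hp y (ltn_addr _ h4); apply: n; rewrite e h6.
  have [xb|xb] := ltnP x (a + b); last first.
    apply/esym/negP => /andP [/andP [h4 h5] /eqP e].
    by have [h6 _] := hp y (ltn_addr _ h4); lia.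
  have := hcup (x - a) ltac:(lia); rewrite subnKC // => hx.
  have [_ [_ h3]] := hp x xb.
  apply/eqP/andP => [->|[/andP [h4 h5] /eqP e]]; first by rewrite h3 hx eqxx.
  by have [_ [_ h6]] := hp y (ltn_addr _ h4); rewrite e h6.
rewrite contr_cat contr_wp //; last first.
  by move=> k; rewrite em mem_ends_wires; lia.
have ch1 k : ~~ ((k < a) && (p k < a)) -> chn (contr m t) k = onth c k.
  by rewrite -em => h; rewrite chn_contr_other.
have mk : mok m t.
  apply: pmem_mok => x y; rewrite hm => /and3P [hx hy /eqP e]; subst y.
  have ok := @mok_typed _ _ f _ ht; have := mok_pmem ok (x := x) (y := p x).
  rewrite pmem_prs // ltn_addr // eqxx => /(_ isT) [n [q]].
  by rewrite !chn_wires_typed // hx hy => h1 h2; split=> //; exists q; rewrite ht.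
have chm k : chn (contr m t) k = if (k < a) && (p k < a) then None else onth c k.
  by rewrite chn_contr // em ht.
rewrite contr_relabel //; first last.
- move=> j hj; rewrite nxs // chm.
  have [h1 [_ h3]] := hp (a + j) ltac:(lia); rewrite h3 hcup // ifF; last lia.
  have := @mok_typed _ _ f _ ht; rewrite -/a -/b -/p => ok.
  have := mok_pmem ok (x := p (a + j)) (y := a + j).
  rewrite pmem_prs // h1 h3 eqxx => /(_ isT) [n [q]].
  rewrite !chn_wires_typed // -/a -/b hcup // (_ : (a + j < a) = false); last lia.
  rewrite (_ : (a + j < a + b) = true); last lia.
  rewrite addKn => -> ; case: (onth d j) => //= z [e].
  by rewrite -(pinvK q) -e pinvK.
- move=> k hk; rewrite chm; case: ifP => // _; apply: onth_default; rewrite -/a; lia.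
have ri : rinj (relab xs (a + b)) (contr m t).
  apply: rinj_relab => j hj; rewrite chm ifF; last lia.
  apply: onth_default; rewrite -/a; lia.
have nm k : chn (contr m t) k <> None -> k \in xs.
  rewrite chm xsP; case: ifP => // h1 h2.
  have ka : k < a by apply/(typed_names k ht); rewrite ht.
  by rewrite ka; move: h1; rewrite ka; lia.
have E k : chn (contr m t) k <> None -> relab xs (a + b) k - (a + b) = p k - a.
  by move/nm => h; rewrite /relab h ixs //; lia.
have rr : rinj (subn^~ (a + b) \o relab xs (a + b)) (contr m t).
  move=> k l hk hl /=; rewrite !E // => e.
  have := nm _ hk; have := nm _ hl; rewrite !xsP => /andP [l1 l2] /andP [k1 k2].
  have [_ [_ e1]] := hp k (ltn_addr _ k1); have [_ [_ e2]] := hp l (ltn_addr _ l1).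
  by rewrite -e1 -(subnKC k2) e subnKC.
by rewrite ren_comp //; apply: ren_ext.
Qed.
End Wires.

Lemma InP (l : seq nat) x : List.In x l <-> x \in l.
Proof.
elim: l => [|y l IH] //=; rewrite inE; split=> [[->|/IH ->]|/orP [/eqP ->|/IH]]; auto.
- by rewrite eqxx.
- by rewrite orbT.
Qed.

Lemma NoDup_uniq (l : seq nat) : NoDup l -> uniq l.
Proof. by elim=> //= x l' h _ ->; rewrite andbT; apply/negP => /InP. Qed.

Lemma Permutation_Forall2 (T U : Type) (R : T -> U -> Prop) l1 l2 k1 :
  Permutation l1 l2 -> Forall2 R l1 k1 -> exists2 k2, Permutation k1 k2 & Forall2 R l2 k2.
Proof.
move=> p; elim: p k1 => {l1 l2} [|x l l' _ IH|x y l|l1 l2 l3 _ IH1 _ IH2] k1 F.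
- by inversion F; subst; exists [::].
- inversion F as [|? z ? k h F']; subst; have [k' p F2] := IH _ F'.
  by exists (z :: k'); constructor.
- inversion F as [|? z ? k h F']; subst; inversion F' as [|? z' ? k' h' F'']; subst.
  by exists [:: z', z & k']; [exact: perm_swap|constructor=> //; constructor].
- have [k2 p2 F2] := IH1 _ F; have [k3 p3 F3] := IH2 _ F2.
  by exists k3 => //; exact: Permutation_trans p2 p3.
Qed.

Section LoopsEqv.
Variable P : palette.
Implicit Types l : seq P.

Lemma loops_eqv_sym l l' : loops_eqv l l' -> loops_eqv l' l.
Proof.
case=> k [p F]; have F' : Forall2 (fun a b : P => b = a \/ b = pinv a) k l.
  by elim: F => // a b l1 l2 [->|->] _ IH; constructor; rewrite ?pinvK; auto.
have [k2 p2 F2] := Permutation_Forall2 p F'.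
by exists k2; split=> //; exact: Permutation_sym.
Qed.

Lemma loops_eqv_trans l1 l2 l3 : loops_eqv l1 l2 -> loops_eqv l2 l3 -> loops_eqv l1 l3.
Proof.
case=> k [p F] [k' [p' F']].
have [k2 p2 F2] := Permutation_Forall2 (Permutation_sym p) F'.
exists k2; split; first exact: Permutation_trans (Permutation_sym p2) p'.
elim: F k2 {p2} F2 => [|a b l l' h _ IH] k2 F2; inversion F2 as [|? z ? k3 h' F3]; subst;
  constructor; last exact: IH.
by case: h => e1; case: h' => e2; rewrite e2 e1 ?pinvK; auto.
Qed.

Lemma loops_eqv_perm l l' : Permutation l l' -> loops_eqv l l'.
Proof.
by move=> p; exists l; split=> //; elim: l {p} => [|c l IH]; constructor; auto.
Qed.

Lemma loops_eqv_cat l1 l2 k1 k2 : loops_eqv l1 k1 -> loops_eqv l2 k2 ->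
  loops_eqv (l1 ++ l2) (k1 ++ k2).
Proof.
case=> j1 [p1 F1] [j2 [p2 F2]]; exists (j1 ++ j2); split.
  exact: Permutation_app.
exact: Forall2_app.
Qed.
End LoopsEqv.

Lemma clos_rt_sym (T : Type) (R : T -> T -> Prop) : (forall x y, R x y -> R y x) ->
  forall x y, clos_refl_trans T R x y -> clos_refl_trans T R y x.
Proof.
move=> h x y; elim=> {x y} [x y /h|x|x y z _ h1 _ h2].
- exact: rt_step.
- exact: rt_refl.
- exact: rt_trans h2 h1.
Qed.

(** * Evaluation respects composition *)

Section EvComp.
Variables (P : palette) (s : CircOp P).
Implicit Types (t u v : nom s) (c d e : seq P).

Lemma rinj_dom (f g : nat -> nat) t : (forall k, chn t k <> None -> f k = g k) -> rinj f t -> rinj g t.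
Proof. by move=> h hf k l hk hl; rewrite -!h //; exact: hf. Qed.

(** Points of [g] are shifted by [M = a + b], which makes its sources the outer ends of the wires of
    [f]. Adjoining all wires first, both pairings form one matching [m]. Eliminating the wires of
    [f] leaves a matching on the outer points with the connectivity prescribed by [BDis_comp], hence
    the pairing of [h], and one loop for each circle. *)
Theorem ev_comp c d e (f : BDiag c d) (g : BDiag d e) (h : BDiag c e) t :
  BDis_comp f g h -> typed c t -> ev h t = ev g (ev f t).
Proof.
pose a := size c; pose b := size d; pose k := size e.
pose pf := bpair f; pose pg := bpair g; pose ph := bpair h.
pose edge i j := (i < a + b /\ j = pf i) \/ (a <= i /\ i < a + b + k /\ j = a + pg (i - a)).
pose connB := clos_refl_trans nat edge.
pose emb p := if p < a then p else p + b.
pose innerB i := (a <= i /\ i < a + b) /\ forall q, connB i q -> a <= q /\ q < a + b.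
move=> [H1 [ks [L [L1 [L2 [L3 [L4 [L5 L6]]]]]]]] ht.
have {}H1 p q : p < a + k -> q < a + k -> p <> q -> (ph p = q <-> connB (emb p) (emb q)) := H1 p q.
have {}L2 i : List.In i ks -> innerB i := L2 i.
have {}L3 i : innerB i -> exists j, List.In j ks /\ connB i j := L3 i.
have {}L4 i j : List.In i ks -> List.In j ks -> connB i j -> i = j := L4 i j.
have hf : pairing (a + b) pf := bd_pairing f.
have hg : pairing (b + k) pg := bd_pairing g.
have hh : pairing (a + k) ph := bd_pairing h.
pose M := a + b.
pose wsf := wires a M d; pose wsg := wires (M + b) (M + b + k) e.
pose m := prs pf M ++ mapp (addn M) (prs pg (b + k)).
have tn n : a <= n -> chn t n = None by move=> hn; exact: (typed_None ht).
have fgt : wfresh wsg t by apply: wfresh_wires => // n hn; apply: tn; rewrite /M in hn; lia.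
have fft : wfresh wsf t by exact: wfresh_typed.
have fgd n : n \in ends (wl wsf) -> n \notin ends (wl wsg).
  by rewrite !mem_ends_wires -/b -/k; rewrite /M; lia.
pose u := wp t wsg.
have ffu : wfresh wsf u.
  apply: wfresh_wp => // n; apply: contraL; exact: fgd.
have fgf : wfresh wsg (wp t wsf) by exact: wfresh_wp.
have Ett : wp u wsf = wp (wp t wsf) wsg.
  by rewrite /u wp_comm // => n; apply: contraL; exact: fgd.
have um : uniq (ends m).
  rewrite ends_cat cat_uniq (uniq_prs hf) ends_mapp (map_inj_uniq (@addnI M)) (uniq_prs hg) andbT /=.
  by apply/hasPn => _ /mapP [n _ ->]; rewrite mem_ends_prs //; rewrite /M; lia.
have em n : (n \in ends m) = (n < M + b + k).
  rewrite ends_cat mem_cat mem_ends_prs // ends_mapp.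
  apply/idP/idP => [/orP [|/mapP [i]]|hn]; first by rewrite /M; lia.
    by rewrite mem_ends_prs // => hi ->; lia.
  case: (ltnP n M) => //= hM; apply/mapP; exists (n - M); last by rewrite subnKC.
  by rewrite mem_ends_prs //; lia.
have hv := typed_ev f ht.
have cvb n : chn (wp (ev f t) (wires b (b + k) e)) n = if n < b then onth d n else
    if n < b + k then omap pinv (onth e (n - b)) else onth e (n - (b + k)).
  exact: (@chn_wires_typed _ _ _ _ _ _ hv).
have cta n : chn (wp t wsf) n = if n < a then onth c n else
    if n < M then omap pinv (onth d (n - a)) else onth d (n - M).
  exact: (@chn_wires_typed _ _ _ _ _ _ ht).
have chtt n : chn (wp u wsf) n = if n < M then chn (wp t wsf) n else
   chn (wp (ev f t) (wires b (b + k) e)) (n - M).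
  have -> : chn (wp u wsf) n = if M + b <= n < M + b + k then omap pinv (onth e (n - (M + b))) else
      if M + b + k <= n < M + b + k + k then onth e (n - (M + b + k)) else chn (wp t wsf) n.
    by rewrite Ett; exact: chn_wires fgf.
  rewrite cvb cta.
  case: (ltnP n M) => h1.
    by rewrite ifF; [rewrite ifF //; lia|lia].
  rewrite (_ : (n < a) = false); last by rewrite /M in h1; lia.
  case: (ltnP (n - M) b) => h2.
    by rewrite ifF; [rewrite ifF //; lia|lia].
  case: (ltnP (n - M) (b + k)) => h3.
    by rewrite ifT ?subnDA //; lia.
  rewrite ifF; last lia.
  have -> : n - M - (b + k) = n - (M + b + k) by lia.
  by case: ifP => h4 //; rewrite !onth_default // -/b -/k; lia.
have ok : mok m (wp u wsf).
  move=> x y; rewrite mem_cat => /orP [hxy|/mapP [[i j] hij [-> ->]]].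
    have := @mok_typed _ _ _ _ f _ ht _ _ hxy; rewrite /zok !chtt.
    have /andP [] := mem_ends2 hxy; rewrite !mem_ends_prs // => -> -> //.
  have := @mok_typed _ _ _ _ g _ (typed_ev f ht) _ _ hij; rewrite /zok !chtt.
  rewrite !ltnNge !leq_addr /= !addKn => -[n q]; split=> //; lia.
have sub : {subset ends (wl wsf) <= ends m}.
  by move=> n; rewrite em mem_ends_wires -/b; rewrite /M; lia.
have [m' [Lo [E1 um' E3 E4 E5]]] := wire_elimination um ffu sub ok.
set E := m ++ wl wsf in E4 E5.
have Ewl n : (n \in ends (wl wsf)) = (a <= n < M + b).
  by rewrite mem_ends_wires -/b; rewrite /M; lia.
(* In [E] every middle point is doubled into the two ends of a wire. [pi] collapses them to the
   points used in [BDis_comp]; [io] goes back and picks the inner end. *)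
pose pi n := if n < M then n else n - b.
pose io n := if n < M then n else n + b.
have pfE i : i < M -> conn E i (pf i).
  by move=> hi; apply: conn_pm; rewrite !pmem_cat pmem_prs // hi eqxx.
have pgE i : i < b + k -> conn E (M + i) (M + pg i).
  move=> hi; apply: conn_pm; rewrite !pmem_cat (_ : pmem (mapp _ _) _ _ = true) ?orbT //.
  by apply/pmem_mapp; exists i, (pg i); rewrite pmem_prs // hi eqxx.
have wE i : a <= i < M -> conn E i (M + (i - a)).
  move=> hi; apply: conn_pm; rewrite !pmem_cat /pmem mem_wires -/b eqxx; apply/orP; right.
  by apply/orP; left; rewrite /M in hi; lia.
have edge_sym i j : edge i j -> edge j i.
  case=> [[hi ->]|[h1 [h2 ->]]].
    by have [h1 [_ h2]] := hf i hi; left; rewrite h2.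
  have [h3 [_ h4]] := hg (i - a) ltac:(lia).
  by right; rewrite addKn h4; lia.
have connB_sym i j : connB i j -> connB j i by apply: clos_rt_sym.
have B1 x y : conn E x y -> connB (pi x) (pi y).
  elim=> {x y} [x y|x|x y _|x y z _ h1 _ h2]; last 3 first.
  - exact: rt_refl.
  - exact: connB_sym.
  - exact: rt_trans h1 h2.
  rewrite !mem_cat => /orP [/orP [|/mapP [[i j]]]|].
  - rewrite mem_prs => /and3P [hx _ /eqP ->]; have [hx' _] := hf _ hx.
    by rewrite /pi hx hx'; apply: rt_step; left.
  - rewrite mem_prs => /and3P [hi _ /eqP ->] [-> ->].
    rewrite /pi !ltnNge !leq_addr /=; apply: rt_step; right.
    have -> : M + i - b = a + i by rewrite /M; lia.
    have -> : M + pg i - b = a + pg i by rewrite /M; lia.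
    by rewrite addKn; lia.
  - rewrite mem_wires -/b => /and3P [hx1 hx2 /eqP ->].
    have -> : pi (M + (x - a)) = pi x; last exact: rt_refl.
    by rewrite /pi ltnNge leq_addr hx2 /= /M; lia.
have W n : a <= n -> n < M + k -> conn E (io n) (M + (n - a)).
  move=> h1 h2; rewrite /io; case: ifP => h3; first by apply: wE; lia.
  by have -> : n + b = M + (n - a); [rewrite /M; lia|exact: conn_refl].
have B2 i j : connB i j -> conn E (io i) (io j).
  elim=> {i j} [i j|i|i j l _ h1 _ h2]; last 2 first.
  - exact: conn_refl.
  - exact: conn_trans h1 h2.
  case=> [[hi ->]|[h1 [h2 ->]]].
    by have [h1 _] := hf i hi; rewrite /io hi h1; exact: pfE.
  have hi : i - a < b + k by lia.
  have [h3 _] := hg _ hi.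
  apply: (conn_trans (W i h1 h2)); apply: (conn_trans (pgE _ hi)).
  have := W (a + pg (i - a)) (leq_addr _ _); rewrite addKn => /(_ ltac:(rewrite /M; lia)).
  exact: conn_sym.
have B3 x : x < M + b + k -> conn E x (io (pi x)).
  move=> hx; rewrite /pi; case: ifP => h1; first by rewrite /io h1; exact: conn_refl.
  apply: conn_sym; have := W (x - b) ltac:(rewrite /M in h1; lia) ltac:(rewrite /M in h1 *; lia).
  by have -> : M + (x - b - a) = x by rewrite /M in h1 *; lia.
(* Places the boundary points of [h] among those of [E], skipping the [2 * b] wire ends in the
   middle. *)
pose sg n := if n < a then n else n + b + b.
have sgi : injective sg by move=> i j; rewrite /sg; do 2 case: ifP; lia.
have pis n : pi (sg n) = emb n.
  by rewrite /pi /sg /emb /M; case: (ltnP n a) => h1; [rewrite ifT|rewrite ifF]; lia.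
have ios n : n < a + k -> io (emb n) = sg n.
  by move=> hn; rewrite /io /sg /emb; case: (ltnP n a) => h1; case: ifP => h2; rewrite /M in h2; lia.
have sgW n : n < a + k -> sg n \notin ends (wl wsf).
  by move=> hn; rewrite Ewl /sg; case: ifP => h1; rewrite /M; lia.
have hm' : pmem m' =2 pmem (mapp sg (prs ph (a + k))).
  move=> x y; apply/idP/idP => [hxy|].
    have xy : x <> y.
      move=> e1; subst y; have := hxy; rewrite /pmem orbb => hxx.
      by case/splitPr: hxx um' => p1 p2; rewrite (perm_uniq (ends_perm_mid _ _ _)) /= inE eqxx.
    have en n : n \in ends m' -> exists2 i, i < a + k & n = sg i.
      rewrite E3 em Ewl /M => hn; case: (ltnP n a) => h1; [exists n|exists (n - b - b)]; rewrite /sg ?h1 //; try lia.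
      rewrite ifF; lia.
    have [i hi ex] := en x (mem_ends hxy).
    have [j hj ey] : exists2 j, j < a + k & y = sg j by apply/en/(@mem_ends _ _ x); rewrite pmem_sym.
    apply/pmem_mapp; exists i, j; split=> //; rewrite pmem_prs // hi eq_sym; apply/eqP.
    apply/H1 => //; first by move=> e1; apply: xy; rewrite ex ey e1.
    rewrite -!pis -ex -ey; apply: B1; apply/E4; rewrite ?ex ?ey ?sgW //.
    by rewrite -ex -ey; exact: conn_pm.
  case/pmem_mapp => i [j [-> ->]]; rewrite pmem_prs // => /andP [hi /eqP ej].
  have [hj [ni _]] := hh i hi; rewrite -ej in hj ni.
  have : conn m' (sg i) (sg j).
    apply/E4; rewrite ?sgW // -!ios //; apply: B2; apply/H1 => //; exact/nesym.
  by case/(conn_matching um') => // /sgi e1; case: ni.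
have hL : loops_eqv Lo L.
  rewrite -[L]map_id; have -> : L = map (fun x => x) L by rewrite map_id.
  (* The representatives [ks] are inner wire ends, which carry the dual colours; hence [map pinv L],
     which agrees with [L] orbit by orbit. *)
  apply: loops_eqv_trans (E5 ks (map pinv L) _) _; last first.
    exists (map id L); split=> //; rewrite map_id; elim: (L) => [|q l IH] /=; constructor => //.
    by right; rewrite pinvK.
  have ksr n : n \in ks -> a <= n < M by move/InP/L2 => -[]; rewrite /M; lia.
  have pik n : n \in ks -> pi n = n by move=> /ksr; rewrite /pi; case: ltnP => //; lia.
  have iok n : n \in ks -> io n = n by move=> /ksr; rewrite /io; case: ltnP => //; lia.
  have cn i j : conn E i j -> i < M + b + k -> j < M + b + k.
    case/conn_ends => [->//|/andP [_]]; rewrite /E ends_cat mem_cat em Ewl; lia.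
  split.
  - elim: L1 ksr => /= [|n q ks' l hn _ IH] ksr; constructor.
      left; have hr := ksr n (mem_head _ _).
      rewrite chtt ifT; last lia.
      rewrite cta ifF; last lia.
      rewrite ifT; last lia.
      move: hn; rewrite !onth_cat ifF -/a -/b; last lia.
      by rewrite ifT; [move=> ->|rewrite /M in hr; lia].
    by apply: IH => i hi; apply: ksr; rewrite inE hi orbT.
  - move=> n hn q hq; have hr := ksr n hn.
    have := B1 _ _ hq; rewrite pik // => hq2.
    have [_ /(_ _ hq2)] := L2 n (proj2 (InP _ _) hn).
    have := cn _ _ hq ltac:(lia); rewrite Ewl /pi; case: ifP => h1; rewrite /M in h1 *; lia.
  - move=> i hi; have : i \in ends (wl wsf) by apply: hi; exact: conn_refl.
    rewrite Ewl => hr; have h3 := B3 i ltac:(lia).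
    have [|j [hj hc]] := L3 (pi i).
      split; first by rewrite /pi; case: ifP; rewrite /M in hr *; lia.
      move=> q /B2 hq; have := hi _ (conn_trans h3 hq); rewrite Ewl /io.
      by case: ifP => h4; rewrite /M in h4 *; lia.
    move/InP in hj; exists j => //; apply: (conn_trans h3).
    by rewrite -(iok j hj); exact: B2.
  - move=> i j hi hj /B1; rewrite !pik // => hc.
    by apply: L4 => //; exact/InP.
  - exact: NoDup_uniq.
have Lh : loops_eqv (bloops h) (bloops g ++ (bloops f ++ Lo)).
  apply: (loops_eqv_trans L6); rewrite !catA.
  apply: loops_eqv_cat (loops_eqv_sym hL).
  apply: loops_eqv_perm; exact: Permutation_app_comm.
pose H := raw h t.
pose v := ren (subn^~ M) (raw f t).
have Ev : ev f t = lops (bloops f) v by [].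
have tv : typed d v by move=> n; rewrite -hv Ev chn_lops.
have fv : wfresh (wires b (b + k) e) v by exact: wfresh_typed.
pose X0 := raw g v.
have -> : ev g (ev f t) = lops (bloops g) (lops (bloops f) (ren (subn^~ (b + k)) X0)).
  rewrite {1}/ev {1}/raw Ev wp_lops // contr_lops ren_lops //.
  exact: (@rinj_sub_raw _ _ _ _ g _ tv).
rewrite /ev (lops_eqv _ Lh) !lops_cat; congr (lops _ (lops _ _)).
have uX : uniq (ends (mapp sg (prs ph (a + k)))).
  by rewrite ends_mapp map_inj_uniq // uniq_prs.
(* Before names are shifted back, the two evaluations differ only in their numbering, [addn M]
   against [sg], and in the loops found by elimination. *)
have Xs : ren (addn M) X0 = lops Lo (ren sg H).
  rewrite /X0 /raw -/b -/k -/pg contr_ren; last exact: addnI.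
  rewrite ren_wp //; last exact: addnI.
  rewrite (@mapw_wires _ (addn M) b (b + k) (M + b) (M + b + k) e); last by move=> j hj; lia.
  have -> : ren (addn M) v = raw f t.
    rewrite /v ren_comp; last first.
      move=> i j; rewrite !chn_raw // -/a -/b -/M /=; do 2 case: ltnP => //; lia.
    by apply: ren_id => i; rewrite chn_raw // -/a -/b -/M /=; case: ltnP => //; lia.
  rewrite -/wsg /raw -/a -/b -/M -/pf -/wsf -contr_wp //; last first.
    by move=> n; rewrite mem_ends_prs // mem_ends_wires -/k; lia.
  rewrite -Ett -contr_cat -/m E1; congr (lops _ _).
  rewrite (contr_pmem _ um' uX hm') /H /raw -/a -/k -/ph contr_ren // ren_wp //; last exact: wfresh_typed.
  rewrite ren_id; last first.
    by move=> n; rewrite ht /sg; case: ltnP => // hn; rewrite onth_default.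
  rewrite (@mapw_wires _ sg a (a + k) (M + b) (M + b + k) e) //.
  by move=> j hj; rewrite /sg !ifF; rewrite /M; lia.
have cH n : chn H n <> None -> a + k <= n.
  by rewrite /H chn_raw // -/a -/k; case: ltnP.
have cX n : chn X0 n <> None -> b + k <= n.
  by rewrite /X0 chn_raw // -/b -/k; case: ltnP.
have rX : rinj (subn^~ (b + k)) X0 by move=> i j /cX hi /cX hj; lia.
have rs : rinj ((fun n => n - M - (b + k)) \o sg) H.
  by move=> i j /cH hi /cH hj /=; rewrite /sg !ifF; rewrite /M; lia.
have -> : ren (subn^~ (b + k)) X0 = ren (fun n => n - M - (b + k)) (ren (addn M) X0).
  rewrite ren_comp; first by apply: ren_ext => // n _ /=; rewrite addKn.
  by apply: (rinj_dom (f := subn^~ (b + k))) => // n _ /=; rewrite addKn.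
rewrite Xs ren_lops; last first.
  move=> i j hi hj.
  have [[i' [<- hi'] _]|[_ e1]] := chn_renP i (inj_rinj (t := H) sgi); last by rewrite e1 in hi.
  have [[j' [<- hj'] _]|[_ e1]] := chn_renP j (inj_rinj (t := H) sgi); last by rewrite e1 in hj.
  by move=> e1; rewrite (rs i' j').
congr lops; rewrite ren_comp //.
apply: ren_ext; first by move=> i j /cH hi /cH hj; lia.
by move=> n /cH hn; rewrite /= /sg ifF; rewrite /M; lia.
Qed.
End EvComp.

(** * Evaluation respects identities, tensor products and symmetry *)

Section Mul.
Variables (P : palette) (s : CircOp P).
Implicit Types (t u v : nom s) (c d e : seq P) (ws : seq (nat * nat * P)).

Lemma chn_shift a t n : chn (ren (addn a) t) n = if n < a then None else chn t (n - a).
Proof.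
case: ltnP => h; last by rewrite -{1}(subnKC h) chn_ren //; exact: addnI.
apply: chn_ren_None => [|l _ e]; [exact/inj_rinj/addnI|lia].
Qed.

Definition mul a t u := np t (ren (addn a) u).

Lemma disj_shift c t u : typed c t -> disj t (ren (addn (size c)) u).
Proof.
move=> h k; rewrite chn_shift; case: ltnP => hk; [by right|left; exact: typed_None h hk].
Qed.

Lemma chn_mul c t u k : typed c t ->
  chn (mul (size c) t u) k = if k < size c then chn t k else chn u (k - size c).
Proof.
move=> h; rewrite chn_np ?chn_shift; last exact: disj_shift.
case: ltnP => hk; first by case: (chn t k).
by rewrite (typed_None h hk).
Qed.

Lemma typed_mul c d t u : typed c t -> typed d u -> typed (c ++ d) (mul (size c) t u).
Proof. by move=> ht hu k; rewrite (chn_mul _ _ ht) onth_cat ht hu. Qed.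

Lemma typed_nu : typed [::] (nu s).
Proof. by move=> k; rewrite chn_nu onth0n. Qed.

Lemma ren_shift a b t : ren (addn a) (ren (addn b) t) = ren (addn (a + b)) t.
Proof.
rewrite ren_comp; last by apply: inj_rinj => i j /= ; lia.
by apply: ren_ext => [i j|k] _ /=; lia.
Qed.

Lemma mul_assoc c d t u v : typed c t -> typed d u ->
  mul (size (c ++ d)) (mul (size c) t u) v = mul (size c) t (mul (size d) u v).
Proof.
move=> ht hu; rewrite /mul ren_np; [|exact: disj_shift|exact/inj_rinj/addnI].
rewrite ren_shift size_cat np_assoc //; first exact: disj_shift.
  move=> k; rewrite chn_shift; case: ltnP => hk; first by right.
  by left; apply: (typed_None ht); lia.
move=> k; rewrite !chn_shift; case: ltnP => h1; first by left.
by case: ltnP => h2; [right|left; apply: (typed_None hu); lia].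
Qed.

Lemma mul_nul t : mul 0 (nu s) t = t.
Proof. by rewrite /mul nu_np ren_id. Qed.

Lemma mul_nur a t : mul a t (nu s) = t.
Proof. by rewrite /mul (ren_id (t := nu s)) ?np_nu // => k; rewrite chn_nu. Qed.

Lemma BDis_idE c (f : BDiag c c) : BDis_id f ->
  forall i, i < size c -> bpair f i = size c + i /\ bpair f (size c + i) = i.
Proof.
case=> h _ i hi; have [_ [_ e]] := bd_pairing f (i := i) ltac:(lia).
by rewrite -(addnC i) -h // e.
Qed.

Lemma ev_id c (f : BDiag c c) t : BDis_id f -> typed c t -> ev f t = t.
Proof.
move=> /[dup] hid /BDis_idE h ht.
rewrite (@ev_cupless _ _ _ _ f t [::] ht) //.
- case: hid => _ -> /=; apply: ren_id => k /(typed_names k ht) hk.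
  by case: (h k hk) => -> _; rewrite addKn.
- by move=> j hj; case: (h j hj) => _ ->.
move=> x y; rewrite /pmem !in_nil; symmetry; apply/negP => /and3P [hx hy /eqP e].
by case: (h x hx); lia.
Qed.

Lemma wires_cat i o d e :
  wires i o (d ++ e) = wires i o d ++ wires (i + size d) (o + size d) e.
Proof. by elim: d i o => [|c d IH] i o /=; rewrite ?addn0 // IH !addSnnS. Qed.

Lemma wp_npl ws t u : disj t u -> wfresh ws t -> wfresh ws u ->
  disj (wp t ws) u /\ wp (np t u) ws = np (wp t ws) u.
Proof.
move=> d; elim: ws => [//|w ws IH] f1 f2.
have [d1 e1] := IH (wfresh_cons f1) (wfresh_cons f2).
have /= dw := disj_wp f1; have [/= w1 w2 w3] := wfresh_hd f1.
have du : disj (wr s w.1.1 w.1.2 w.2) u.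
  move=> k; rewrite chn_wr //; case: f2 => _ f2.
  case: eqP => [->|_]; first by right; rewrite f2 //= !inE eqxx.
  by case: eqP => [->|_]; [right; rewrite f2 //= !inE eqxx orbT|left].
have d3 : disj (np (wp t ws) (wr s w.1.1 w.1.2 w.2)) u by exact: disj_np.
split=> //=; rewrite e1 np_assoc //; last exact: disj_sym.
by rewrite (np_comm (disj_sym du)) -np_assoc.
Qed.

Lemma rinj_names c d (f : BDiag c d) t (r : nat -> nat) : typed c t ->
  (forall i j, size c + size d <= i -> size c + size d <= j -> r i = r j -> i = j) ->
  rinj r (raw f t).
Proof.
by move=> h hr i j; rewrite !chn_raw //; case: ltnP => // h1 _; case: ltnP => // h2 _; exact: hr.
Qed.

(** The matching of [h] is the disjoint union of the two images [E1] and [E2]. Each half meets only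
    one factor of the juxtaposition, so [contr_npl] separates the contractions; the loops commute
    past everything. *)
Lemma ev_tensor c d c' d' (f : BDiag c d) (f' : BDiag c' d') (h : BDiag (c ++ c') (d ++ d')) t t' :
  BDis_tensor f f' h -> typed c t -> typed c' t' ->
  ev h (mul (size c) t t') = mul (size d) (ev f t) (ev f' t').
Proof.
pose a := size c; pose b := size d; pose a' := size c'; pose b' := size d'.
pose pf := bpair f; pose pf' := bpair f'; pose ph := bpair h.
pose A := a + a'; pose B := b + b'.
case; rewrite -/a -/b -/a' -/b' -/pf -/pf' -/ph => H1 [H2 HL] ht ht'.
have hf : pairing (a + b) pf := bd_pairing f.
have hf' : pairing (a' + b') pf' := bd_pairing f'.
have hh : pairing (A + B) ph.
  by have := bd_pairing h; rewrite !size_cat.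
(* The three ranges of [E1] and [E2] are the sources, the inner ends and the outer ends of the
   wires, each sent to its place in the tensor product. *)
pose E1 n := if n < a then n else if n < a + b then n + a' else n + a' + b'.
pose E2 n := if n < a' then a + n else if n < a' + b' then a + b + n else n + a + b + b.
have i1 : injective E1 by move=> i j; rewrite /E1; do ! case: ifP; lia.
have i2 : injective E2 by move=> i j; rewrite /E2; do ! case: ifP; lia.
have E1f i : i < a + b -> ph (E1 i) = E1 (pf i) /\ E1 i < A + B.
  move=> hi; have [h1 _] := hf _ hi; rewrite /E1 hi h1 H1 //; split=> //.
  by rewrite /A /B; case: ifP; lia.
have E2f i : i < a' + b' -> ph (E2 i) = E2 (pf' i) /\ E2 i < A + B.
  move=> hi; have [h1 _] := hf' _ hi; rewrite /E2 hi h1 H2 //; split=> //.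
  by rewrite /A /B; case: ifP; lia.
pose m := mapp E1 (prs pf (a + b)) ++ mapp E2 (prs pf' (a' + b')).
have um : uniq (ends m).
  rewrite ends_cat cat_uniq !ends_mapp !map_inj_uniq // !uniq_prs // andbT.
  apply/hasPn => _ /mapP [i hi ->]; apply/negP => /mapP [j hj].
  move: hi hj; rewrite !mem_ends_prs // => hi hj.
  by rewrite /E1 /E2 hi hj; do 2 case: ifP; lia.
have pm : pmem (prs ph (A + B)) =2 pmem m.
  move=> x y; rewrite pmem_prs // pmem_cat; apply/andP/orP => [[hx /eqP ->]|].
    have [[i hi ex]|[i hi ex]] : (exists2 i, i < a + b & x = E1 i) \/ (exists2 i, i < a' + b' & x = E2 i).
      case: (ltnP x a) => h1; first by left; exists x; rewrite /E1 ?h1 //; lia.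
      case: (ltnP x A) => h2.
        by right; exists (x - a); rewrite /A in h2; [|rewrite /E2 ifT]; lia.
      case: (ltnP x (A + b)) => h3.
        by left; exists (x - a'); rewrite /A in h2 h3; [|rewrite /E1 ifF ?ifT]; lia.
      by right; exists (x - a - b); rewrite /A /B in h2 h3 hx; [|rewrite /E2 ifF ?ifT]; lia.
    - left; apply/pmem_mapp; exists i, (pf i); rewrite pmem_prs // hi eqxx ex.
      by case: (E1f i hi) => ->.
    - right; apply/pmem_mapp; exists i, (pf' i); rewrite pmem_prs // hi eqxx ex.
      by case: (E2f i hi) => ->.
  case=> /pmem_mapp [i [j [-> ->]]]; rewrite pmem_prs // => /andP [hi /eqP ->].
    by case: (E1f i hi) => -> ->.
  by case: (E2f i hi) => -> ->.
pose T' := ren (addn a) t'.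
have dT : disj t T' by exact: disj_shift.
have T'n k : k < a \/ A <= k -> chn T' k = None.
  move=> hk; rewrite chn_shift; case: ltnP => h1 //; apply: (typed_None ht'); rewrite -/a'.
  by rewrite /A in hk; lia.
have tn k : a <= k -> chn t k = None by exact: typed_None.
pose ws1 := wires A (A + B) d; pose ws2 := wires (A + b) (A + B + b) d'.
have fr v : (forall k, A <= k -> chn v k = None) -> wfresh ws1 v /\ wfresh ws2 v.
  by move=> hv; split; apply: wfresh_wires => [|k]; rewrite -/b -/b' /B /A; try lia;
    move=> hk; apply: hv; rewrite /A; lia.
have [f1t f2t] : wfresh ws1 t /\ wfresh ws2 t by apply: fr => k; rewrite /A => hk; apply: tn; lia.
have [f1T f2T] : wfresh ws1 T' /\ wfresh ws2 T' by apply: fr => k hk; apply: T'n; right.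
have d12 k : k \in ends (wl ws2) -> k \notin ends (wl ws1).
  by rewrite !mem_ends_wires -/b -/b' /B; lia.
have f1W : wfresh ws1 (wp T' ws2) by exact: wfresh_wp.
have [dx ex] := wp_npl (disj_sym dT) f2T f2t.
have [dy ey] := wp_npl (disj_sym dx) f1t f1W.
have Eraw : raw h (mul a t t') = np (ren E1 (raw f t)) (ren E2 (raw f' t')).
  rewrite /raw !size_cat -/a -/b -/a' -/b' -/A -/B -/ph wires_cat -/b.
  rewrite [wp _ (_ ++ _)]foldr_cat -/(wp _ _) -/(wp _ _) -/ws1 -/ws2 /mul -/T'.
  rewrite (np_comm dT) ex (np_comm dx) ey.
  rewrite (contr_pmem _ (uniq_prs hh) um pm) contr_cat.
  rewrite !contr_ren // !ren_wp //; try exact: wfresh_typed.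
  have -> : ren E1 t = t by apply: ren_id => k /(typed_names k ht); rewrite /E1 -/a => ->.
  have -> : ren E2 t' = T'.
    by apply: ren_ext => [|k /(typed_names k ht')]; [exact: inj_rinj|rewrite /E2 -/a' => ->].
  rewrite (@mapw_wires _ E1 a (a + b) A (A + B) d); last first.
    by move=> j hj; rewrite -/b in hj; split; rewrite /E1 /A /B; [rewrite ifF ?ifT|rewrite !ifF]; lia.
  rewrite (@mapw_wires _ E2 a' (a' + b') (A + b) (A + B + b) d'); last first.
    by move=> j hj; rewrite -/b' in hj; split; rewrite /E2 /A /B; [rewrite ifF ?ifT|rewrite !ifF]; lia.
  rewrite contr_npl //; last first.
    move=> _ /[!ends_mapp] /mapP [k hk ->]; rewrite mem_ends_prs // in hk.
    rewrite chn_wp //; first by apply: T'n; rewrite /E1 hk /A; case: ifP; lia.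
    rewrite mem_ends_wires /E1 hk /A /B -/b'; case: ifP; lia.
  rewrite np_comm; last exact: disj_contr.
  rewrite contr_npl //; first by rewrite np_comm //; apply: disj_contr; exact/disj_sym/disj_contr.
    exact/disj_sym/disj_contr.
  move=> _ /[!ends_mapp] /mapP [k hk ->]; rewrite mem_ends_prs // in hk.
  rewrite chn_contr_other.
    rewrite chn_wp //; first by apply: tn; rewrite /E2 hk; case: ifP; lia.
    rewrite mem_ends_wires /E2 hk /A /B -/b; case: ifP; lia.
  rewrite ends_mapp; apply/negP => /mapP [j hj]; rewrite mem_ends_prs // in hj.
  by rewrite /E1 /E2 hk hj; do 2 case: ifP; lia.
have r1 : rinj (fun n => n - (a + b)) (raw f t) by exact: rinj_sub_raw.
have r2 : rinj (fun n => n - (a' + b')) (raw f' t') by exact: rinj_sub_raw.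
have dd : disj (ren E1 (raw f t)) (ren E2 (raw f' t')).
  move=> k; have [[l [<- hl] _]|[_ ->]] := chn_renP k (inj_rinj (t := raw f t) i1); last by left.
  have [[l' [e hl'] _]|[_ ->]] := chn_renP (E1 l) (inj_rinj (t := raw f' t') i2); last by right.
  move: hl hl' e; rewrite !chn_raw // -/a -/b -/a' -/b'; case: ltnP => // h1 hl; case: ltnP => // h2 hl'.
  have := typed_names; move: hl hl'; rewrite /E1 /E2 !ifF; try lia.
  have onthN (dd : seq P) i : onth dd i <> None -> i < size dd by rewrite -onthTE; case: onth.
  by move=> /onthN + /onthN; rewrite -/b -/b'; lia.
rewrite {1}/ev Eraw HL !size_cat -/a -/b -/a' -/b' -/A -/B lops_cat.
have tm : typed (c ++ c') (mul a t t') by exact: typed_mul.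
have rr : rinj (subn^~ (A + B)) (np (ren E1 (raw f t)) (ren E2 (raw f' t'))).
  by have := @rinj_sub_raw _ _ _ _ h _ tm; rewrite !size_cat Eraw.
rewrite ren_np // !ren_comp; first last.
- by apply: rinj_names => // i j; rewrite -/a -/b /E1 /= => h1 h2; rewrite !ifF /A /B; lia.
- by apply: rinj_names => // i j; rewrite -/a' -/b' /E2 /= => h1 h2; rewrite !ifF /A /B; lia.
rewrite /mul {2}/ev ren_lops; last exact: inj_rinj (@addnI b).
have de : disj (ev f t) (ren (addn (size d)) (ren (subn^~ (a' + b')) (raw f' t'))).
  by apply: disj_shift; exact: typed_ev.
rewrite np_lopsr // /ev np_lops; last first.
  by move=> k; case: (de k); rewrite /ev ?chn_lops; auto.
rewrite -!lops_cat (@lops_perm _ _ (bloops f' ++ bloops f) (bloops f ++ bloops f')); last exact: Permutation_app_comm.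
congr (lops _ (np _ _)).
  apply: ren_ext; first by apply: rinj_names => // i j; rewrite -/a -/b /E1 /= => h1 h2; rewrite !ifF /A /B; lia.
  move=> k; rewrite chn_raw // -/a -/b; case: ltnP => // hk _ /=.
  by rewrite /E1 !ifF /A /B; lia.
rewrite ren_comp; last first.
  by apply: rinj_names => // i j; rewrite -/a' -/b' /=; lia.
apply: ren_ext; first by apply: rinj_names => // i j; rewrite -/a' -/b' /E2 /= => h1 h2; rewrite !ifF /A /B; lia.
move=> k; rewrite chn_raw // -/a' -/b'; case: ltnP => // hk _ /=.
by rewrite /E2 !ifF /A /B -/b; lia.
Qed.

(** The symmetry joins every target to a source and caps nothing, so [ev_cupless] with the empty
    matching turns it into a renaming; what remains is commutativity of juxtaposition. *)
Lemma ev_swap c d (h : BDiag (c ++ d) (d ++ c)) t u :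
  BDis_swap c d h -> typed c t -> typed d u ->
  ev h (mul (size c) t u) = mul (size d) u t.
Proof.
pose a := size c; pose b := size d; pose p := bpair h.
case; rewrite -/a -/b -/p => H1 [H2 HL] ht hu.
have hp : pairing (a + b + (b + a)) p by have := bd_pairing h; rewrite !size_cat.
have tm : typed (c ++ d) (mul a t u) by exact: typed_mul.
have ge n : n < a + b -> a + b <= p n.
  move=> hn; case: (ltnP n a) => h1; first by rewrite H1 //; lia.
  by rewrite -(subnKC h1) H2; lia.
have rp : rinj (fun n => p n - (a + b)) (mul a t u).
  move=> k l /(typed_names k tm) + /(typed_names l tm); rewrite size_cat -/a -/b => hk hl e.
  have [k1 [_ k2]] := hp k ltac:(lia); have [l1 [_ l2]] := hp l ltac:(lia).
  rewrite -k2 -l2; congr p; have := ge k hk; have := ge l hl; lia.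
rewrite (@ev_cupless _ _ _ _ h _ [::] tm) //.
- rewrite HL /= size_cat -/a -/b -/p /mul ren_np //; last exact: disj_shift.
  rewrite np_comm; last by apply: disj_ren => //; exact: disj_shift.
  congr np.
    have E k : chn u k <> None -> p (a + k) - (a + b) = k.
      by move/(typed_names k hu) => hk; rewrite H2 //; lia.
    rewrite ren_comp; first by apply: ren_id => k hk /=; exact: E.
    by move=> k l hk hl /=; rewrite !E.
  apply/esym/ren_ext; first exact/inj_rinj/addnI.
  by move=> k /(typed_names k ht) hk; rewrite H1 // -/b; lia.
- move=> j; rewrite !size_cat -/a -/b -/p => hj.
  case: (ltnP j b) => h1.
    have := H2 j h1; have [_ [_]] := hp (a + j) ltac:(lia) => + e.
    by rewrite e => ->; lia.
  have := H1 (j - b) ltac:(lia); have [_ [_]] := hp (j - b) ltac:(lia) => + e.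
  by rewrite e (_ : a + b + b + (j - b) = a + b + j) => [->|]; lia.
move=> x y; rewrite /pmem !in_nil; symmetry; apply/negP => /and3P [].
rewrite !size_cat -/a -/b -/p => hx hy /eqP e.
case: (ltnP x a) => h1; first by move: hy; rewrite e H1 //; lia.
by move: hy; rewrite e -(subnKC h1) H2; lia.
Qed.
End Mul.

(** * The circuit algebra of a circuit operad *)

Section AlgebraOfOperad.
Variables (P : palette) (s : CircOp P).

Definition gA (c : seq P) := {t : nom s | typed c t}.

Lemma gA_eq c (x y : gA c) : sval x = sval y -> x = y.
Proof.
case: x y => [x hx] [y hy] /= e; subst y; congr exist; exact: proof_irrelevance.
Qed.

Definition gmap c d (f : BDiag c d) (x : gA c) : gA d := exist _ _ (typed_ev f (svalP x)).

Lemma typed_mul_eq c d e (H : e = c ++ d) (x : gA c) (y : gA d) :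
  typed e (mul (size c) (sval x) (sval y)).
Proof. rewrite H; exact: typed_mul (svalP x) (svalP y). Qed.

Definition gmu c d e (H : e = c ++ d) (x : gA c) (y : gA d) : gA e :=
  exist _ _ (typed_mul_eq H x y).

Definition gdata : CircAlgData P := MkCircAlgData gmap gmu (exist _ _ (typed_nu s)).

Lemma gax : is_circuit_algebra gdata.
Proof.
split.
- by move=> c d f f' h x; apply: gA_eq; exact: ev_eqv.
- by move=> c f h x; apply: gA_eq; apply: ev_id => //; exact: svalP.
- by move=> c d e f g h H x; apply: gA_eq; apply: ev_comp => //; exact: svalP.
- move=> c d c' d' ce de H1 H2; subst ce de => f f' h H x x'.
  by apply: gA_eq; apply: ev_tensor => //; exact: svalP.
- move=> c d e cd de cde H1 H2 H3 H4 x y z; subst cd de cde.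
  by apply: gA_eq => /=; apply: mul_assoc; exact: svalP.
- by move=> c H x; apply: gA_eq; exact: mul_nul.
- by move=> c H x; apply: gA_eq; exact: mul_nur.
- move=> c d cd dc H1 H2; subst cd dc => h H x y.
  by apply: gA_eq; apply: ev_swap => //; exact: svalP.
Qed.

Definition galg : CircAlg P := MkCircAlg gax.
End AlgebraOfOperad.

(** * From circuit algebras to circuit operads *)

Section Rank.
Variable X : finType.
Definition rk (x : X) : nat := index x (enum X).
Lemma rk_lt x : rk x < #|X|.
Proof. by rewrite cardE index_mem mem_enum. Qed.
Lemma rk_inj : injective rk.
Proof.
move=> x y e; have xe : x \in enum X by rewrite mem_enum.
by rewrite -(nth_index x xe) -/(rk x) e nth_index // mem_enum.
Qed.
Lemma rk_surj i : i < #|X| -> exists x, rk x = i.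
Proof.
rewrite cardE => hi; case E : (enum X) => [|x0 l]; first by rewrite E in hi.
by exists (nth x0 (enum X) i); rewrite /rk index_uniq ?enum_uniq.
Qed.
Lemma onth_rk (T : Type) (k : X -> T) x : onth (map k (enum X)) (rk x) = Some (k x).
Proof.
have h : x \in enum X by rewrite mem_enum.
by rewrite onth_map onthE (nth_map x) ?index_mem // nth_index.
Qed.
Lemma size_enum_map (T : Type) (k : X -> T) : size (map k (enum X)) = #|X|.
Proof. by rewrite size_map -cardE. Qed.
End Rank.

Lemma enum_sumE (X Y : finType) : enum ((X + Y)%type : finType) = map inl (enum X) ++ map inr (enum Y).
Proof. by rewrite !enumT [in LHS]unlock. Qed.

Lemma rk_inl (X Y : finType) (x : X) : rk (inl x : (X + Y)%type) = rk x.
Proof.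
rewrite /rk enum_sumE index_cat map_f ?mem_enum // index_map //; exact: inl_inj.
Qed.

Lemma rk_inr (X Y : finType) (y : Y) : rk (inr y : (X + Y)%type) = #|X| + rk y.
Proof.
rewrite /rk enum_sumE index_cat ifF; last by apply/negP => /mapP [].
by rewrite size_enum_map index_map // => ? ? [].
Qed.

Lemma map_enum_sum (X Y : finType) (T : Type) (k : X + Y -> T) :
  map k (enum ((X + Y)%type : finType)) = map (k \o inl) (enum X) ++ map (k \o inr) (enum Y).
Proof. by rewrite enum_sumE map_cat -!map_comp. Qed.

Lemma map_enum_rk (X Y : finType) (T : Type) (k : X -> T) (k' : Y -> T) (e : bij Y X) :
  (forall y, rk (e y) = rk y) -> (forall y, k (e y) = k' y) -> map k (enum X) = map k' (enum Y).
Proof.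
move=> h hk; have cXY : #|X| = #|Y|.
  by rewrite -(card_codom (@bij_inj _ _ e)); apply/eq_card => x; rewrite -[x](binvK e) codom_f.
apply: eq_from_onth_le => i; rewrite !size_enum_map cXY maxnn => /rk_surj [y <-].
by rewrite onth_rk -h onth_rk hk.
Qed.

(** * Diagrams between enumerated colourings *)

Section Coding.
Variables (X Y : finType).
(** Numbers the boundary points of a diagram from [X] to [Y]. It agrees with the rank in the sum
    type, because the enumeration of a sum lists the left summand first. *)
Definition code (u : X + Y) : nat := match u with inl x => rk x | inr y => #|X| + rk y end.

Lemma code_rk u : code u = rk u.
Proof. by case: u => [x|y]; rewrite ?rk_inl ?rk_inr. Qed.
Lemma code_inj : injective code.
Proof. by move=> u v; rewrite !code_rk; exact: rk_inj. Qed.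
Lemma code_lt u : code u < #|X| + #|Y|.
Proof. by rewrite code_rk -card_sum rk_lt. Qed.
Lemma code_surj i : i < #|X| + #|Y| -> exists u, code u = i.
Proof. by rewrite -card_sum => /rk_surj [u <-]; exists u; rewrite code_rk. Qed.

Definition is_inl (u : X + Y) := if u is inl _ then true else false.

Lemma code_ltX u : (code u < #|X|) = is_inl u.
Proof. by case: u => [x|y] /=; [rewrite rk_lt|rewrite ltnNge leq_addr]. Qed.

Definition csum (T : Type) (k : X -> T) (k' : Y -> T) (u : X + Y) : T :=
  match u with inl x => k x | inr y => k' y end.

Lemma onth_code (T : Type) (k : X -> T) (k' : Y -> T) u :
  onth (map k (enum X) ++ map k' (enum Y)) (code u) = Some (csum k k' u).
Proof. by rewrite code_rk -[_ ++ _](map_enum_sum (csum k k')) onth_rk. Qed.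

Definition bdp (p : X + Y -> X + Y) (i : nat) :=
  if [pick u | code u == i] is Some u then code (p u) else i.

Lemma bdpE p u : bdp p (code u) = code (p u).
Proof.
rewrite /bdp; case: pickP => [v /eqP /code_inj -> //|h].
by have := h u; rewrite eqxx.
Qed.

Variable P : palette.
Definition fpairing (k : X -> P) (k' : Y -> P) (p : X + Y -> X + Y) :=
  forall u, [/\ p (p u) = u, p u <> u &
    csum k k' (p u) = (if is_inl u == is_inl (p u) then pinv else id) (csum k k' u)].

Lemma bdp_ok k k' p : fpairing k k' p -> bd_ok (map k (enum X)) (map k' (enum Y)) (bdp p).
Proof.
move=> h; rewrite /bd_ok !size_enum_map; split; [|split] => i.
- move=> /code_surj [u <-]; case: (h u) => h1 h2 _.
  rewrite !bdpE h1 code_lt; split=> //; split=> // /code_inj; exact: h2.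
- move=> hi; rewrite /bdp; case: pickP => // u /eqP e.
  by have := code_lt u; rewrite e; lia.
move=> /code_surj [u <-]; case: (h u) => _ _ h3.
by rewrite bdpE !onth_code !code_ltX h3; case: eqP.
Qed.

Definition mkbd k k' p (h : fpairing k k' p) (l : seq P) : BDiag (map k (enum X)) (map k' (enum Y)) :=
  MkBDiag l (bdp_ok h).

(** Diagrams over different but equal lists, and with different validity proofs, are compared
    through the map [p] that they follow. *)
Definition follows (c d : seq P) (f : BDiag c d) (p : X + Y -> X + Y) :=
  forall u, bpair f (code u) = code (p u).

Lemma follows_mkbd k k' p (h : fpairing k k' p) l : follows (mkbd h l) p.
Proof. exact: bdpE. Qed.

Lemma follows_eq (c d c' d' : seq P) (f : BDiag c d) (f' : BDiag c' d') p :
  size c + size d = #|X| + #|Y| -> size c' + size d' = #|X| + #|Y| ->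
  follows f p -> follows f' p -> bpair f =1 bpair f'.
Proof.
move=> s1 s2 h h' i; case: (ltnP i (#|X| + #|Y|)) => [/code_surj [u <-]|hi].
  by rewrite h h'.
have [_ [e _]] := bpair_ok f; have [_ [e' _]] := bpair_ok f'.
by rewrite e ?e' // ?s1 ?s2.
Qed.
End Coding.

Lemma follows_bdeq (X Y : finType) (P : palette) (k : X -> P) (k' : Y -> P) (p : X + Y -> X + Y)
  (f f' : BDiag (map k (enum X)) (map k' (enum Y))) :
  follows f p -> follows f' p -> loops_eqv (bloops f) (bloops f') -> BDeq f f'.
Proof. by move=> h h' l; split=> //; apply: (follows_eq _ _ h h'); rewrite !size_enum_map. Qed.

(** * A criterion for composites without new loops *)

Section Criterion.
Variables (X Y Z : finType).

Definition te (u : X + Z) : (X + Y) + Z := match u with inl x => inl (inl x) | inr z => inr z end.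
Definition tg (u : Y + Z) : (X + Y) + Z := match u with inl y => inl (inr y) | inr z => inr z end.

Variables (p : X + Y -> X + Y) (q : Y + Z -> Y + Z) (r : X + Z -> X + Z) (rho : Y -> X + Z).

Definition rho3 (s : (X + Y) + Z) : X + Z :=
  match s with inl (inl x) => inl x | inl (inr y) => rho y | inr z => inr z end.

(** An abstract stand-in for connectivity of the two stacked diagrams. Quantifying over all such
    relations lets the criterion be verified on points of the sum types, without their numbers. *)
Definition linked (R : (X + Y) + Z -> (X + Y) + Z -> Prop) :=
  [/\ forall s, R s s, forall s s', R s s' -> R s' s,
      forall s s' s'', R s s' -> R s' s'' -> R s s'',
      forall u, R (inl u) (inl (p u)) & forall u, R (tg u) (tg (q u))].

(* Every middle point [y] is joined to the outer point [rho y], and [rho] is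
   compatible with the edges: the composite of [p] and [q] is then [r], without loops. *)
Lemma comp_criterion (P : palette) (c d e : seq P) (f : BDiag c d) (g : BDiag d e) (h : BDiag c e) :
  size c = #|X| -> size d = #|Y| -> size e = #|Z| ->
  follows f p -> follows g q -> follows h r ->
  (forall u, let v := rho3 (inl (p u)) in v = rho3 (inl u) \/ v = r (rho3 (inl u))) ->
  (forall u, let v := rho3 (tg (q u)) in v = rho3 (tg u) \/ v = r (rho3 (tg u))) ->
  (forall R, linked R -> (forall y, R (inl (inr y)) (te (rho y))) /\
                        (forall u, R (te u) (te (r u)))) ->
  loops_eqv (bloops h) (bloops f ++ bloops g) ->
  BDis_comp f g h.
Proof.
move=> sc sd se hf hg hh E1 E2 H Hl.
pose a := #|X|; pose b := #|Y|; pose k := #|Z|.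
pose edge i j := (i < a + b /\ j = bpair f i) \/ (a <= i /\ i < a + b + k /\ j = a + bpair g (i - a)).
pose connB := clos_refl_trans nat edge.
pose emb i := if i < a then i else i + b.
pose innerB i := (a <= i /\ i < a + b) /\ forall q, connB i q -> a <= q /\ q < a + b.
pose c3 (s : (X + Y) + Z) := code s.
have cXY (u : X + Y) : c3 (inl u) = code u by rewrite /c3 /= -code_rk.
have cte u : c3 (te u) = emb (code u).
  case: u => [x|z]; rewrite /emb; first by rewrite cXY /= rk_lt.
  by rewrite /c3 /= ltnNge leq_addr /= card_sum -/a -/b; lia.
have ctg u : c3 (tg u) = a + code u.
  by case: u => [y|z]; rewrite ?cXY // /c3 /= card_sum -/a -/b; lia.
have rr u : r (r u) = u.
  have hh2 := hh (r u); rewrite hh -?hh in hh2.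
  have [_ [_ e1]] := bd_pairing h (i := code u) ltac:(rewrite sc se; exact: code_lt).
  by apply: code_inj; rewrite -!hh e1.
have st i j : edge i j -> forall s, i = c3 s -> exists2 s', j = c3 s' & rho3 s' = rho3 s \/ rho3 s' = r (rho3 s).
  case=> [[hi ->]|[h1 [h2 ->]]] s ei; subst i.
    case: s hi => [u|z]; last by rewrite /c3 /= card_sum -/a -/b; lia.
    by move=> _; exists (inl (p u)); [rewrite !cXY hf|exact: E1].
  have [u eu] : exists u, s = tg u.
    case: s h1 h2 => [[x|y]|z] h1 h2; [|by exists (inl y)|by exists (inr z)].
    by have := rk_lt x; move: h1; rewrite cXY /= -/a; lia.
  by subst s; exists (tg (q u)); [rewrite !ctg addKn hg|exact: E2].
have inv i j : connB i j -> forall s, i = c3 s -> exists2 s', j = c3 s' & rho3 s' = rho3 s \/ rho3 s' = r (rho3 s).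
  elim=> {i j} [i j|i s ->|i j l _ IH1 _ IH2 s /IH1 [s' /IH2 [s'' -> h2] h1]].
  - exact: st.
  - by exists s => //; left.
  - by exists s'' => //; case: h2 => ->; case: h1 => ->; rewrite ?rr; auto.
have edge_sym i j : edge i j -> edge j i.
  case=> [[hi ->]|[h1 [h2 ->]]].
    by have [h1 [_ h2]] := bd_pairing f (i := i) ltac:(rewrite sc sd; lia); left; rewrite h2; rewrite sc sd in h1.
  have [h3 [_ h4]] := bd_pairing g (i := i - a) ltac:(rewrite sd se -/b -/k; lia).
  right; rewrite addKn h4; rewrite sd se in h3; lia.
have [Hy Hr] : (forall y, connB (c3 (inl (inr y))) (c3 (te (rho y)))) /\
               (forall u, connB (c3 (te u)) (c3 (te (r u)))).
  apply: (H (fun s s' => connB (c3 s) (c3 s'))); split.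
  - by move=> s; exact: rt_refl.
  - by move=> s s'; apply: clos_rt_sym.
  - by move=> s s' s''; exact: rt_trans.
  - by move=> u; apply: rt_step; left; rewrite !cXY hf; split=> //; exact: code_lt.
  - move=> u; apply: rt_step; right; rewrite !ctg addKn hg; have := code_lt u.
    by rewrite -/b -/k; lia.
rewrite /BDis_comp sc sd se -/a -/b -/k.
split.
  move=> i j hi hj ij; have [u eu] := code_surj hi; have [v ev] := code_surj hj; subst i j.
  rewrite hh -/(emb _) -/(emb _) -!cte; split=> [/code_inj <-|]; first exact: Hr.
  move=> /(inv _ _) /(_ _ erefl) [s' e1].
  have e2 : s' = te v by apply: (@code_inj _ _ s' (te v)); rewrite -[LHS]/(c3 s') -e1.
  have rt w : rho3 (te w) = w by case: w.
  by rewrite e2 !rt => -[e3|->//]; case: ij; rewrite e3.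
(* Every middle point is connected to an outer one, so the list of loops created by the composition
   is empty. *)
have noinner i : ~ innerB i.
  case=> [[h1 h2] h3]; have [s es] : exists s, c3 s = i.
    by apply: code_surj; rewrite card_sum -/a -/b; lia.
  case: s es => [[x|y]|z] es.
  - by have := rk_lt x; move: h1; rewrite -es cXY /= -/a; lia.
  - have := Hy y; rewrite es => /h3; rewrite cte /emb; case: ifP; lia.
  - by move: h2; rewrite -es /c3 /= card_sum -/a -/b; lia.
exists [::], [::]; split; first by constructor.
split; first by []. split; first by move=> i /noinner. split; first by [].
by split; [constructor|rewrite cats0].
Qed.
End Criterion.

(** * Transport along equalities of colour lists *)

Section Cast.
Variables (P : palette) (a : CircAlg P).
Implicit Types (c d e : seq P).
Let ax := ca_ax a.

Definition cst c d (E : c = d) (x : a c) : a d := eq_rect c (fun c => a c) x d E.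

Lemma cst_id c (E : c = c) x : cst E x = x.
Proof. by rewrite (proof_irrelevance _ E erefl). Qed.

Lemma cst_cst c d e (E : c = d) (E' : d = e) (E'' : c = e) x : cst E' (cst E x) = cst E'' x.
Proof. by subst; rewrite !cst_id. Qed.

Lemma amap_cst c d c' d' (Ec : c = c') (Ed : d = d') (D : BDiag c d) (D' : BDiag c' d') x :
  bpair D =1 bpair D' -> loops_eqv (bloops D) (bloops D') ->
  amap a D' (cst Ec x) = cst Ed (amap a D x).
Proof. by subst => h l; rewrite !cst_id; apply/esym/(amap_eqv ax). Qed.

Lemma mu_cst c d e c' d' e' (Ec : c = c') (Ed : d = d') (Ee : e = e') H H' x y :
  mu a (e := e') H' (cst Ec x) (cst Ed y) = cst Ee (mu a (e := e) H x y).
Proof. by subst; rewrite !cst_id; congr mu; exact: proof_irrelevance. Qed.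

Lemma amap_idcst c d (D : BDiag c d) (E : c = d) x :
  (forall i, i < size c -> bpair D i = i + size c) -> bloops D = [::] -> amap a D x = cst E x.
Proof. by subst => h l; rewrite cst_id (amap_id ax). Qed.
End Cast.

(** * Diagrams without cups *)

Section Cupless.
Variables (P : palette) (X Z : finType).

(** Encodes a diagram without cups from [X] to [Z]: target [z] is joined to source [o z], and the
    sources missed by [o] are capped in pairs by [tau]. The values of [tau] matter only outside the
    image of [o]. *)
Definition okcl (k : X -> P) (o : Z -> X) (tau : X -> X) :=
  injective o /\ forall x, x \notin codom o ->
    [/\ tau x \notin codom o, tau x <> x, tau (tau x) = x & k (tau x) = pinv (k x)].

Definition pcl (o : Z -> X) (tau : X -> X) (u : X + Z) : X + Z :=
  match u with
  | inl x => if [pick z | o z == x] is Some z then inr z else inl (tau x)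
  | inr z => inl (o z) end.

Lemma pcl_in o tau z : injective o -> pcl o tau (inl (o z)) = inr z.
Proof.
move=> oi /=; case: pickP => [w /eqP /oi -> //|h].
by have := h z; rewrite eqxx.
Qed.

Lemma pcl_out o tau x : x \notin codom o -> pcl o tau (inl x) = inl (tau x).
Proof. by move=> h /=; case: pickP => // z /eqP e; rewrite -e codom_f in h. Qed.

Lemma okcl_fpairing k o tau : okcl k o tau -> fpairing k (k \o o) (pcl o tau).
Proof.
case=> oi h [x|z].
  have [/codomP [z ->]|hx] := boolP (x \in codom o); first by rewrite pcl_in //.
  have [h1 h2 h3 h4] := h x hx; rewrite !pcl_out // h3; split=> // -[]; exact: h2.
by rewrite [pcl o tau (inr z)]/= pcl_in.
Qed.
End Cupless.

Section OperadOfAlgebra.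
Variables (P : palette) (a : CircAlg P).
Implicit Types (X Y Z : finType).
Let ax := ca_ax a.

Definition fS (X : finType) := {k : X -> P & a (map k (enum X))}.

Lemma fS_eq X (k k' : X -> P) x y : k =1 k' ->
  (forall E : map k (enum X) = map k' (enum X), cst E x = y) -> existT _ k x = existT _ k' y :> fS X.
Proof.
move=> /functional_extensionality h; subst k'.
by move=> /(_ erefl) <-.
Qed.

Definition dm X Y (t : fS X) (k : Y -> P) (D : BDiag (map (tag t) (enum X)) (map k (enum Y))) : fS Y :=
  existT _ k (amap a D (tagged t)).

Lemma dm_eq X Y (t : fS X) (k k' : Y -> P) D D' (p p' : X + Y -> X + Y) :
  k =1 k' -> follows D p -> follows D' p' -> p =1 p' -> loops_eqv (bloops D) (bloops D') ->
  @dm X Y t k D = @dm X Y t k' D'.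
Proof.
move=> /functional_extensionality h; subst k' => hD hD' hp hl.
congr existT; apply: (amap_eqv ax); apply: (follows_bdeq hD _ hl).
by move=> u; rewrite hD' hp.
Qed.

Lemma dm_id X (t : fS X) (k : X -> P) D (p : X + X -> X + X) :
  follows D p -> (forall x, p (inl x) = inr x) -> k =1 tag t -> bloops D = [::] -> @dm X X t k D = t.
Proof.
move=> hD hp /functional_extensionality hk hl; subst k.
case: t D hD hl => k x D hD hl; congr existT; apply: (amap_id ax); split=> // i.
by rewrite !size_enum_map => /rk_surj [y <-]; rewrite -[rk y]/(code (inl y : X + X)) hD hp /= addnC.
Qed.

Definition dcl X Z (t : fS X) (o : Z -> X) tau (H : okcl (tag t) o tau) : fS Z :=
  dm (mkbd (okcl_fpairing H) [::]).

Definition lift X Y Z (o : Z -> Y) (u : X + Z) : X + Y :=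
  match u with inl x => inl x | inr z => inr (o z) end.

(* Capping off targets of a diagram; no loop is closed as long as no cap joins
   the two ends of one strand, nor two capped points. *)
Lemma dm_dcl X Y Z (t : fS X) (k : Y -> P) (D : BDiag (map (tag t) (enum X)) (map k (enum Y)))
    (p : X + Y -> X + Y) (o : Z -> Y) tau (H : okcl k o tau) (D' : BDiag (map (tag t) (enum X)) (map (k \o o) (enum Z))) (r : X + Z -> X + Z) :
  follows D p -> follows D' r -> loops_eqv (bloops D') (bloops D) ->
  (forall y y', y \notin codom o -> p (inr y) = inr y' -> y' \in codom o) ->
  (forall u, lift o (r u) = match p (lift o u) with
     | inr y => if y \in codom o then inr y else p (inr (tau y)) | v => v end) ->
  @dcl Y Z (dm D) o tau H = @dm X Z t _ D'.
Proof.
move=> hD hD' hl hC hr; congr existT; symmetry.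
have [oi ho] := H.
set w := @lift X Y Z o in hr *.
have wi : injective w by move=> [x|z] [x'|z'] //= [] => [->|/oi ->].
have pp u : p (p u) = u.
  have [_ [_ e]] := bd_pairing D (i := code u) ltac:(rewrite !size_enum_map; exact: code_lt).
  by apply: (@code_inj X Y); rewrite -!hD.
(* The outer end reached from a middle point: the point itself if it is not capped, otherwise the
   other end of its strand in [D], which [hC] keeps from being capped as well. *)
have wex y : exists v, w v = if y \in codom o then inr y else p (inr y).
  case: ifP => [/codomP [z ->]|/negbT hy]; first by exists (inr z).
  case E : (p (inr y)) => [x|y']; first by exists (inl x).
  by have /codomP [z ->] := hC _ _ hy E; exists (inr z).
pose rho y := proj1_sig (constructive_indefinite_description _ (wex y)).
have rhoE y : w (rho y) = if y \in codom o then inr y else p (inr y).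
  by rewrite /rho; case: constructive_indefinite_description.
pose norm (u : X + Y) := match u with inr y => if y \in codom o then inr y else p (inr y) | v => v end.
have sE u : w (rho3 rho (inl u)) = norm u by case: u => [x|y] //=; exact: rhoE.
have hr' u : w (r u) = match p (w u) with
     | inr y => if y \in codom o then inr y else p (inr (tau y)) | v => v end by exact: hr.
have Lw R : linked p (pcl o tau) R -> forall v, R (inl (w v)) (te Y v).
  case=> h1 h2 h3 h4 h5 [x|z]; first exact: h1.
  by have := h5 (inr z) => /= /h2.
apply: (amap_comp ax); apply: (@comp_criterion X Y Z p (pcl o tau) r rho);
  rewrite ?size_enum_map //.
- exact: follows_mkbd.
- move=> u; cbv zeta; have [e|e] := classic (norm u = u); last first.
    left; apply: wi; rewrite !sE; case: u e => [x|y] //=; case: ifP => // /negbT hy _.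
    by case E : (p (inr y)) => [x|y'] //=; rewrite (hC _ _ hy E).
  case E : (p u) => [x|y].
    by right; apply: wi; rewrite -E hr' !sE e E.
  have [hy|hy] := boolP (y \in codom o).
    by right; apply: wi; rewrite hr' !sE e E /= hy.
  by left; apply: wi; rewrite !sE e /= (negbTE hy) -E pp.
- move=> [y|z]; cbv zeta; last first.
    by left; apply: wi; rewrite /= rhoE codom_f.
  have [/codomP [z ->]|hy] := boolP (y \in codom o).
    by left; apply: wi; rewrite pcl_in //= rhoE codom_f.
  have [h1 h2 h3 _] := ho y hy.
  right; apply: wi; rewrite pcl_out //= rhoE (negbTE h1) hr' rhoE (negbTE hy) pp.
  by rewrite (negbTE hy).
- move=> R hR; have [h1 h2 h3 h4 h5] := hR; have lw := Lw R hR; split.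
    move=> y; have := lw (rho y); rewrite rhoE; case: ifP => // _.
    by apply: h3; exact: h4.
  move=> u; apply: (h3 _ _ _ (h2 _ _ (lw u))); apply: (h3 _ _ _ (h4 (w u))).
  have := lw (r u); rewrite hr'; case E : (p (w u)) => [x|y] //.
  have [hy|hy] := boolP (y \in codom o) => // lwr; apply: (h3 _ _ _ _ lwr).
  by have := h5 (inl y); rewrite pcl_out //= => h6; apply: (h3 _ _ _ h6); exact: h4.
- by rewrite cats0.
Qed.

Lemma dcl_ext X Z (t : fS X) (o o' : Z -> X) tau tau' H H' :
  o =1 o' -> (forall x, x \notin codom o -> tau x = tau' x) ->
  @dcl X Z t o tau H = @dcl X Z t o' tau' H'.
Proof.
move=> ho ht; apply: (dm_eq _ (follows_mkbd _ _) (follows_mkbd _ _)); last exact: loops_eqv_refl.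
  by move=> z /=; rewrite ho.
case=> [x|z] /=; last by rewrite ho.
have [/codomP [z ->]|hx] := boolP (x \in codom o).
  rewrite [LHS]pcl_in; last by case: H.
  by rewrite ho [RHS]pcl_in //; case: H'.
rewrite [LHS]pcl_out // ht // [RHS]pcl_out //.
by rewrite -(eq_codom ho).
Qed.

Lemma dcl_id X (t : fS X) (o : X -> X) tau H : o =1 id -> @dcl X X t o tau H = t.
Proof.
move=> ho; apply: (dm_id (follows_mkbd _ _)) => // [x|x /=]; last by rewrite ho.
by rewrite -[x in inl x]ho pcl_in //; case: H.
Qed.

(** The surviving points compose, and the caps of the composite are those of the first diagram
    together with those of the second, transported back along [o1]. *)
Lemma dcl_comp X Y Z (t : fS X) (o1 : Y -> X) tau1 H1 (o2 : Z -> Y) tau2 H2 (o : Z -> X) tau H :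
  o =1 o1 \o o2 -> (forall x, x \notin codom o1 -> tau x = tau1 x) ->
  (forall y, y \notin codom o2 -> tau (o1 y) = o1 (tau2 y)) ->
  @dcl Y Z (@dcl X Y t o1 tau1 H1) o2 tau2 H2 = @dcl X Z t o tau H.
Proof.
move=> /functional_extensionality ho h1 h2; subst o.
have [i1 k1] := H1; have [i2 k2] := H2; have [i3 k3] := H.
apply: (dm_dcl _ (follows_mkbd _ _) (follows_mkbd _ _)) => //; first exact: loops_eqv_refl.
case=> [x|z]; last by [].
rewrite [lift o2 (inl x)]/=.
have [/codomP [y ->]|hx] := boolP (x \in codom o1); last first.
  rewrite (pcl_out (o := o1)) // pcl_out /= ?h1 //.
  by apply: contra hx => /codomP [z ->]; exact: codom_f.
rewrite (pcl_in (o := o1)) //.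
have [/codomP [z ->]|hy] := boolP (y \in codom o2).
  by rewrite -[o1 (o2 z)]/((o1 \o o2) z) pcl_in.
rewrite pcl_out /= ?h2 //.
by apply: contra hy => /codomP [z /i1 ->]; exact: codom_f.
Qed.
End OperadOfAlgebra.

(** * The operations of the operad and their axioms *)

Section OperadStructure.
Variables (P : palette) (a : CircAlg P).
Implicit Types (X Y Z : finType).
Let ax := ca_ax a.
Notation fS := (fS a).

Lemma cst_mu (c d e e' : seq P) (E : e = e') (H : e = c ++ d) H' x y :
  cst E (mu a H x y) = mu a (e := e') H' x y.
Proof. by subst e'; rewrite cst_id; congr mu; exact: proof_irrelevance. Qed.

Definition fmul X Y (t : fS X) (u : fS Y) : fS (X + Y)%type :=
  existT _ (csum (tag t) (tag u)) (mu a (map_enum_sum (csum (tag t) (tag u))) (tagged t) (tagged u)).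

Lemma enum_void (T : Type) (f : void -> T) : [::] = map f (enum (void : finType)).
Proof. by case: (enum _) => [//|[]]. Qed.

Definition funit : fS void :=
  existT _ (fun x : void => match x return P with end) (cst (enum_void _) (mu0 a)).

Lemma okcl_bij X Y (k : Y -> P) (e : bij X Y) : okcl k e id.
Proof.
split=> [|y /negP []]; first exact: bij_inj.
by rewrite -[y](binvK e); exact: codom_f.
Qed.

Definition fact X Y (e : bij X Y) (t : fS Y) : fS X := dcl (okcl_bij (tag t) e).

Definition swp (T : eqType) (x y z : T) := if z == x then y else if z == y then x else z.

Lemma codom_rem2 X (x y z : X) : (z \notin codom (val : rem2 x y -> X)) = (z == x) || (z == y).
Proof.
apply/idP/idP => [|h]; last first.
  by apply/negP => /codomP [[w /= hw] e]; move: h; rewrite e -[_ || _]negbK negb_or hw.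
apply: contraR; rewrite negb_or => h.
by apply/codomP; exists (exist (fun w => (w != x) && (w != y)) z h).
Qed.

Lemma okcl_zeta X (k : X -> P) (x y : X) : x != y -> k x = pinv (k y) ->
  okcl k (val : rem2 x y -> X) (swp x y).
Proof.
move=> n H; split; first exact: val_inj.
move=> z; rewrite !codom_rem2 => /orP [] /eqP -> {z}; rewrite /swp !eqxx.
  rewrite (eq_sym y x) (negbTE n) ?eqxx ?orbT /=; split=> //; last by rewrite H pinvK.
  by move=> e; rewrite e eqxx in n.
rewrite (eq_sym y x) (negbTE n) ?eqxx ?orbT /=; split=> //.
by move=> e; rewrite e eqxx in n.
Qed.

Definition fzeta X (x y : X) (n : x != y) (t : fS X) (H : tag t x = pinv (tag t y)) : fS (rem2 x y) :=
  dcl (okcl_zeta n H).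

Definition cupcol (c : P) (i : 'I_2) := if i == pt1 then c else pinv c.
Definition pcup (u : void + 'I_2) : void + 'I_2 :=
  match u with inl x => inl x | inr i => inr (swap2 i) end.

Lemma swap2_neq i : swap2 i <> i.
Proof. by case: i => [[|[|i]] hi]. Qed.

Lemma cupcol_swap c i : cupcol c (swap2 i) = pinv (cupcol c i).
Proof. by rewrite /cupcol; case: i => [[|[|i]] hi] //=; rewrite pinvK. Qed.

Lemma fpairing_cup (k : void -> P) (l : 'I_2 -> P) :
  (forall i, l (swap2 i) = pinv (l i)) -> fpairing k l pcup.
Proof.
move=> h [[]|i]; split => /=; first by rewrite swap2K.
  by case; exact: swap2_neq.
exact: h.
Qed.

Definition fepsu (c : P) : fS 'I_2 :=
  dm (t := funit) (mkbd (fpairing_cup (tag funit) (cupcol_swap c)) [::]).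

Definition fdata : CircOpData P :=
  @MkCircOpData P fS (@fact) (fun (X : finType) (x : X) (t : fS X) => tag t x)
    (@fmul) funit (@fzeta) fepsu.

Definition embl X X' Y Y' (u : X + Y) : (X + X') + (Y + Y') :=
  match u with inl x => inl (inl x) | inr y => inr (inl y) end.
Definition embr X X' Y Y' (u : X' + Y') : (X + X') + (Y + Y') :=
  match u with inl x => inl (inr x) | inr y => inr (inr y) end.

Lemma dm_mul X X' Y Y' (t : fS X) (t' : fS X') (k : Y -> P) (k' : Y' -> P)
   D (p : X + Y -> X + Y) D' (p' : X' + Y' -> X' + Y') D'' p'' :
  follows D p -> follows D' p' -> follows D'' p'' ->
  (forall u, p'' (embl X' Y' u) = embl X' Y' (p u)) ->
  (forall u, p'' (embr X Y u) = embr X Y (p' u)) -> bloops D'' = bloops D ++ bloops D' ->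
  fmul (@dm P a X Y t k D) (@dm P a X' Y' t' k' D') = @dm P a _ _ (fmul t t') (csum k k') D''.
Proof.
move=> h h' h'' E E' El; congr existT; symmetry; apply: (mu_nat ax).
rewrite /BDis_tensor !size_enum_map; split; [|split=> //] => _ /code_surj [u <-].
  have C (v : X + Y) : code (embl X' Y' v) = if code v < #|X| then code v else code v + #|X'|.
    case: v => [x|y]; rewrite /code /embl rk_inl; first by rewrite rk_lt.
    rewrite card_sum ifF; lia.
  by rewrite -C h'' E h C.
have C (v : X' + Y') : code (embr X Y v) = if code v < #|X'| then #|X| + code v else #|X| + #|Y| + code v.
  case: v => [x|y]; rewrite /code /embr rk_inr; first by rewrite rk_lt.
  rewrite card_sum ifF; lia.
by rewrite -C h'' E' h' C.
Qed.

Lemma okcl_comp X Y Z (k : X -> P) (o1 : Y -> X) tau1 (o2 : Z -> Y) tau2 (o : Z -> X) tau :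
  okcl k o1 tau1 -> okcl (k \o o1) o2 tau2 -> o =1 o1 \o o2 ->
  (forall x, x \notin codom o1 -> tau x = tau1 x) ->
  (forall y, y \notin codom o2 -> tau (o1 y) = o1 (tau2 y)) -> okcl k o tau.
Proof.
move=> [i1 h1] [i2 h2] /functional_extensionality -> E1 E2; split; first exact: inj_comp.
have c1 x : x \notin codom o1 -> x \notin codom (o1 \o o2).
  by apply: contra => /codomP [z ->]; exact: codom_f.
have c2 y : y \notin codom o2 -> o1 y \notin codom (o1 \o o2).
  by apply: contra => /codomP [z /i1 ->]; exact: codom_f.
move=> x hx; have [/codomP [y ey]|hx1] := boolP (x \in codom o1).
  have hy : y \notin codom o2.
    by apply: contra hx => /codomP [z ez]; rewrite ey ez; exact: (codom_f (o1 \o o2)).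
  have [g1 g2 g3 g4] := h2 y hy; rewrite ey E2 //; split.
  - exact: c2.
  - by move/i1.
  - by rewrite E2 // g3.
  - exact: g4.
have [g1 g2 g3 g4] := h1 x hx1; rewrite E1 //; split=> //; first exact: c1.
by rewrite E1.
Qed.

(** The validity proof of the composite is packed into an existential. An identity between iterated
    relabellings and contractions thus reduces to comparing [o] and [tau], by [dcl_ext]. *)
Lemma dcl2 X Y Z (t : fS X) (o1 : Y -> X) tau1 H1 (o2 : Z -> Y) tau2 H2 (o : Z -> X) tau :
  o =1 o1 \o o2 -> (forall x, x \notin codom o1 -> tau x = tau1 x) ->
  (forall y, y \notin codom o2 -> tau (o1 y) = o1 (tau2 y)) ->
  exists H, @dcl P a Y Z (@dcl P a X Y t o1 tau1 H1) o2 tau2 H2 = @dcl P a X Z t o tau H.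
Proof.
move=> ho h1 h2; have H := okcl_comp H1 H2 ho h1 h2.
by exists H; exact: dcl_comp.
Qed.

Lemma dcl_mul X X' Z Z' (t : fS X) (t' : fS X') (o : Z -> X) tau H (o' : Z' -> X') tau' H'
   (O : Z + Z' -> X + X') T (HO : okcl (tag (fmul t t')) O T) :
  (forall z, O (inl z) = inl (o z)) -> (forall z, O (inr z) = inr (o' z)) ->
  (forall x, x \notin codom o -> T (inl x) = inl (tau x)) ->
  (forall x, x \notin codom o' -> T (inr x) = inr (tau' x)) ->
  fmul (@dcl P a X Z t o tau H) (@dcl P a X' Z' t' o' tau' H') = @dcl P a _ _ (fmul t t') O T HO.
Proof.
move=> E1 E2 T1 T2.
have kO : csum (tag t \o o) (tag t' \o o') =1 tag (fmul t t') \o O by case=> z /=; rewrite ?E1 ?E2.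
have iO : injective O by case: HO.
have oi : injective o by case: H. have oi' : injective o' by case: H'.
have OK : fpairing (tag (fmul t t')) (csum (tag t \o o) (tag t' \o o')) (pcl O T).
  move=> u; have [h1 h2 h3] := okcl_fpairing HO u; split=> //.
  have E v : csum (tag (fmul t t')) (csum (tag t \o o) (tag t' \o o')) v =
             csum (tag (fmul t t')) (tag (fmul t t') \o O) v by case: v => // v; exact: kO.
  by rewrite !E.
rewrite /dcl (@dm_mul _ _ _ _ _ _ _ _ _ (pcl o tau) _ (pcl o' tau') (mkbd OK [::]) (pcl O T)) //;
  try exact: follows_mkbd.
- by apply: (dm_eq kO (follows_mkbd _ _) (follows_mkbd _ _)) => //; exact: loops_eqv_refl.
- case=> [x|z]; last by rewrite [LHS]/= E1.
  have [/codomP [z ->]|hx] := boolP (x \in codom o).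
    by rewrite (@pcl_in _ _ o) //= -E1 -/(pcl O T (inl (O (inl z)))) pcl_in.
  rewrite (@pcl_out _ _ o) // [embl _ _ _]/= pcl_out ?T1 //.
  by apply: contra hx => /codomP [[z|z]]; rewrite ?E1 ?E2 // => -[->]; exact: codom_f.
case=> [x|z]; last by rewrite [LHS]/= E2.
have [/codomP [z ->]|hx] := boolP (x \in codom o').
  by rewrite (@pcl_in _ _ o') //= -E2 -/(pcl O T (inl (O (inr z)))) pcl_in.
rewrite (@pcl_out _ _ o') // [embr _ _ _]/= pcl_out ?T2 //.
by apply: contra hx => /codomP [[z|z]]; rewrite ?E1 ?E2 // => -[->]; exact: codom_f.
Qed.

(** A bijection preserving ranks gives the identity diagram, up to transport of its list.
    Associativity and the unit laws relabel along bijections of this kind. *)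
Lemma fact_rk X Y (e : bij X Y) (t : fS Y) E : (forall x, rk (e x) = rk x) ->
  fact e t = existT _ (tag t \o e) (cst E (tagged t)).
Proof.
move=> h; congr existT; apply: amap_idcst => // i; rewrite !size_enum_map => /rk_surj [y <-].
rewrite -[rk y]/(code (inl y : Y + X)) follows_mkbd -[y](binvK e) pcl_in /=; last exact: bij_inj.
by rewrite h addnC.
Qed.

Lemma fS_eta X (t : fS X) : existT _ (tag t) (tagged t) = t.
Proof. by case: t. Qed.

Lemma fact_id X (e : bij X X) (t : fS X) : (forall z, e z = z) -> fact e t = t.
Proof. by move=> h; exact: dcl_id. Qed.

Lemma not_codom_bij X Y (e : bij X Y) y : y \in codom e.
Proof. by rewrite -[y](binvK e); exact: codom_f. Qed.

Lemma fact_dcl X Y Z (e : bij Z Y) (t : fS X) (o : Y -> X) tau H (o' : Z -> X) : o' =1 o \o e ->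
  exists H', fact e (@dcl P a X Y t o tau H) = @dcl P a X Z t o' tau H'.
Proof. by move=> h; apply: dcl2 => // y; rewrite not_codom_bij. Qed.

Lemma fmul_unitr X (t : fS X) (e : bij X (X + void)%type) : (forall x, e x = inl x) ->
  fact e (fmul t funit) = t.
Proof.
move=> he; have hr x : rk (e x) = rk x by rewrite he rk_inl.
rewrite (@fact_rk _ _ _ _ (map_enum_rk (k := tag (fmul t funit)) hr (fun=> erefl))) //.
rewrite -[RHS]fS_eta; apply: fS_eq => [x|E]; first by rewrite /= he.
set E1 := map_enum_rk _ _.
rewrite (cst_cst _ _ (etrans E1 E)) /=.
set H := map_enum_sum _; set E2 := etrans E1 E.
move: (enum_void _) H E2 => /=; move: (map _ (enum (void : finType))) => d Eu H E2.
by subst d => /=; rewrite (cst_mu _ _ (esym (cats0 _))) (mu_unitr ax).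
Qed.

(** For relabelling and contraction both sides of an axiom are one diagram without cups. The product
    laws come from [mu], and the two laws of the wire from [dm_dcl], which follows a strand of the
    cup through the relabelling or the cap. *)
Lemma fax : is_circuit_operad fdata.
Proof.
split=> /=.
- by move=> X e he t; exact: fact_id.
- move=> X Y Z e1 e2 e3 h t; rewrite {2}/fact.
  have [H ->] := @fact_dcl _ _ _ e1 t e2 id (okcl_bij (tag t) e2) e3 h.
  by apply: dcl_ext => // x; rewrite not_codom_bij.
- by [].
- move=> X X' Y Y' e1 e2 e h1 h2 t u; symmetry; apply: dcl_mul => //.
- move=> X Y Z e h1 h2 h3 t u v.
  have hr x : rk (e x) = rk x.
    by case: x => [[x|y]|z]; rewrite ?h1 ?h2 ?h3 !(rk_inl, rk_inr) // card_sum; lia.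
  rewrite (@fact_rk _ _ _ _ (map_enum_rk (k := tag (fmul t (fmul u v))) hr (fun=> erefl))) //.
  apply: fS_eq => [[[x|y]|z]|E] /=; rewrite ?h1 ?h2 ?h3 //.
  rewrite (cst_cst _ _ (etrans (map_enum_rk hr (fun=> erefl)) E)).
  set H1 := map_enum_sum _; set H2 := map_enum_sum _; set H3 := map_enum_sum _; set H4 := map_enum_sum _.
  set E2 := etrans _ _.
  rewrite (cst_mu _ _ (etrans (esym E2) H1)).
  by rewrite (mu_assoc ax H4 H3 H2 (etrans (esym E2) H1)).
- by move=> X e he t; exact: fmul_unitr.
- move=> X e he t; have hr x : rk (e x) = rk x by rewrite he rk_inr card_void.
  rewrite (@fact_rk _ _ _ _ (map_enum_rk (k := tag (fmul funit t)) hr (fun=> erefl))) //.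
  rewrite -[RHS]fS_eta; apply: fS_eq => [x|E]; first by rewrite /= he.
  set E1 := map_enum_rk _ _.
  rewrite (cst_cst _ _ (etrans E1 E)) /=.
  set H := map_enum_sum _; set E2 := etrans E1 E.
  move: (enum_void _) H E2 => /=; move: (map _ (enum (void : finType))) => d Eu H E2.
  by subst d => /=; rewrite (cst_mu _ _ (erefl : map (tag t) (enum X) = [::] ++ map (tag t) (enum X))) (mu_unitl ax).
- move=> X Y e h1 h2 t u; apply: fS_eq => [[x|y]|E] /=; rewrite ?h1 ?h2 //.
  set H1 := map_enum_sum _; set H2 := map_enum_sum _; set D := mkbd _ _.
  rewrite (mu_sym ax H1 (etrans E H2)); first exact: cst_mu.
  have ei : injective e by exact: bij_inj.
  rewrite /BDis_swap !size_enum_map; split; [|split=> //] => _ /rk_surj [z <-].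
    rewrite -(@rk_inl Y X) -[rk _]/(code (inl (inl z) : (Y + X) + (X + Y))) follows_mkbd.
    by rewrite -h2 pcl_in //= h2 rk_inr rk_inl card_sum -!addnA.
  rewrite -(@rk_inr Y X) -[rk _]/(code (inl (inr z) : (Y + X) + (X + Y))) follows_mkbd.
  by rewrite -h1 pcl_in //= rk_inl card_sum.
- by [].
- by [].
- move=> X Y e x y nxy nexy t H H' e' he'.
  have [H1 ->] := @fact_dcl _ _ _ e' t _ _ (okcl_zeta nexy H) (e \o val) (fun z => esym (he' z)).
  have [|z|z hz|H2 E] := @dcl2 _ _ _ t e id (okcl_bij (tag t) e) _ _ (okcl_zeta nxy H') (e \o val) (swp (e x) (e y)).
  + by [].
  + by rewrite not_codom_bij.
  + by rewrite /swp !(inj_eq (@bij_inj _ _ e)); case: ifP => // _; case: ifP.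
  + rewrite /fzeta /fact E; exact: dcl_ext.
- by [].
- move=> X x y w z nxy nwz w1 z1 x2 y2 n1 n2 t H1 H3 H2 H4 e ew ez ex ey he.
  (* The common description of both iterated contractions: [x] capped with [y], and [w] with [z]. *)
  pose T u := if u == x then y else if u == y then x else swp w z u.
  have vi (c d : X) : injective (val : rem2 c d -> X) by exact: val_inj.
  have xw : x != w by rewrite -ex; case/andP: (valP x2).
  have xz : x != z by rewrite -ex; case/andP: (valP x2).
  have yw : y != w by rewrite -ey; case/andP: (valP y2).
  have yz : y != z by rewrite -ey; case/andP: (valP y2).
  have [||u hu|H5 E5] := @dcl2 _ _ _ t _ _ (okcl_zeta nxy H1) _ _ (okcl_zeta n1 H2) (val \o val) T.
  + by [].
  + move=> u; rewrite codom_rem2 /T /swp => /orP [] /eqP ->; rewrite !eqxx //.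
  + have /andP [/negbTE ux /negbTE uy] := valP u.
    by rewrite /T ux uy /swp -ew -ez !(inj_eq (vi _ _)); case: ifP => // _; case: ifP.
  + have [||u hu|H6 E6] := @dcl2 _ _ _ t _ _ (okcl_zeta nwz H3) _ _ (okcl_zeta n2 H4) (val \o val) T.
    * by [].
    * move=> u; rewrite codom_rem2 /T => /orP [] /eqP ->.
        by rewrite (eq_sym w x) (eq_sym w y) (negbTE xw) (negbTE yw).
      by rewrite (eq_sym z x) (eq_sym z y) (negbTE xz) (negbTE yz).
    * move: hu; rewrite codom_rem2 => hu.
      rewrite /T -ex -ey !(inj_eq (vi _ _)) /swp.
      by case/orP: hu => /eqP ->; rewrite !eqxx //; case: ifP.
    * rewrite /fzeta E5 E6.
      have [H7 ->] := @fact_dcl _ _ _ e t _ _ H6 (val \o val) (fun u => esym (he u)).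
      exact: dcl_ext.
- move=> X Y x y nxy nxy' t u H H' e he.
  pose oo (v : (rem2 x y + Y)%type) : X + Y := match v with inl v => inl (val v) | inr w => inr w end.
  have [H1 E1] : exists H1, fmul (fzeta nxy H) u =
     @dcl P a _ _ (fmul t u) oo (swp (inl x) (inl y)) H1.
    have H1 : okcl (tag (fmul t u)) oo (swp (inl x) (inl y)).
      have [_ h] := @okcl_zeta _ (tag (fmul t u)) _ _ nxy' H'.
      have cE v : (v \in codom oo) = (v \in codom (val : rem2 (inl x : (X + Y)%type) (inl y) -> _)).
        apply/codomP/codomP => -[v1 ->].
          by exists (binv e v1); have := he (binv e v1); rewrite binvK; exact: esym.
        by exists (e v1); exact: he.
      split; first by move=> [v|v] [w|w] // [] => [/val_inj ->|->].
      by move=> v; rewrite cE => /h [h1 h2 h3 h4]; split=> //; rewrite cE.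
    exists H1; rewrite -[u in fmul _ u](@fact_id _ (bij_id Y)) //.
    apply: dcl_mul => // v.
    by rewrite /swp !(inj_eq inl_inj) => _; case: ifP => // _; case: ifP.
  rewrite E1.
  have [|H2 ->] := @fact_dcl _ _ _ e _ _ _ H1 val.
    by move=> v; rewrite /= he.
  exact: dcl_ext.
- move=> c e e1 e2.
  have eE i : e i = swap2 i.
    case: (i =P pt1) => [->|n]; first by rewrite e1.
    have -> : i = pt2 by case: i n => [[|[|i]] hi] // n; [case: n|]; apply: val_inj.
    by rewrite e2.
  have h i : (cupcol c \o e) (swap2 i) = pinv ((cupcol c \o e) i).
    by rewrite /= !eE swap2K cupcol_swap pinvK.
  rewrite /fact /fepsu (@dm_dcl _ _ _ _ _ _ _ _ pcup _ _ _ (mkbd (fpairing_cup (tag funit) h) [::]) pcup);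
    try exact: follows_mkbd.
  + apply: (dm_eq _ (follows_mkbd _ _) (follows_mkbd _ _)) => //; last exact: loops_eqv_refl.
    by move=> i; rewrite /= eE cupcol_swap /cupcol; case: ifP; rewrite ?pinvK.
  + exact: loops_eqv_refl.
  + by move=> y y'; rewrite not_codom_bij.
  + by case=> [[]|i]; rewrite /= not_codom_bij !eE.
- by [].
- move=> X x n t H e he.
  pose c := tag t x.
  have [H1 E1] := @fact_dcl _ _ _ e (fmul t (fepsu c)) _ _
    (@okcl_zeta _ (tag (fmul t (fepsu c))) (inl x) (inr pt2) n H) _ (frefl _).
  rewrite E1 {E1}.
  pose O : X -> X + 'I_2 := fun w => if w == x then inr pt1 else inl w.
  have [H2 ->] : exists H2, dcl H1 = @dcl P a _ _ (fmul t (fepsu c)) O (swp (inl x) (inr pt2)) H2.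
    have Oe : val \o e = O by apply: functional_extensionality => w; rewrite /= he.
    by move: H1; rewrite Oe => H1; exists H1.
  (* Writing [t] as its own image under the identity diagram turns its juxtaposition with the cup
     into the single diagram [p]. *)
  pose pI (u : X + X) : X + X := match u with inl x => inr x | inr x => inl x end.
  have fI : fpairing (tag t) (tag t) pI by case.
  have Et : t = @dm P a X X t (tag t) (mkbd fI [::]).
    by symmetry; apply: (dm_id (follows_mkbd fI _)).
  pose p (u : (X + void) + (X + 'I_2)) : (X + void) + (X + 'I_2) :=
    match u with
    | inl (inl z) => inr (inl z) | inl (inr z) => match z with end
    | inr (inl z) => inl (inl z) | inr (inr i) => inr (inr (swap2 i)) end.
  have fp : fpairing (tag (fmul t funit)) (csum (tag t) (cupcol c)) p.
    case=> [[z|[]]|[z|i]] //; split=> /=; rewrite ?swap2K //; last exact: cupcol_swap.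
    by case; exact: swap2_neq.
  have Em : fmul t (fepsu c) = @dm P a _ _ (fmul t funit) (csum (tag t) (cupcol c)) (mkbd fp [::]).
    rewrite [in LHS]Et /fepsu; apply: (dm_mul (follows_mkbd fI _) (follows_mkbd _ _) (follows_mkbd fp _)) => //.
      by case.
    by case=> [[]|].
  move: H2; rewrite Em => H2.
  (* The cap joins the strand of [x] to the second end of the cup. The strand straightens: [x]
     leaves at the first end of the cup, and the identity remains. *)
  pose r (u : (X + void) + X) : (X + void) + X :=
    match u with inl (inl z) => inr z | inl (inr z) => match z with end | inr z => inl (inl z) end.
  have fr : fpairing (tag (fmul t funit)) (csum (tag t) (cupcol c) \o O) r.
    case=> [[z|[]]|z] /=; split=> //=; rewrite /O; by case: (z =P x) => [->|].
  have Oi : injective O by case: H2.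
  have Oout z : (z \notin codom O) = (z == inl x) || (z == inr pt2).
    apply/idP/idP => [|h].
      apply: contraR; rewrite negb_or => /andP [h1 h2].
      case: z h1 h2 => [z|i] h1 h2.
        by have -> : inl z = O z; [rewrite /O; case: (z =P x) => // e1; rewrite e1 eqxx in h1|exact: codom_f].
      have -> : inr i = O x; last exact: codom_f.
      rewrite /O eqxx; congr inr; apply: val_inj.
      by case: i h2 {h1} => [[|[|i]] hi].
    apply/negP => /codomP [w ew]; move: h; rewrite ew /O; case: (w =P x) => [_|ne]; first by [].
    by case/orP => /eqP // -[].
  rewrite (@dm_dcl _ _ _ _ _ _ _ _ p _ _ _ (mkbd fr [::]) r); try exact: follows_mkbd.
  + pose je z := inl z : X + void.
    pose jv (z : X + void) : X := match z with inl z => z | inr v => match v with end end.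
    have K1 : cancel je jv by []. have K2 : cancel jv je by case=> [|[]].
    rewrite -[RHS](@fmul_unitr _ _ (Bij K1 K2 : bij X (X + void)%type)) //.
    apply: (dm_eq _ (follows_mkbd _ _) (follows_mkbd _ _)); last exact: loops_eqv_refl.
      by move=> z; rewrite /= /O; case: (z =P x) => [->|].
    case=> [[z|[]]|z]; last by [].
    by rewrite -[inl z in RHS]/((Bij K1 K2 : bij X (X + void)%type) z) pcl_in //; exact: bij_inj.
  + exact: loops_eqv_refl.
  + move=> y y'; rewrite Oout => /orP [] /eqP ->; first by [].
    move=> /= [<-].
    by rewrite -[_ \in _]negbK Oout.
  case=> [[z|[]]|z].
    rewrite [lift _ _]/= [p _]/=; case: ifP => [/codomP [w ew]|/negbT].
      have ezw : w = z by move: ew; rewrite /O; case: (w =P x) => // _ [->].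
      by rewrite [in RHS]ew ezw.
    rewrite Oout orbF => /eqP [->]; rewrite /swp eqxx.
    by rewrite /= /O eqxx.
  rewrite [lift O (inr z)]/= [lift O _]/= /O; case: (z =P x) => [->|nz] //=.
  rewrite ifF; last by apply/negbTE; rewrite Oout.
  by rewrite /swp.
Qed.

Definition foper : CircOp P := MkCircOp fax.
End OperadStructure.

(** * Functoriality *)

Section OperadMorphism.
Variables (P Q : palette) (g : palmap P Q) (s : CircOp P) (s' : CircOp Q) (h : COhom g s s').
Implicit Types (t u : nom s).

Definition nmap t : nom s' := existT _ (tag t) (cm h (tagged t)).

Lemma nmap_nm (X : finType) (r : X -> nat) (ri : injective r) phi :
  nmap (nm ri phi) = nm ri (cm h phi).
Proof. by rewrite /nmap /nm /= cm_act. Qed.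

Lemma chn_nmap t k : chn (nmap t) k = omap g (chn t k).
Proof.
case: (nmP t) => X [r [ri [phi ->]]]; rewrite nmap_nm.
have [[x <- ->]|[hk ->]] := chn_nmP ri phi k; first by rewrite chn_nm cm_ch.
by rewrite chn_nm_None.
Qed.

Lemma nmap_np t u : disj t u -> nmap (np t u) = np (nmap t) (nmap u).
Proof.
case/npE => X [Y [r [ri [r' [ri' [phi [psi [H [-> -> ->]]]]]]]]].
by rewrite !nmap_nm cm_xprod (np_nm _ _ _ _ H).
Qed.

Lemma nmap_ren f t : rinj f t -> nmap (ren f t) = ren f (nmap t).
Proof.
case: (nmP t) => X [r [ri [phi ->]]] /rinj_nm hf.
by rewrite (ren_nm ri hf) !nmap_nm (ren_nm ri hf).
Qed.

Lemma nmap_nu : nmap (nu s) = nu s'.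
Proof. by rewrite /nu nmap_nm cm_xunit. Qed.

(** The guard [zok] matters: [g] may identify colours, so a pair that cannot be contracted in [t]
    may become contractible in the image. *)
Lemma nmap_zt x y t : zok x y t -> nmap (zt x y t) = zt x y (nmap t).
Proof.
case/zokE => X [r [ri [a [b [n [phi [H [-> <- <- ->]]]]]]]].
have H' : ch s' a (cm h phi) = pinv (ch s' b (cm h phi)) by rewrite !cm_ch H pm_inv.
by rewrite !nmap_nm (zt_nm ri n H') (cm_zeta n H H').
Qed.

Lemma nmap_wr a b c : a <> b -> nmap (wr s a b c) = wr s' a b (g c).
Proof.
by move=> ab; rewrite !(wr_nm _ _ (wrn_inj ab) ab) nmap_nm cm_epsu.
Qed.

Lemma nmap_lop c : nmap (lop s c) = lop s' (g c).
Proof. by rewrite /lop nmap_zt ?nmap_wr //; exact: zok_wr. Qed.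

Lemma nmap_lops l t : nmap (lops l t) = lops (map g l) (nmap t).
Proof. by elim: l => //= c l IH; rewrite nmap_np ?IH ?nmap_lop //; exact: disj_lop. Qed.

Lemma nmap_contr m t : uniq (ends m) -> mok m t -> nmap (contr m t) = contr m (nmap t).
Proof.
elim: m t => // p m IH t um ok; rewrite !contr_cons IH.
- by rewrite nmap_zt //; apply: ok; rewrite inE -surjective_pairing eqxx.
- by move: um => /= /and3P [].
- exact: mok_zt.
Qed.

Lemma nmap_wp t i o d : wfresh (wires i o d) t ->
  nmap (wp t (wires i o d)) = wp (nmap t) (wires i o (map g d)).
Proof.
elim: d i o => //= c d IH i o fr.
have /= dw := disj_wp fr; have [/= io _ _] := wfresh_hd fr.
by rewrite nmap_np // nmap_wr // IH ?pm_inv //; exact: wfresh_cons fr.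
Qed.

Lemma typed_nmap c t : typed c t -> typed (map g c) (nmap t).
Proof. by move=> ht k; rewrite chn_nmap ht onth_map. Qed.

Lemma nmap_ev c d (f : BDiag c d) (f' : BDiag (map g c) (map g d)) t : typed c t ->
  (forall i, bpair f' i = bpair f i) -> bloops f' = map g (bloops f) ->
  nmap (ev f t) = ev f' (nmap t).
Proof.
move=> ht hp hl; rewrite /ev nmap_lops hl nmap_ren; last exact: rinj_sub_raw.
rewrite /raw !size_map nmap_contr; [|exact/uniq_prs/bd_pairing|exact: mok_typed].
rewrite nmap_wp; last exact: wfresh_typed.
have -> // : prs (bpair f') (size c + size d) = prs (bpair f) (size c + size d).
rewrite /prs (eq_filter (a2 := fun i => i < bpair f i)); last by move=> i; rewrite hp.
by apply: eq_map => i; rewrite hp.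
Qed.

Definition gam c c' (H : c' = map g c) (x : galg s c) : galg s' c' :=
  exist (typed c') (nmap (sval x))
    (eq_rect_r (fun c' => typed c' (nmap (sval x))) (typed_nmap (svalP x)) H).

Definition ghom : CAhom g (galg s) (galg s').
Proof.
apply: (@MkCAhom _ _ _ _ _ gam).
- move=> c d c' d' Hc Hd; subst c' d' => f f' hp hl x; apply: gA_eq => /=.
  by apply: nmap_ev => //; exact: svalP.
- move=> c d e c' d' e' H H' Hc Hd He x y; subst c' d' e; apply: gA_eq => /=.
  rewrite size_map /mul nmap_np; last exact: disj_shift (svalP x).
  by rewrite nmap_ren //; exact/inj_rinj/addnI.
- by move=> H; apply: gA_eq; exact: nmap_nu.
Defined.
End OperadMorphism.

(** * Morphisms of algebras give morphisms of operads *)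

Section AlgebraMorphism.
Variables (P Q : palette) (g : palmap P Q) (a : CircAlg P) (b : CircAlg Q) (h : CAhom g a b).
Implicit Types (X Y Z : finType).

Lemma cst_am c c' c'' (E : c' = c'') (H : c' = map g c) H' x :
  cst E (am h H x) = am h H' x.
Proof. by subst c''; rewrite cst_id; congr am; exact: proof_irrelevance. Qed.

Lemma am_cst c d c' (E : c = d) (H : c' = map g d) H' x : am h H (cst E x) = am h H' x.
Proof. by subst d; rewrite cst_id; congr am; exact: proof_irrelevance. Qed.

Definition fcm X (t : fS a X) : fS b X :=
  existT _ (g \o tag t) (am h (map_comp g (tag t) (enum X)) (tagged t)).

Lemma fcm_dm X Y (t : fS a X) (k : Y -> P) D (D' : BDiag (map (g \o tag t) (enum X)) (map (g \o k) (enum Y))) :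
  bpair D' =1 bpair D -> bloops D' = map g (bloops D) ->
  fcm (@dm P a X Y t k D) = @dm Q b X Y (fcm t) (g \o k) D'.
Proof. by move=> h1 h2; congr existT; apply: am_nat. Qed.

Lemma okcl_map X Z (k : X -> P) (o : Z -> X) tau : okcl k o tau -> okcl (g \o k) o tau.
Proof.
case=> oi ho; split=> // x /ho [h1 h2 h3 h4]; split=> //=.
by rewrite h4 pm_inv.
Qed.

Lemma fcm_dcl X Z (t : fS a X) (o : Z -> X) tau H (H' : okcl (g \o tag t) o tau) :
  fcm (@dcl P a X Z t o tau H) = @dcl Q b X Z (fcm t) o tau H'.
Proof. exact: fcm_dm. Qed.

Lemma fcm_mul X Y (t : fS a X) (u : fS a Y) : fcm (fmul t u) = fmul (fcm t) (fcm u).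
Proof.
apply: fS_eq => [[x|y] //|E].
rewrite (cst_am _ _ (etrans (esym E) (map_comp g _ _))).
by apply: am_mu.
Qed.

Lemma fcm_unit : fcm (funit a) = funit b.
Proof.
apply: fS_eq => [[]|E]; rewrite (cst_am _ _ (etrans (esym E) (map_comp g _ _))).
rewrite [tagged _]/=; set H := etrans _ _.
move: (enum_void _) (enum_void _) H => /=; move: (map _ _) (map _ _) => c c' E1 E2 H; subst c c'.
by rewrite /= !am_mu0.
Qed.

Lemma dm_eq2 X Y (t t' : fS b X) (k k' : Y -> Q) D D' (p p' : X + Y -> X + Y) : t = t' ->
  k =1 k' -> follows D p -> follows D' p' -> p =1 p' -> loops_eqv (bloops D) (bloops D') ->
  @dm Q b X Y t k D = @dm Q b X Y t' k' D'.
Proof. by move=> e; subst t'; exact: dm_eq. Qed.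

Definition fhom : COhom g (foper a) (foper b).
Proof.
apply: (@MkCOhom P Q g (foper a) (foper b) (@fcm)).
- by move=> X Y e t; apply: fcm_dcl.
- by [].
- exact: fcm_mul.
- exact: fcm_unit.
- move=> X x y n t H H'; rewrite /= /fzeta (fcm_dcl _ (okcl_map (okcl_zeta n H))).
  exact: dcl_ext.
- move=> c /=; have hc i : (g \o cupcol c) (swap2 i) = pinv ((g \o cupcol c) i).
    by rewrite /= cupcol_swap pm_inv.
  rewrite /fepsu (@fcm_dm _ _ _ _ _ (mkbd (fpairing_cup _ hc) [::])) //.
  apply: (dm_eq2 fcm_unit _ (follows_mkbd _ _) (follows_mkbd _ _)) => //; last exact: loops_eqv_refl.
  by move=> i; rewrite /= /cupcol; case: ifP => // _; rewrite pm_inv.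
Defined.
End AlgebraMorphism.

(** * Unit and counit *)

Section Counit.
Variables (P : palette) (s : CircOp P).
Implicit Types (X Y Z : finType).
Let ax := co_ax s.

Lemma sval_cst (c d : seq P) (E : c = d) (x : galg s c) : sval (cst E x : galg s d) = sval x.
Proof. by subst d. Qed.

Lemma fS_gA_eq X (t t' : fS (galg s) X) : tag t =1 tag t' -> sval (tagged t) = sval (tagged t') -> t = t'.
Proof.
case: t t' => [k x] [k' x'] /= h e; apply: fS_eq => // E.
by apply: gA_eq; rewrite sval_cst.
Qed.

Lemma typed_nm_rk X (phi : s X) : typed (map (fun x => ch s x phi) (enum X)) (nm (@rk_inj X) phi).
Proof.
move=> k; have [[x <- ->]|[h ->]] := chn_nmP (@rk_inj X) phi k; first by rewrite onth_rk.
case: (ltnP k #|X|) => [/rk_surj [x e]|hk]; first by case: (h x).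
by rewrite onth_default // size_enum_map.
Qed.

(** A typed element over an enumerated colouring is pulled back along the enumeration. Surjectivity
    of both comparison maps, [nuh] and [etan], rests on this. *)
Lemma typed_nm_rkP X (k : X -> P) t : typed (map k (enum X)) t ->
  exists2 phi, t = nm (@rk_inj X) phi & forall x, ch s x phi = k x.
Proof.
case: (nmP t) => Y [r [ri [psi ->]]] ht.
have [e he] : exists e : bij X Y, forall x, r (e x) = rk x.
  apply: naming_bij => // [|x|y]; first exact: rk_inj.
    have := ht (rk x); rewrite onth_rk.
    by have [[y <- _] _|[_ ->]//] := chn_nmP ri psi (rk x); exists y.
  have := ht (r y); rewrite chn_nm => /esym h; apply: rk_surj.
  by rewrite -(@size_enum_map X _ k) -onthTE h.
have E : nm ri psi = nm (@rk_inj X) (act s e psi).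
  by symmetry; apply: (@nm_eq _ _ _ _ _ _ _ _ e).
exists (act s e psi) => // x.
by have := ht (rk x); rewrite E chn_nm onth_rk => -[].
Qed.

Definition nuh X (phi : s X) : fS (galg s) X :=
  existT _ (fun x => ch s x phi) (exist (typed _) _ (typed_nm_rk phi)).

Lemma nuh_inj X : injective (@nuh X).
Proof.
move=> phi psi /(congr1 (fun t => sval (tagged t))) /= /nm_inj [_ h].
by rewrite -(h (bij_id X)) // (act_id ax).
Qed.

Lemma nuh_surj X (t : fS (galg s) X) : exists phi, nuh phi = t.
Proof.
have [phi e h] := typed_nm_rkP (svalP (tagged t)).
by exists phi; apply: fS_gA_eq.
Qed.

(** Specialises [ev_cupless] to the diagrams of relabelling and contraction; [m] lists the caps by
    ranks. *)
Lemma ev_pcl X Z (k : X -> P) (o : Z -> X) tau (H : okcl k o tau) (t : nom s) m : typed (map k (enum X)) t ->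
  uniq (ends m) ->
  (forall x y : X, pmem m (rk x) (rk y) = (x \notin codom o) && (y == tau x)) ->
  (forall i, i \in ends m -> i < #|X|) ->
  ev (mkbd (okcl_fpairing H) [::]) t =
  ren (fun n => bdp (pcl o tau) n - #|X|) (contr m t).
Proof.
move=> ht um hm em; have [oi ho] := H.
rewrite (@ev_cupless _ _ _ _ _ _ m ht) // ?size_enum_map //.
- move=> j /rk_surj [z <-].
  by rewrite -[#|X| + rk z]/(code (inr z : X + Z)) follows_mkbd /= rk_lt.
move=> i j; case: (ltnP i #|X|) => [/rk_surj [x <-]|hi] /=; last first.
  by apply/negP => /mem_ends /em; rewrite ltnNge hi.
case: (ltnP j #|X|) => [/rk_surj [y <-]|hj] /=; last first.
  by apply/negP; rewrite pmem_sym => /mem_ends /em; rewrite ltnNge hj.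
rewrite hm -[rk x]/(code (inl x : X + Z)) bdpE.
have [/codomP [z ->]|hx] := boolP (x \in codom o).
  by rewrite pcl_in //=; apply/esym/negbTE/eqP => e; have := rk_lt y; rewrite e ltnNge leq_addr.
by rewrite pcl_out //= (inj_eq (@rk_inj X)).
Qed.

(** The two target wires run from [0] to [2] and from [1] to [3]. Contracting [0] with [1] merges
    them into one wire between [2] and [3], which the final shift renames to [0] and [1]. *)
Lemma ev_cup (c d : seq P) (f : BDiag c d) x : c = [::] -> d = [:: x; pinv x] ->
  bpair f 0 = 1 -> bpair f 1 = 0 -> bloops f = [::] -> ev f (nu s) = wr s 0 1 x.
Proof.
move=> ec ed; subst c d => b0 b1 l; rewrite /ev /raw l /=.
have -> : prs (bpair f) (0 + 2) = [:: (0, 1)] by rewrite /prs /= b0 b1 /= b0.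
rewrite /contr /= pinvK nu_np -[0 + 2]/2.
rewrite [wr s 0 2 _]wr_sym // zt_sym (@zt_wr _ _ 1 2 0 x) ?chn_wr //.
by rewrite ren_wr // ren_wr.
Qed.

Definition nu_hom : COhom (palmap_id P) s (foper (galg s)).
Proof.
apply: (@MkCOhom P P _ s (foper (galg s)) nuh).
- move=> X Y e phi; apply: fS_gA_eq => [x|] /=; first exact: (ch_act ax).
  rewrite (@ev_pcl _ _ _ _ _ _ _ [::]) //; [|exact: typed_nm_rk|by move=> x y; rewrite not_codom_bij].
  have E x : bdp (pcl e id) (rk (e x)) - #|Y| = rk x.
    rewrite -[rk (e x)]/(code (inl (e x) : Y + X)) bdpE pcl_in /= ?addKn //; exact: bij_inj.
  have i : injective ((fun n => bdp (pcl e id) n - #|Y|) \o (@rk Y)).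
    move=> y y'; rewrite /= -(binvK e y) -(binvK e y') !E => /rk_inj -> //.
  by rewrite /contr /= (ren_nm _ i); apply: (@nm_eq _ _ _ _ _ _ _ _ e) => // x; exact: E.
- by [].
- move=> X Y phi psi; apply: fS_gA_eq => [[x|y]|] /=.
  + exact: (ch_xprodl ax).
  + exact: (ch_xprodr ax).
  have i : injective (addn #|X| \o (@rk Y)) by move=> x y /addnI /rk_inj.
  have i2 : injective (sumr (@rk X) (addn #|X| \o (@rk Y))).
    by move=> u v; rewrite -[sumr _ _ u]/(code u) -[sumr _ _ v]/(code v); exact: code_inj.
  rewrite size_enum_map /mul (ren_nm _ i) (np_nm _ _ _ _ i2).
  by apply: nm_ext => u; rewrite -code_rk; case: u.
- apply: fS_gA_eq => [[]|]; rewrite /= sval_cst /=.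
  by apply: nm_ext; case.
- move=> X x y n phi H H'; apply: fS_gA_eq => [z|] /=; first exact: (ch_zeta ax).
  rewrite (@ev_pcl _ _ _ _ _ _ _ [:: (rk x, rk y)]) //; first last.
  + by move=> i; rewrite /= !inE => /orP [] /eqP ->; exact: rk_lt.
  + move=> u v; rewrite codom_rem2 pmem_cons /pmem !in_nil orbF !xpair_eqE !(inj_eq (@rk_inj X)).
    rewrite /swp; case: (u =P x) => [->|ux] /=; first by rewrite (negbTE n) ?andbF ?orbF.
    by case: (u =P y) => [_|_] /=; rewrite ?andbT ?andbF ?orbF.
  + by rewrite /= inE andbT (inj_eq (@rk_inj X)).
  + exact: typed_nm_rk.
  have E (z : rem2 x y) : bdp (pcl (val : rem2 x y -> X) (swp x y)) (rk (val z)) - #|X| = rk z.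
    rewrite -[rk (val z)]/(code (inl (val z) : X + rem2 x y)) bdpE pcl_in /= ?addKn //; exact: val_inj.
  rewrite contr_cons [(rk x, rk y).1]/= [(rk x, rk y).2]/= (zt_nm _ n H) /contr /=.
  have i : injective ((fun n => bdp (pcl (val : rem2 x y -> X) (swp x y)) n - #|X|) \o (@rk X \o (val : rem2 x y -> X))).
    by move=> u v e; apply: (@rk_inj (rem2 x y)); rewrite -!E.
  by rewrite (ren_nm _ i); apply: nm_ext => z; rewrite -E.
- move=> c; apply: fS_gA_eq => [i|] /=.
    rewrite /cupcol; case: (i =P pt1) => [->|ni]; first exact: (ch_epsu ax).
    have -> : i = pt2 by case: i ni => [[|[|i]] hi] // ni; [case: ni|]; apply: val_inj.
    have -> : epsu s c = act s (Bij swap2K swap2K) (epsu s (pinv c)).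
      by rewrite -(epsu_inv ax) ?pinvK.
    by rewrite (ch_act ax) (ch_epsu ax).
  rewrite sval_cst /=.
  have rk2 (i : 'I_2) : rk i = i by rewrite /rk index_enum_ord.
  have sv : size (map (tag (funit (galg s))) (enum (void : finType))) = 0.
    by rewrite size_enum_map card_void.
  have s2 : size (map (cupcol c) (enum 'I_2)) = 2 by rewrite size_enum_map card_ord.
  have e2 : map (cupcol c) (enum 'I_2) = [:: c; pinv c].
    apply: eq_from_onth_le => k; rewrite s2 /= maxnn => hk.
    have hk' : k < #|'I_2| by rewrite card_ord.
    have [i <-] := rk_surj hk'; rewrite onth_rk rk2 /cupcol.
    by case: i {hk hk'} => [[|[|i]] hi].
  have b0 : bdp pcup 0 = 1.
    have := @bdpE void 'I_2 pcup (inr pt1).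
    by rewrite /= card_void !rk2.
  have b1 : bdp pcup 1 = 0.
    have := @bdpE void 'I_2 pcup (inr pt2).
    by rewrite /= card_void !rk2.
  rewrite (_ : ev _ _ = wr s 0 1 c); last by apply: (ev_cup (size0nil sv) e2).
  rewrite (wr_nm _ _ (@wrn_inj 0 1 ltac:(done))) //.
  by apply: nm_ext => i; rewrite rk2 /wrn; case: i => [[|[|i]] hi].
Defined.
End Counit.

(** * An algebra and its round trip *)

Section Unit.
Variables (P : palette) (a : CircAlg P).
Implicit Types (X Y Z : finType) (c d e : seq P).
Let ax := ca_ax a.
Notation nomF := (nom (foper a)).

Definition kap c : 'I_(size c) -> P := tnth (in_tuple c).

Lemma kapE c : c = map (@kap c) (enum 'I_(size c)).
Proof. by rewrite (map_tnth_enum (in_tuple c)). Qed.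

(** The list [c] is read as a colouring of its own positions; enumerating these gives back [c] only
    propositionally, whence the transport. *)
Definition et c (x : a c) : foper a 'I_(size c) := existT _ (@kap c) (cst (kapE c) x).

Definition etan c (x : a c) : nomF := nm (@rk_inj 'I_(size c)) (et x).

Lemma etan_cst c d (E : c = d) (x : a c) : etan (cst E x) = etan x.
Proof. by subst d. Qed.

Lemma onth_kap c i : onth c (rk i) = Some (@kap c i).
Proof. by rewrite {1}(kapE c) onth_rk. Qed.

Lemma typed_etan c (x : a c) : typed c (etan x).
Proof. by have := @typed_nm_rk P (foper a) _ (et x); rewrite /= -kapE. Qed.

(** [X] and the positions of its list of colours are identified by rank, and such a relabelling is
    mere transport by [fact_rk]. *)
Lemma nm_rk_etan X (t : fS a X) : nm (s := foper a) (@rk_inj X) t = etan (tagged t).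
Proof.
set c := map (tag t) (enum X).
have sc : #|'I_(size c)| = #|X| by rewrite card_ord size_enum_map.
have [e he] : exists e : bij X 'I_(size c), forall x, rk (e x) = rk x.
  apply: naming_bij; try exact: rk_inj.
    by move=> x; apply: rk_surj; rewrite sc rk_lt.
  by move=> i; apply: rk_surj; rewrite -sc rk_lt.
have hk x : kap (e x) = tag t x.
  by have := onth_kap (e x); rewrite he onth_rk => -[].
apply: (@nm_eq _ _ _ _ _ _ _ _ e) => //.
rewrite /= (@fact_rk P a _ _ e (et (tagged t)) (map_enum_rk (k := @kap c) he (fun=> erefl)) he).
rewrite -[RHS]fS_eta; apply: fS_eq => // E.
by rewrite (cst_cst _ _ (etrans (map_enum_rk he (fun=> erefl)) E)) (cst_cst _ _ erefl).
Qed.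

Lemma et_inj c : injective (@et c).
Proof.
move=> x y; rewrite /et; move: (kapE c) => E e.
(* An equality of dependent pairs is pushed through a map defined on all of [fS], which transports
   the second component back to [c] whenever the list allows it. *)
have := f_equal (fun t : fS a 'I_(size c) =>
   match excluded_middle_informative (map (tag t) (enum 'I_(size c)) = c) with
   | left E => Some (cst E (tagged t)) | right _ => None end) e.
rewrite /=; case: excluded_middle_informative => [E' []|[]]; last by rewrite -E.
by rewrite !(cst_cst _ _ erefl) !cst_id.
Qed.

Lemma etan_inj c : injective (@etan c).
Proof.
move=> x y /nm_inj [_ /(_ (bij_id _) (fun=> erefl))].
by rewrite /= fact_id // => /et_inj.
Qed.

Lemma etan_surj c t : typed c t -> exists x : a c, etan x = t.
Proof.
rewrite {1}(kapE c) => /typed_nm_rkP [phi -> h].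
have E : map (tag phi) (enum 'I_(size c)) = c.
  by rewrite [RHS]kapE; apply: eq_map => i; exact: h.
by exists (cst E (tagged phi)); rewrite etan_cst -nm_rk_etan.
Qed.

Lemma etan_mu c d e (H : e = c ++ d) x y : etan (mu a H x y) = mul (size c) (etan x) (etan y).
Proof.
have E : e = map (tag (fmul (et x) (et y))) (enum (('I_(size c) + 'I_(size d))%type : finType)).
  by rewrite map_enum_sum -!kapE.
rewrite -(etan_cst E) -(mu_cst (kapE c) (kapE d) E H (map_enum_sum _)).
rewrite -[mu _ _ _ _]/(tagged (fmul (et x) (et y))) -nm_rk_etan.
have i : injective (addn (size c) \o (@rk 'I_(size d))) by move=> ? ? /addnI /rk_inj.
have cE u : sumr (@rk 'I_(size c)) (addn (size c) \o (@rk 'I_(size d))) u = code u.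
  by case: u => //= j; rewrite card_ord.
have i2 : injective (sumr (@rk 'I_(size c)) (addn (size c) \o (@rk 'I_(size d)))).
  by move=> u v; rewrite !cE; exact: code_inj.
rewrite /mul (ren_nm _ i) (np_nm _ _ _ _ i2).
by apply: nm_ext => u; rewrite -code_rk cE.
Qed.

Lemma etan_mu0 : etan (mu0 a) = nu (foper a).
Proof.
rewrite -(etan_cst (enum_void (tag (funit a)))) -[cst _ _]/(tagged (funit a)) -nm_rk_etan.
by apply: nm_ext; case.
Qed.

Lemma follows_fpairing X Y (k : X -> P) (k' : Y -> P) (D : BDiag (map k (enum X)) (map k' (enum Y))) p :
  follows D p -> fpairing k k' p.
Proof.
move=> hD u; have [h1 [_ h3]] := bpair_ok D.
have hu : code u < size (map k (enum X)) + size (map k' (enum Y)).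
  by rewrite !size_enum_map; exact: code_lt.
have [_ [g2 g3]] := h1 _ hu; have := h3 _ hu.
rewrite !hD !onth_code !size_enum_map !code_ltX in g2 g3 *.
move=> g4; split; first exact: code_inj.
  by move=> e; apply: g2; rewrite e.
by move: g4; case: ifP => _ [].
Qed.

(** Supplies the map [r] that [dm_dcl] takes as given: a strand is continued through at most one
    cap, because by the last hypothesis it cannot run into a second. *)
Lemma splice_exists X Y Z (k : X -> P) (k' : Y -> P) (p : X + Y -> X + Y) (o : Z -> Y) tau :
  fpairing k k' p -> okcl k' o tau ->
  (forall y y', y \notin codom o -> p (inr y) = inr y' -> y' \in codom o) ->
  exists2 r, fpairing k (k' \o o) r & forall u, lift o (r u) = match p (lift o u) with
     | inr y => if y \in codom o then inr y else p (inr (tau y)) | v => v end.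
Proof.
move=> hp [oi ho] hC.
pose F (v : X + Y) := match p v with
     | inr y => if y \in codom o then inr y else p (inr (tau y)) | v => v end.
have pp u : p (p u) = u by case: (hp u).
have outer y : y \notin codom o -> exists w : X + Z, lift o w = p (inr y).
  move=> hy; case E : (p (inr y)) => [x|y']; first by exists (inl x).
  by have /codomP [z ->] := hC _ _ hy E; exists (inr z).
have wex u : exists w, lift o w = F (lift o u).
  rewrite /F; case E : (p _) => [x|y]; first by exists (inl x).
  case: ifP => [/codomP [z ->]|/negbT hy]; first by exists (inr z).
  by apply: outer; case: (ho y hy).
pose r u := proj1_sig (constructive_indefinite_description _ (wex u)).
have rE u : lift o (r u) = F (lift o u) by rewrite /r; case: constructive_indefinite_description.
have li : injective (@lift X Y Z o) by move=> [x|z] [x'|z'] //= [] => [->|/oi ->].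
have Fo (u : X + Z) : let v := lift o u in
   (F v = p v /\ forall y, p v = inr y -> y \in codom o) \/
   (exists2 y, y \notin codom o & p v = inr y /\ F v = p (inr (tau y))).
  rewrite /= /F; case E : (p _) => [x|y]; first by left.
  have [hy|hy] := boolP (y \in codom o); first by left; split=> // y' [<-].
  by right; exists y.
have lo (u : X + Z) y : lift o u = inr y -> y \in codom o by case: u => // z [<-]; exact: codom_f.
exists r; last by move=> u; rewrite rE.
move=> u; have csE w : csum k (k' \o o) w = csum k k' (lift o w) by case: w.
have isE (w : X + Z) : is_inl w = is_inl (lift o w) by case: w.
case: (Fo u) => [[E1 E2]|[y hy [E1 E2]]].
  have ru : lift o (r u) = p (lift o u) by rewrite rE E1.
  have [_ h2 h3] := hp (lift o u).
  split.
  - apply: li; rewrite rE ru /F pp; case E : (lift o u) => [//|y].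
    by rewrite (lo u).
  - by move=> e; apply: h2; rewrite -ru e.
  - by rewrite !csE !isE ru h3.
have [t1 t2 t3 t4] := ho y hy.
have ru : lift o (r u) = p (inr (tau y)) by rewrite rE E2.
split.
- apply: li; rewrite rE ru /F pp (negbTE t1) t3 -E1 pp //.
- move=> e; apply: t2; rewrite e in ru.
  by have := E1; rewrite ru pp => -[].
have [_ _ h3] := hp (lift o u); have [_ _ h4] := hp (inr (tau y)).
rewrite !csE !isE ru h4 /= t4.
move: h3; rewrite E1 /=; case: (lift o u) => [x|z] /=; case: (p _) => [x'|z'] /= ->; rewrite ?pinvK //.
Qed.

Lemma mul_unit_cst X (t : fS a X) (E : map (tag t) (enum X) = map (tag (fmul t (funit a))) (enum ((X + void)%type : finType))) :
  tagged (fmul t (funit a)) = cst E (tagged t).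
Proof.
rewrite /=; set H := map_enum_sum _; set E2 := E.
move: (enum_void _) H E2 => /=; move: (map _ (enum (void : finType))) => d Eu H E2.
subst d => /=; symmetry.
have -> : cst E2 (tagged t) = cst E2 (mu a (esym (cats0 _)) (tagged t) (mu0 a)) by rewrite (mu_unitr ax).
exact: cst_mu.
Qed.

Definition fromX X Y (u : X + Y) : (X + void) + Y :=
  match u with inl x => inl (inl x) | inr y => inr y end.

(** Adjoining the unit appends an empty list to the source, so [fromX] leaves the boundary numbers
    unchanged. *)
Lemma dm_unit X Y (t : fS a X) (k : Y -> P) D (p : X + Y -> X + Y) D'' p'' :
  follows D p -> follows D'' p'' -> (forall u, p'' (fromX u) = fromX (p u)) ->
  loops_eqv (bloops D'') (bloops D) ->
  @dm P a _ Y (fmul t (funit a)) k D'' = @dm P a X Y t k D.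
Proof.
move=> h h'' hp hl; congr existT.
have E : map (tag t) (enum X) = map (tag (fmul t (funit a))) (enum ((X + void)%type : finType)).
  by rewrite map_enum_sum /= -(enum_void (fun x : void => match x return P with end)) cats0.
rewrite (mul_unit_cst E) -[RHS](cst_id erefl).
apply: amap_cst; last exact: loops_eqv_sym.
have C (u : X + Y) : code (fromX u) = code u.
  by case: u => [x|y] /=; rewrite ?rk_inl // card_sum card_void addn0.
move=> i; case: (ltnP i (#|X| + #|Y|)) => [/code_surj [u <-]|hi].
  by rewrite h -(C u) h'' hp C.
have [_ [e1 _]] := bpair_ok D; have [_ [e2 _]] := bpair_ok D''.
by rewrite e1 ?e2 // !size_enum_map // card_sum card_void addn0.
Qed.
End Unit.

(** * The unit commutes with diagrams without closed loops *)

Section UnitNatural.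
Variables (P : palette) (a : CircAlg P).
Implicit Types (X Y Z : finType) (c d e : seq P).
Let ax := ca_ax a.
Notation F := (foper a).

Section State.
Variables (X : finType) (rX : X -> nat) (rXi : injective rX) (t : fS a X).

(** Each wire is a cup applied to the unit, so adjoining it tensors the diagram found so far with a
    cup; [dm_unit] then removes the extra unit from the source. The last two clauses record the
    strands: a source passes through under its own name, and the ends of a wire are joined. *)
Lemma wires_diagram ws : wfresh (s := F) ws (nm (s := F) rXi t) ->
  exists (Y : finType) (r : Y -> nat) (ri : injective r) (k : Y -> P)
    (D : BDiag (map (tag t) (enum X)) (map k (enum Y))) (p : X + Y -> X + Y),
  [/\ follows D p, bloops D = [::], wp (nm (s := F) rXi t) ws = nm (s := F) ri (dm D),
      (forall x, exists2 y, p (inl x) = inr y & r y = rX x) &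
      (forall w, w \in wl ws -> exists y y', [/\ p (inr y) = inr y', r y = w.1 & r y' = w.2])].
Proof.
elim: ws => [|[[b0 b1] c] ws IH] fr.
  pose p (u : X + X) : X + X := match u with inl x => inr x | inr x => inl x end.
  have hp : fpairing (tag t) (tag t) p by case.
  exists X, rX, rXi, (tag t), (mkbd hp [::]), p; split=> //; first exact: follows_mkbd.
    by rewrite (dm_id (follows_mkbd hp _)).
  by move=> x; exists x.
have [Y [r [ri [k [D [p [hD hl E h1 h2]]]]]]] := IH (wfresh_cons fr).
have [/= b01 n0 n1] := wfresh_hd fr.
have /= dw := disj_wp fr.
pose inj v : X + (Y + 'I_2) := match v with inl x => inl x | inr y => inr (inl y) end.
pose p' (u : X + (Y + 'I_2)) : X + (Y + 'I_2) :=
  match u with inl x => inj (p (inl x)) | inr (inl y) => inj (p (inr y)) | inr (inr i) => inr (inr (swap2 i)) end.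
have hp := follows_fpairing hD.
have p'i v : p' (inj v) = inj (p v) by case: v.
have hp' : fpairing (tag t) (csum k (cupcol c)) p'.
  have A v : [/\ p' (p' (inj v)) = inj v, p' (inj v) <> inj v & csum (tag t) (csum k (cupcol c)) (p' (inj v)) =
     (if is_inl (inj v) == is_inl (p' (inj v)) then pinv else id) (csum (tag t) (csum k (cupcol c)) (inj v))].
    have [g1 g2 g3] := hp v; rewrite !p'i g1.
    have ji : injective inj by move=> [x|y] [x'|y'] //= [] ->.
    have jc w : csum (tag t) (csum k (cupcol c)) (inj w) = csum (tag t) k w by case: w.
    have js w : is_inl (inj w) = is_inl w by case: w.
    by rewrite !jc !js g3; split=> // /ji.
  case=> [x|[y|i]]; [exact: (A (inl x))|exact: (A (inr y))|].
  split=> /=; first by rewrite swap2K.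
    by case; exact: swap2_neq.
  exact: cupcol_swap.
pose p'' (u : (X + void) + (Y + 'I_2)) : (X + void) + (Y + 'I_2) :=
  match u with inl (inl x) => fromX (p' (inl x)) | inl (inr v) => match v with end | inr y => fromX (p' (inr y)) end.
have p''i v : p'' (fromX v) = fromX (p' v) by case: v.
have hp'' : fpairing (tag (fmul t (funit a))) (csum k (cupcol c)) p''.
  have A v : [/\ p'' (p'' (fromX v)) = fromX v, p'' (fromX v) <> fromX v &
     csum (tag (fmul t (funit a))) (csum k (cupcol c)) (p'' (fromX v)) =
     (if is_inl (fromX v) == is_inl (p'' (fromX v)) then pinv else id) (csum (tag (fmul t (funit a))) (csum k (cupcol c)) (fromX v))].
    have [g1 g2 g3] := hp' v; rewrite !p''i g1.
    have ji : injective (@fromX X (Y + 'I_2)%type) by move=> [x|y] [x'|y'] //= [] ->.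
    have jc w : csum (tag (fmul t (funit a))) (csum k (cupcol c)) (fromX w) = csum (tag t) (csum k (cupcol c)) w by case: w.
    have js (w : X + (Y + 'I_2)) : is_inl (fromX w) = is_inl w by case: w.
    by rewrite !jc !js g3; split=> // /ji.
  by case=> [[x|[]]|y]; [exact: (A (inl x))|exact: (A (inr y))].
have i2 : injective (sumr r (wrn b0 b1)).
  by move: dw; rewrite E (wr_nm _ _ (wrn_inj b01) b01); exact: disj_nm.
exists (Y + 'I_2)%type, (sumr r (wrn b0 b1)), i2, (csum k (cupcol c)), (mkbd hp' [::]), p'.
split=> //.
- exact: follows_mkbd.
- rewrite /= E (wr_nm _ _ (wrn_inj b01) b01) (np_nm _ _ _ _ i2); congr nm.
  rewrite -(@dm_unit _ _ _ _ _ _ _ _ (mkbd hp'' [::]) p'' (follows_mkbd hp' _) (follows_mkbd hp'' _)) //; last exact: loops_eqv_refl.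
  apply: (dm_mul hD (follows_mkbd _ _) (follows_mkbd hp'' _)); rewrite ?hl //.
    case=> [x|y] /=; first by case: (p (inl x)).
    by case: (p (inr y)).
  by case=> [[]|i].
- by move=> x; have [y py ry] := h1 x; exists (inl y); rewrite //= py.
move=> w; rewrite inE => /orP [/eqP -> /=|/h2 [y [y' [py ry ry']]]]; last first.
  by exists (inl y), (inl y'); split=> //=; rewrite py.
by exists (inr pt1), (inr pt2); split=> //; rewrite /= /wrn ?eqxx.
Qed.

Variables (A b : nat) (f : nat -> nat).
Let M := A + b.
Hypothesis rXlt : forall x, rX x < A.
Hypothesis fp : pairing M f.

(* [out i u]: the point [u] is the outer end of the strand through the inner point [i]. *)
Definition out Y (r : Y -> nat) i (u : X + Y) : Prop :=
  match u with inl x => rX x = i | inr y => r y = i + b /\ A <= i /\ i < M end.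

(** The invariant during contraction: [u] is a single diagram without loops applied to [t]. An inner
    point not yet contracted is joined to the outer end of its strand; once [i] has been contracted,
    the outer ends for [i] and [f i] are joined. After the last contraction the strands thus realise
    [f]. *)
Definition state (u : nom F) := exists (Y : finType) (r : Y -> nat) (ri : injective r) (k : Y -> P)
    (D : BDiag (map (tag t) (enum X)) (map k (enum Y))) (p : X + Y -> X + Y),
  [/\ follows D p, bloops D = [::], u = nm (s := F) ri (dm D),
      (forall y, r y < M -> out r (r y) (p (inr y))) &
      (forall i v, out r i v -> (forall y, r y <> i) -> out r (f i) (p v))].

Lemma out_uniq Y (r : Y -> nat) i u v : injective r -> out r i u -> out r i v -> u = v.
Proof.
move=> ri; case: u v => [x|y] [x'|y'] /=.
- by move=> <- /rXi ->.
- by move=> <- [_ [h _]]; have := rXlt x; lia.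
- by move=> [_ [h _]] e; have := rXlt x'; lia.
- by move=> [e _] [e' _]; congr inr; apply: (ri); rewrite e e'.
Qed.

Lemma out_fun Y (r : Y -> nat) i j u : out r i u -> out r j u -> i = j.
Proof. case: u => [x|y] /=; first by move=> <-. by move=> [e _] [e' _]; lia. Qed.

(** Both points to be contracted are joined in [D] to outer points, so they are not joined to each
    other: the new cap closes no loop and [dm_dcl] applies. It connects the outer ends for [i] and
    [f i], as the invariant asks. *)
Lemma state_zt i u : i < M -> zok i (f i) u -> state u -> state (zt i (f i) u).
Proof.
move=> hi ok [Y [r [ri [k [D [p [hD hl E I1 I2]]]]]]].
have [fM [fn ff]] := fp hi.
subst u; have := ok => -[_ [cc]].
have [[y1 e1 E1] _|[_ ->]//] := chn_nmP ri (dm D : F Y) i.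
have [[y2 e2 E2] _|[_ ->]//] := chn_nmP ri (dm D : F Y) (f i).
have n : y1 != y2 by apply/eqP => e; apply: fn; rewrite -e2 -e1 e.
have H : k y1 = pinv (k y2).
  case: ok => _ [c]; rewrite E1 E2 => -[<-] [] /= ->; by rewrite pinvK.
rewrite -e2 -e1 (zt_nm ri n (phi := (dm D : F Y)) H).
have hp := follows_fpairing hD.
have o1 : out r i (p (inr y1)) by rewrite -e1; apply: I1; rewrite e1.
have o2 : out r (f i) (p (inr y2)) by rewrite -e2; apply: I1; rewrite e2.
have inner y j v : r y < M -> out r j v -> v <> inr y.
  by move=> hy; case: v => // y' /= [e [h1 h2]] [ey]; subst y'; rewrite e /M in hy; lia.
have hC y y' : y \notin codom (val : rem2 y1 y2 -> Y) -> p (inr y) = inr y' -> y' \in codom (val : rem2 y1 y2 -> Y).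
  move=> hy; rewrite -[_ \in _]negbK codom_rem2.
  have [j oj] : exists j, out r j (p (inr y)).
    by move: hy; rewrite codom_rem2 => /orP [] /eqP ->; [exists i|exists (f i)].
  move=> e; apply/negP => /orP [] /eqP ey; subst y'.
    by apply: (inner y1 j _ _ oj); rewrite ?e1.
  by apply: (inner y2 j _ _ oj); rewrite ?e2.
have [p2 hp2 hr] := splice_exists hp (okcl_zeta n H) hC.
exists (rem2 y1 y2), (r \o val), (inj_comp ri val_inj), (k \o val), (mkbd hp2 [::]), p2.
have ol j (v : X + rem2 y1 y2) : out (r \o val) j v <-> out r j (lift val v) by case: v.
(* A strand ending at an outer point does not meet the new cap and is unchanged. *)
have pass j v : out r j (p v) -> match p v with
     | inr y => if y \in codom (val : rem2 y1 y2 -> Y) then inr y else p (inr (swp y1 y2 y)) | v => v end = p v.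
  case E : (p v) => [//|y] oj; case: ifP => // /negbT; rewrite codom_rem2 => /orP [] /eqP ey; subst y.
    by case: (inner y1 _ _ _ oj); rewrite ?e1.
  by case: (inner y2 _ _ _ oj); rewrite ?e2.
split=> //.
- exact: follows_mkbd.
- congr nm; apply: (dm_dcl _ hD (follows_mkbd hp2 _)) => //.
  by rewrite hl; exact: loops_eqv_refl.
- move=> z hz; have := I1 _ hz => oz.
  by apply/ol; rewrite hr (pass _ _ oz).
move=> j v /ol oj hj; apply/ol; rewrite hr.
have pp w : p (p w) = w by case: (hp w).
have [ji|ji] := classic (j = i).
  subst j; rewrite (out_uniq ri oj o1) pp.
  rewrite ifF; last by apply/negbTE; rewrite codom_rem2 eqxx.
  by rewrite /swp eqxx.
have [jf|jf] := classic (j = f i).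
  subst j; rewrite (out_uniq ri oj o2) pp.
  rewrite ifF; last by apply/negbTE; rewrite codom_rem2 eqxx orbT.
  by rewrite /swp (eq_sym y2) (negbTE n) eqxx ff.
have oo : out r (f j) (p (lift val v)).
  apply: I2 => // y ey; have [/codomP [z ez]|] := boolP (y \in codom (val : rem2 y1 y2 -> Y)).
    by apply: (hj z); rewrite /= -ez.
  by rewrite codom_rem2 => /orP [] /eqP ey1; subst y; [apply: ji; rewrite -ey e1|apply: jf; rewrite -ey e2].
by rewrite (pass _ _ oo).
Qed.

Lemma state_contr m u : (forall x y, (x, y) \in m -> x < M /\ y = f x) -> uniq (ends m) ->
  mok m u -> state u -> state (contr m u).
Proof.
elim: m u => // -[x y] m IH u hm um ok st; rewrite contr_cons.
have [hx ey] := hm x y (mem_head _ _).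
apply: IH.
- by move=> x' y' h; apply: hm; rewrite inE h orbT.
- by move: um => /= /and3P [].
- exact: mok_zt ok.
rewrite /= ey; apply: state_zt => //; rewrite -ey; apply: ok; exact: mem_head.
Qed.
End State.

(** Starting from the sources and the wires, all pairs of [f] are contracted under the invariant
    [state]. The resulting diagram pairs its boundary points as [f] does, and it is applied to the
    same element. *)
Lemma etan_nat0 c d (f : BDiag c d) (x : a c) : bloops f = [::] -> etan (amap a f x) = ev f (etan x).
Proof.
move=> fl; set A := size c; set b := size d; pose M := A + b.
have ht := typed_etan x.
have fp : pairing M (bpair f) := bd_pairing f.
have fr := @wfresh_typed _ _ c d (etan x) ht.
have rlt (i : 'I_(size c)) : rk i < A by have := rk_lt i; rewrite card_ord.
have st0 : state (@rk 'I_(size c)) (et x) A b (bpair f) (wp (etan x) (wires A M d)).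
  have [Y [r [ri [k [D [p [hD hl E h1 h2]]]]]]] := wires_diagram (rXi := @rk_inj _) fr.
  have hp := follows_fpairing hD; have pp w : p (p w) = w by case: (hp w).
  exists Y, r, ri, k, D, p; split=> //.
    move=> y hy; case: (ltnP (r y) A) => hA.
      have [i ei] : exists i : 'I_(size c), rk i = r y by apply: rk_surj; rewrite card_ord.
      have [y' py ry] := h1 i.
      have -> : y = y' by apply: (ri); rewrite ry.
      by rewrite -py pp /= ei ry.
    have [|y1 [y2 [py r1 r2]]] := h2 (r y, r y + b).
      rewrite mem_wires -/b hA /=; apply/andP; split; first by [].
      by rewrite /M; apply/eqP; lia.
    have -> : y = y1 by apply: (ri).
    by rewrite py /= r1 r2 /=; move: hA; rewrite /M in hy; lia.
  move=> i v ov hi; exfalso.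
  have iM : i < M.
    by case: v ov => [j|y] /=; [move=> <-; exact: leq_trans (rlt j) (leq_addr _ _)|case=> _ []].
  case: (ltnP i A) => hA.
    have [j ej] : exists j : 'I_(size c), rk j = i by apply: rk_surj; rewrite card_ord.
    by have [y _ ry] := h1 j; apply: (hi y); rewrite ry.
  have [|y1 [y2 [py r1 r2]]] := h2 (i, i + b).
    rewrite mem_wires -/b hA /=; apply/andP; split; first by [].
    by rewrite /M; apply/eqP; lia.
  exact: (hi y1).
have [|Y [r [ri [k [D [p [hD hl E _ I2]]]]]]] := state_contr (@rk_inj 'I_(size c)) rlt fp _ (uniq_prs fp) (@mok_typed _ _ _ _ f _ ht) st0.
  by move=> i j; rewrite mem_prs => /and3P [h1 _ /eqP ->].
have rM y : M <= r y.
  have := @chn_raw _ _ _ _ f _ (r y) ht; rewrite /raw E chn_nm -/A -/b -/M.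
  by case: ltnP.
have hp := follows_fpairing hD; have pp w : p (p w) = w by case: (hp w).
(* All remaining names are at least [M], so no inner point is pending and the second half of the
   invariant applies to every strand. *)
have {}I2 i v : out (@rk 'I_(size c)) A b r i v -> out (@rk 'I_(size c)) A b r (bpair f i) (p v).
  move=> ov; apply: I2 => // y ey; have := rM y; rewrite ey leqNgt => /negP; apply.
  by case: v ov => [j|y'] /=; [move=> <-; exact: leq_trans (rlt j) (leq_addr _ _)|case=> _ []].
have chnY k' : chn (nm (s := F) ri (dm D)) k' = if k' < M then None else onth d (k' - M).
  by rewrite -E; exact: (@chn_raw _ _ _ _ f _ k' ht).
(* The surviving outer ends [M + j] are identified with the positions of [d]. *)
have [e he] : exists e : bij 'I_(size d) Y, forall j, r (e j) = M + rk j.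
  apply: (naming_bij (r := fun j : 'I_(size d) => M + rk j)).
  - by move=> i j /addnI /rk_inj.
  - by [].
  - move=> j; have := chnY (M + rk j); rewrite ltnNge leq_addr /= addKn onth_kap.
    by have [[y <- _] _|[_ ->]//] := chn_nmP ri (dm D : F Y) (M + rk j); exists y.
  - move=> y; have := chnY (r y); rewrite chn_nm ifF; last by rewrite ltnNge rM.
    move=> /esym h; have hy : r y - M < #|'I_(size d)| by rewrite card_ord -onthTE h.
    by have [j ej] := rk_surj hy; exists j; rewrite ej subnKC.
have [p3 hp3 hr] := splice_exists hp (okcl_bij k e) (fun y y' h _ => not_codom_bij e y').
have hr3 v : lift e (p3 v) = p (lift e v).
  by rewrite hr; case: (p _) => // y; rewrite not_codom_bij.
have E3 : fact e (dm D) = dm (mkbd hp3 [::]).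
  apply: (dm_dcl _ hD (follows_mkbd hp3 _)) => //; first by rewrite hl; exact: loops_eqv_refl.
  by move=> y y' _ _; exact: not_codom_bij.
have ir : injective (subn^~ M \o r).
  by move=> y y' /= h; apply: (ri); have := rM y; have := rM y'; lia.
have Eev : ev f (etan x) = nm (s := F) (@rk_inj 'I_(size d)) (dm (mkbd hp3 [::])).
  rewrite /ev fl /= /raw -/A -/b -/M E (ren_nm ri ir) -E3; symmetry.
  by apply: (@nm_eq _ _ _ _ _ _ _ _ e) => // j /=; rewrite he addKn.
have Ed : d = map (k \o e) (enum 'I_(size d)).
  apply: eq_from_onth => i; rewrite -(typed_ev f ht i) Eev.
  exact: (typed_nm_rk (s := F)).
rewrite Eev nm_rk_etan -(etan_cst Ed); congr etan; rewrite [tagged _]/=.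
symmetry; apply: amap_cst; last by rewrite fl; exact: loops_eqv_refl.
move=> i; case: (ltnP i (#|'I_(size c)| + #|'I_(size d)|)) => [/code_surj [u <-]|hi]; last first.
  have [_ [e1 _]] := bpair_ok f; have [_ [e2 _]] := bpair_ok (mkbd hp3 [::]).
  rewrite e1 ?e2 // ?size_enum_map //.
  by move: hi; rewrite !card_ord.
rewrite follows_mkbd.
(* The boundary point with number [i] is the outer end of the strand at [i]; the invariant then
   reads as the equality of the two pairings. *)
have oc (v : 'I_(size c) + 'I_(size d)) : out (@rk 'I_(size c)) A b r (code v) (lift e v).
  case: v => [j|j] //=; move: (rk_lt j); rewrite he !card_ord /M -/A -/b; move: (rk j) => q; lia.
have := I2 _ _ (oc u); rewrite -hr3 => o1.
exact: (out_fun o1 (oc (p3 u))).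
Qed.
End UnitNatural.

(** * Closed loops *)

Section Loops.
Variables (P : palette) (a : CircAlg P).
Implicit Types (c d e l : seq P).
Let ax := ca_ax a.
Notation F := (foper a).

Lemma bd_ok_nil : @bd_ok P [::] [::] id.
Proof. by split; [|split]. Qed.

Definition loopd l : BDiag [::] [::] := MkBDiag l bd_ok_nil.

Definition lelt l : nom F := etan (amap a (loopd l) (mu0 a)).

Lemma rem2_empty (z : rem2 pt1 pt2) : False.
Proof. by case: z => [[[|[|i]] hi]]. Qed.

(** Contracting the two ends of the cup composes it with a cap. The composite has no boundary and a
    single closed component, hence is the empty diagram with one loop. *)
Lemma lelt1 q : lelt [:: q] = lop F q.
Proof.
have n : pt1 != pt2 by [].
have H : tag (fepsu a q) pt1 = pinv (tag (fepsu a q) pt2) by rewrite /= pinvK.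
rewrite /lop (wr_nm _ _ (@wrn_inj 0 1 ltac:(done))) //.
rewrite -[zt 0 1 _]/(zt (wrn 0 1 pt1) (wrn 0 1 pt2) _) (zt_nm _ n (phi := (fepsu a q : F 'I_2)) H).
rewrite (@nm_ext _ F _ _ (@rk (rem2 pt1 pt2)) _ (@rk_inj _)) => [|z]; last by case: (rem2_empty z).
rewrite -[zeta F n _ H]/(fzeta n (t := fepsu a q) H) nm_rk_etan.
pose p (u : void + rem2 pt1 pt2) := u.
have hp : fpairing (tag (funit a)) (cupcol q \o val) p.
  by case=> [[]|z]; case: (rem2_empty z).
pose h := mkbd hp [:: q].
pose D1 := mkbd (fpairing_cup (tag (funit a)) (cupcol_swap q)) [::].
pose D2 := mkbd (okcl_fpairing (okcl_zeta n H)) [::].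
have sc : #|{: void}| = 0 by rewrite card_void.
have se : #|rem2 pt1 pt2| = 0 by apply: eq_card0 => z; case: (rem2_empty z).
have b01 : bpair D1 0 = 1 /\ bpair D1 1 = 0.
  have := follows_mkbd (fpairing_cup (tag (funit a)) (cupcol_swap q)) [::] (inr pt1).
  have := follows_mkbd (fpairing_cup (tag (funit a)) (cupcol_swap q)) [::] (inr pt2).
  by rewrite /= card_void /rk !index_enum_ord.
have B : BDis_comp D1 D2 h.
  rewrite /BDis_comp !size_enum_map sc se card_ord; split; first by [].
  set conn := clos_refl_trans nat _.
  have inv i j : conn i j -> i < 2 -> j < 2.
    elim=> {i j} // [i j|i j k _ h1 _ h2 /h1 /h2 //].
    case=> [[hi ->] _|[_ [hi ->]] _].
      have := @bd_pairing _ _ _ D1 i; rewrite !size_enum_map sc card_ord => /(_ hi) [] //.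
    have := @bd_pairing _ _ _ D2 (i - 0); rewrite !size_enum_map se card_ord => /(_ ltac:(lia)) [] //.
  (* The circle consists of both middle points; [0] represents it and carries the colour [q]. *)
  exists [:: 0], [:: q]; split.
    constructor; last by constructor.
    rewrite !onth_cat !size_enum_map sc card_ord.
    have ho := onth_rk (cupcol q) pt1; rewrite /rk index_enum_ord in ho; exact: ho.
  split.
    by move=> i [<-|[]]; split=> // j /inv; auto.
  split.
    move=> i [[_ hi] _]; exists 0; split; first by left.
    case: i hi => [|[|i]] // _; first exact: rt_refl.
    by apply: rt_step; left; case: b01.
  split; first by move=> i j [<-|[]] [<-|[]].
  split; first by constructor=> //; constructor.
  exact: loops_eqv_refl.
have -> : tagged (fzeta n (t := fepsu a q) H) = amap a h (cst (enum_void (tag (funit a))) (mu0 a)).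
  by rewrite (amap_comp ax B).
have E2 : [::] = map (cupcol q \o val) (enum (rem2 pt1 pt2)).
  by apply/esym/size0nil; rewrite size_enum_map.
rewrite (@amap_cst _ _ _ _ _ _ (enum_void (tag (funit a))) E2 (loopd [:: q])); first by rewrite etan_cst.
- move=> i; have [_ [e1 _]] := bpair_ok h.
  by rewrite e1 // !size_enum_map sc se.
- exact: loops_eqv_refl.
Qed.

Lemma lelt0 : lelt [::] = nu F.
Proof. by rewrite /lelt (amap_id ax) ?etan_mu0. Qed.

Lemma lelt_cons q l : lelt (q :: l) = np (lop F q) (lelt l).
Proof.
have H : [::] = [::] ++ [::] :> seq P by [].
rewrite /lelt -{1}(mu_unitl ax H (mu0 a)) (@mu_nat _ _ ax _ _ _ _ _ _ H H (loopd [:: q]) (loopd l)) //.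
by rewrite etan_mu -/(lelt _) -/(lelt _) lelt1 /mul ren_id.
Qed.

Lemma disj_lelt (u : nom F) l : disj u (lelt l).
Proof. by move=> k; right; rewrite (typed_etan _ k) onth0n. Qed.

Lemma np_lelt (u : nom F) l : np u (lelt l) = lops l u.
Proof.
elim: l u => [|q l IH] u; first by rewrite lelt0 np_nu.
rewrite lelt_cons -np_assoc; try exact: disj_lelt.
  by rewrite IH /= -np_lops //; exact: disj_lop.
exact: disj_lop.
Qed.

Theorem etan_nat c d (f : BDiag c d) (x : a c) : etan (amap a f x) = ev f (etan x).
Proof.
pose f0 := MkBDiag [::] (bpair_ok f).
have H1 : c = c ++ [::] by rewrite cats0.
have H2 : d = d ++ [::] by rewrite cats0.
have T : BDis_tensor f0 (loopd (bloops f)) f.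
  split; [|split=> //] => i hi.
  by rewrite /= !addn0; case: ifP; case: ifP.
rewrite -{1}(mu_unitr ax H1 x) (mu_nat ax H1 H2 T) etan_mu etan_nat0 //.
rewrite /mul -/(lelt _) ren_id; first by rewrite np_lelt.
by move=> k; rewrite (typed_etan _ k) onth0n.
Qed.

Lemma typed_etan_map c c' (H : c' = map (palmap_id P) c) (x : a c) : typed c' (etan x).
Proof. by rewrite H map_id; exact: typed_etan. Qed.

Definition eta_fun c c' (H : c' = map (palmap_id P) c) (x : a c) : galg F c' :=
  exist (typed c') (etan x) (typed_etan_map H x).

Definition eta_hom : CAhom (palmap_id P) a (galg F).
Proof.
apply: (@MkCAhom P P (palmap_id P) a (galg F) eta_fun).
- move=> c d c' d' Hc Hd.
  have Ec : c = c' by rewrite Hc map_id. have Ed : d = d' by rewrite Hd map_id.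
  destruct Ec, Ed => f f' hp hl x; apply: gA_eq; rewrite /= etan_nat.
  by apply: ev_eqv; split=> [i|]; rewrite ?hp // hl map_id; exact: loops_eqv_refl.
- move=> c d e c' d' e' H H' Hc Hd He x y; apply: gA_eq => /=.
  by rewrite etan_mu Hc map_id.
- by move=> H; apply: gA_eq; exact: etan_mu0.
Defined.
End Loops.

(** * Composites and inverses of morphisms *)

Section Homs.

Lemma bd_ok_map (P Q : palette) (g : palmap P Q) c d p : bd_ok c d p -> bd_ok (map g c) (map g d) p.
Proof.
case=> h1 [h2 h3]; rewrite /bd_ok !size_map -map_cat; split=> //; split=> // i hi.
rewrite !onth_map h3 //; case: ifP => _ //.
by case: (onth _ _) => //= x; rewrite pm_inv.
Qed.

(** The palette map [g3] only has to agree pointwise with the composite, matching the relational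
    definition of composition in the categories. In particular [palmap_id] can serve as its own
    composite. *)
Definition COcomp (P Q R : palette) (g1 : palmap P Q) (g2 : palmap Q R) (g3 : palmap P R)
  (s : CircOp P) (t : CircOp Q) (u : CircOp R) (E : forall c, g3 c = g2 (g1 c))
  (f : COhom g1 s t) (h : COhom g2 t u) : COhom g3 s u.
Proof.
apply: (@MkCOhom _ _ _ _ _ (fun X phi => cm h (cm f phi))).
- by move=> X Y e phi; rewrite !cm_act.
- by move=> X x phi; rewrite !cm_ch E.
- by move=> X Y phi psi; rewrite !cm_xprod.
- by rewrite !cm_xunit.
- move=> X x y n phi H H'.
  have H1 : ch t x (cm f phi) = pinv (ch t y (cm f phi)) by rewrite !cm_ch H pm_inv.
  by rewrite (cm_zeta n H H1) (cm_zeta n H1 H').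
- by move=> c; rewrite !cm_epsu E.
Defined.

Lemma map_comp3 (P Q R : palette) (g1 : palmap P Q) (g2 : palmap Q R) (g3 : palmap P R)
  (E : forall c, g3 c = g2 (g1 c)) c : map g3 c = map g2 (map g1 c).
Proof. by rewrite -map_comp; apply: eq_map. Qed.

Definition CAcomp (P Q R : palette) (g1 : palmap P Q) (g2 : palmap Q R) (g3 : palmap P R)
  (a : CircAlg P) (b : CircAlg Q) (u : CircAlg R) (E : forall c, g3 c = g2 (g1 c))
  (f : CAhom g1 a b) (h : CAhom g2 b u) : CAhom g3 a u.
Proof.
apply: (@MkCAhom _ _ _ _ _ (fun c c' (H : c' = map g3 c) x =>
   am h (etrans H (map_comp3 E c)) (am f erefl x))).
- move=> c d c' d' Hc Hd D D' hp hl x.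
  (* Naturality of [f] needs a diagram between the intermediate lists: the same pairing, with the
     colours of the loops mapped by [g1]. *)
  pose D1 := MkBDiag (map g1 (bloops D)) (bd_ok_map g1 (bpair_ok D)).
  rewrite (am_nat f erefl erefl (f' := D1)) //.
  by apply: am_nat => //; rewrite hl (map_comp3 E).
- move=> c d e c' d' e' H H' Hc Hd He x y.
  have H1 : map g1 e = map g1 c ++ map g1 d by rewrite H map_cat.
  by rewrite (am_mu f H H1 erefl erefl) (am_mu h H1 H' (etrans Hc (map_comp3 E c)) (etrans Hd (map_comp3 E d))).
- by move=> H; rewrite !am_mu0.
Defined.

Lemma CAcompE (P Q R : palette) (g1 : palmap P Q) (g2 : palmap Q R) (g3 : palmap P R)
  (a : CircAlg P) (b : CircAlg Q) (u : CircAlg R) (E : forall c, g3 c = g2 (g1 c))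
  (f : CAhom g1 a b) (h : CAhom g2 b u) c c' c'' (H1 : c' = map g1 c) (H2 : c'' = map g2 c') H3 x :
  am (CAcomp E f h) H3 x = am h H2 (am f H1 x).
Proof. by subst c' => /=; congr am; exact: proof_irrelevance. Qed.

Definition COinv (P : palette) (s t : CircOp P) (f : COhom (palmap_id P) s t)
  (inv : forall X : finType, t X -> s X) (K : forall X, cancel (@cm _ _ _ _ _ f X) (inv X))
  (K' : forall X, cancel (inv X) (@cm _ _ _ _ _ f X)) : COhom (palmap_id P) t s.
Proof.
apply: (@MkCOhom _ _ _ _ _ inv).
- by move=> X Y e phi; rewrite -[RHS]K cm_act K'.
- by move=> X x phi; rewrite -[in RHS](K' _ phi) cm_ch.
- by move=> X Y phi psi; rewrite -[RHS]K cm_xprod !K'.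
- by rewrite -[RHS]K cm_xunit.
- move=> X x y n phi H H'; rewrite -[RHS]K; congr inv.
  have H1 : ch t x (cm f (inv X phi)) = pinv (ch t y (cm f (inv X phi))) by rewrite K'.
  by rewrite (cm_zeta n H' H1); apply: zeta_eq; rewrite K'.
- by move=> c; rewrite -[RHS]K cm_epsu.
Defined.

(** [map (palmap_id P) c] equals [c] only propositionally, so the inverse family, indexed by one
    list, is made into a morphism by transport. *)
Definition CAinv (P : palette) (a b : CircAlg P) (f : CAhom (palmap_id P) a b)
  (inv : forall c : seq P, b c -> a c)
  (K : forall c (H : c = map (palmap_id P) c) x, inv c (am f H x) = x)
  (K' : forall c (H : c = map (palmap_id P) c) y, am f H (inv c y) = y) : CAhom (palmap_id P) b a.
Proof.
apply: (@MkCAhom _ _ _ _ _ (fun c c' (H : c' = map (palmap_id P) c) y =>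
    cst (esym (etrans H (map_id c))) (inv c y))).
- move=> c d c' d' Hc Hd.
  have Ec : c = c' by rewrite Hc map_id. have Ed : d = d' by rewrite Hd map_id.
  destruct Ec, Ed => D D' hp hl y; rewrite !cst_id -{1}(K' _ Hc y).
  rewrite -(am_nat f Hc Hd (f := D')) ?K //.
  by rewrite hl !map_id.
- move=> c d e c' d' e' H H' Hc Hd He x y.
  have Ec : c = c' by rewrite Hc map_id. have Ed : d = d' by rewrite Hd map_id.
  have Ee : e = e' by rewrite He map_id.
  destruct Ec, Ed, Ee; rewrite !cst_id -{1}(K' _ Hc x) -{1}(K' _ Hd y).
  by rewrite -(am_mu f H' H Hc Hd He) K.
- by move=> H; rewrite cst_id -(am_mu0 f H) K.
Defined.
End Homs.

(** * Functor laws and naturality of the comparisons *)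

Section FunctorLaws.

Lemma fcm_id (P : palette) (g : palmap P P) (a : CircAlg P) (h : CAhom g a a) :
  (forall p, g p = p) -> (forall c (H : c = map g c) x, am h H x = x) ->
  forall (X : finType) (t : fS a X), fcm h t = t.
Proof.
move=> hg hh X [k x]; apply: fS_eq => [z /=|E]; first exact: hg.
by apply: etrans (cst_am h E _ (etrans (esym E) (map_comp g k _)) x) (hh _ _ x).
Qed.

Lemma nmap_id (P : palette) (g : palmap P P) (s : CircOp P) (h : COhom g s s) :
  (forall (X : finType) (phi : s X), cm h phi = phi) -> forall t, nmap h t = t.
Proof. by move=> hh [X phi]; rewrite /nmap /= hh. Qed.

Variables (P Q R : palette) (g1 : palmap P Q) (g2 : palmap Q R) (g3 : palmap P R).

Lemma fcm_comp (a : CircAlg P) (b : CircAlg Q) (d : CircAlg R)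
    (f : CAhom g1 a b) (h : CAhom g2 b d) (k : CAhom g3 a d) :
  (forall p, g3 p = g2 (g1 p)) ->
  (forall c c' c'' (H1 : c' = map g1 c) (H2 : c'' = map g2 c') (H3 : c'' = map g3 c) x,
     am k H3 x = am h H2 (am f H1 x)) ->
  forall (X : finType) (t : fS a X), fcm k t = fcm h (fcm f t).
Proof.
move=> hg hh X [l x]; apply: fS_eq => [z /=|E]; first exact: hg.
by apply: etrans (cst_am k E _ (etrans (esym E) (map_comp g3 l _)) x) (hh _ _ _ _ _ _ x).
Qed.

Lemma nmap_comp (s : CircOp P) (t : CircOp Q) (u : CircOp R)
    (f : COhom g1 s t) (h : COhom g2 t u) (k : COhom g3 s u) :
  (forall (X : finType) (phi : s X), cm k phi = cm h (cm f phi)) ->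
  forall t, nmap k t = nmap h (nmap f t).
Proof. by move=> hh [X phi]; rewrite /nmap /= hh. Qed.
End FunctorLaws.

Lemma nmap_etan (P Q : palette) (g : palmap P Q) (a : CircAlg P) (b : CircAlg Q)
    (f : CAhom g a b) c c' (H : c' = map g c) x :
  etan (am f H x) = nmap (fhom f) (etan x).
Proof.
have E : map g c = map (g \o @kap P c) (enum 'I_(size c)) by rewrite map_comp -kapE.
rewrite {2}/etan nmap_nm nm_rk_etan.
have -> : tagged (fhom f _ (et x)) = am f (esym E) x.
  exact: (am_cst f (kapE c) (map_comp g _ _)).
by rewrite -(cst_am f (etrans (esym E) (esym H)) (esym E)) etan_cst.
Qed.

Lemma fcm_nuh (P Q : palette) (g : palmap P Q) (s : CircOp P) (t : CircOp Q)
    (f : COhom g s t) (X : finType) (phi : s X) :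
  fcm (ghom f) (nuh phi) = nuh (cm f phi).
Proof. by apply: fS_gA_eq => [x|] /=; rewrite ?cm_ch // nmap_nm. Qed.

(** * Inverses of the comparison morphisms *)

Section Inverses.
Variable P : palette.

Definition eta_val (a : CircAlg P) c (y : galg (foper a) c) : a c :=
  sval (constructive_indefinite_description _ (etan_surj (svalP y))).

Lemma eta_valP (a : CircAlg P) c (y : galg (foper a) c) : etan (eta_val y) = sval y.
Proof. exact: svalP (constructive_indefinite_description _ (etan_surj (svalP y))). Qed.

Lemma eta_homK (a : CircAlg P) c (H : c = map (palmap_id P) c) x : eta_val (am (eta_hom a) H x) = x.
Proof. by apply: etan_inj; rewrite eta_valP. Qed.

Lemma eta_valK (a : CircAlg P) c (H : c = map (palmap_id P) c) y : am (eta_hom a) H (eta_val y) = y.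
Proof. by apply: gA_eq; rewrite /= eta_valP. Qed.

Definition eta_hom_inv (a : CircAlg P) : CAhom (palmap_id P) (galg (foper a)) a :=
  CAinv (@eta_homK a) (@eta_valK a).

Definition nuh_val (s : CircOp P) (X : finType) (t : fS (galg s) X) : s X :=
  sval (constructive_indefinite_description _ (nuh_surj t)).

Lemma nuh_valK (s : CircOp P) (X : finType) : cancel (@nuh_val s X) (@nuh P s X).
Proof. move=> t; exact: svalP (constructive_indefinite_description _ (nuh_surj t)). Qed.

Lemma nuhK (s : CircOp P) (X : finType) : cancel (@nuh P s X) (@nuh_val s X).
Proof. by move=> phi; apply: nuh_inj; rewrite nuh_valK. Qed.

Definition nu_hom_inv (s : CircOp P) : COhom (palmap_id P) (foper (galg s)) s :=
  @COinv P _ _ (nu_hom s) (@nuh_val s) (@nuhK s) (@nuh_valK s).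

End Inverses.

(** * The equivalences *)

Lemma CAinvE (P : palette) (a b : CircAlg P) (f : CAhom (palmap_id P) a b) inv
    (K : forall c (H : c = map (palmap_id P) c) x, inv c (am f H x) = x)
    (K' : forall c (H : c = map (palmap_id P) c) y, am f H (inv c y) = y) c H y :
  am (CAinv K K') H y = inv c y.
Proof. by rewrite /= cst_id. Qed.

Section Iso.
Variable P : palette.
Let g := palmap_id P.
Variable g2 : forall c, g c = g (g c).

Lemma eta_etaK (a : CircAlg P) c (H : c = map g c) x :
  am (CAcomp g2 (eta_hom a) (eta_hom_inv a)) H x = x.
Proof.
have H1 : c = map g c by rewrite map_id.
by rewrite (CAcompE g2 _ _ H1 H) CAinvE eta_homK.
Qed.

Lemma eta_inv_etaK (a : CircAlg P) c (H : c = map g c) y :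
  am (CAcomp g2 (eta_hom_inv a) (eta_hom a)) H y = y.
Proof.
have H1 : c = map g c by rewrite map_id.
by rewrite (CAcompE g2 _ _ H1 H) CAinvE eta_valK.
Qed.
End Iso.

Section Naturality.
Variables (P Q : palette) (g : palmap P Q).

Lemma eta_square (a : CircAlg P) (b : CircAlg Q) (f : CAhom g a b) c c' c'' c3
    (H1 : c' = map g c) (H2 : c'' = map (palmap_id Q) c') (H3 : c3 = map (palmap_id P) c)
    (H4 : c'' = map g c3) x :
  am (eta_hom b) H2 (am f H1 x) = am (ghom (fhom f)) H4 (am (eta_hom a) H3 x).
Proof. by apply: gA_eq; exact: nmap_etan. Qed.

Lemma epsn_square (s : CircOp P) (t : CircOp Q) (f : COhom g s t) (X : finType) (phi : foper (galg s) X) :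
  cm (nu_hom_inv t) (cm (fhom (ghom f)) phi) = cm f (cm (nu_hom_inv s) phi).
Proof.
by rewrite /= -[in LHS](nuh_valK phi) fcm_nuh nuhK.
Qed.
End Naturality.

Definition fibreF (P : palette) : Functor (CAcat P) (COcat P).
Proof.
apply: (@MkFunctor (CAcat P) (COcat P) (@foper P) (fun a b f => fhom f)).
- by move=> a f hf; apply: fcm_id.
- by move=> a b c f h k hk; apply: fcm_comp.
Defined.

Definition fibreG (P : palette) : Functor (COcat P) (CAcat P).
Proof.
apply: (@MkFunctor (COcat P) (CAcat P) (@galg P) (fun s t f => ghom f)).
- by move=> s f hf c H x; apply: gA_eq; apply: nmap_id.
- by move=> s t u f h k hk c c' c'' H1 H2 H3 x; apply: gA_eq; apply: nmap_comp.
Defined.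

(** The comparison [nu_hom] runs from an operad to its round trip, so the counit is its inverse. *)
Definition fibre_equiv (P : palette) : CatEquiv (CAcat P) (COcat P).
Proof.
pose g2 (c : P) : palmap_id P c = palmap_id P (palmap_id P c) := erefl.
apply: (@MkCatEquiv _ _ (fibreF P) (fibreG P) (@eta_hom P) (@eta_hom_inv P)
  (@nu_hom_inv P) (@nu_hom P)).
- move=> a; split.
    by exists (CAcomp g2 (eta_hom a) (eta_hom_inv a)); split=> [c c' c'' *|c H x]; [exact: CAcompE|exact: eta_etaK].
  by exists (CAcomp g2 (eta_hom_inv a) (eta_hom a)); split=> [c c' c'' *|c H x]; [exact: CAcompE|exact: eta_inv_etaK].
- move=> s; split.
    by exists (COcomp g2 (nu_hom_inv s) (nu_hom s)); split=> // X phi; exact: nuh_valK.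
  by exists (COcomp g2 (nu_hom s) (nu_hom_inv s)); split=> // X phi; exact: nuhK.
- move=> a b f; exists (CAcomp g2 f (eta_hom b)); split=> c c' c'' H1 H2 H3 x; first exact: CAcompE.
  by rewrite (CAcompE g2 _ _ H1 H2); apply: eta_square.
- move=> s t f; exists (COcomp g2 (fhom (ghom f)) (nu_hom_inv t)); split=> // X phi.
  exact: epsn_square.
Defined.

Definition globalF : Functor CAgcat COgcat.
Proof.
apply: (@MkFunctor CAgcat COgcat (fun X => existT _ (projT1 X) (foper (projT2 X)))
  (fun X Y f => @MkCOmor (existT _ (projT1 X) (foper (projT2 X)))
     (existT _ (projT1 Y) (foper (projT2 Y))) (ca_pal f) (fhom (ca_hom f)))).
- by move=> a f [hg hf]; split=> //; apply: fcm_id.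
- by move=> a b c f h k [hg hk]; split=> //; apply: fcm_comp.
Defined.

Definition globalG : Functor COgcat CAgcat.
Proof.
apply: (@MkFunctor COgcat CAgcat (fun X => existT _ (projT1 X) (galg (projT2 X)))
  (fun X Y f => @MkCAmor (existT _ (projT1 X) (galg (projT2 X)))
     (existT _ (projT1 Y) (galg (projT2 Y))) (co_pal f) (ghom (co_hom f)))).
- by move=> s f [hg hf]; split=> // c H x; apply: gA_eq; apply: nmap_id.
- by move=> s t u f h k [hg hk]; split=> // c c' c'' H1 H2 H3 x; apply: gA_eq; apply: nmap_comp.
Defined.


Definition global_equiv : CatEquiv CAgcat COgcat.
Proof.
apply: (@MkCatEquiv _ _ globalF globalG
  (fun X => @MkCAmor X (fob globalG (fob globalF X)) (palmap_id _) (eta_hom (projT2 X)))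
  (fun X => @MkCAmor (fob globalG (fob globalF X)) X (palmap_id _) (eta_hom_inv (projT2 X)))
  (fun Y => @MkCOmor (fob globalF (fob globalG Y)) Y (palmap_id _) (nu_hom_inv (projT2 Y)))
  (fun Y => @MkCOmor Y (fob globalF (fob globalG Y)) (palmap_id _) (nu_hom (projT2 Y)))).
- move=> [P a]; have g2 (c : P) : palmap_id P c = palmap_id P (palmap_id P c) by [].
  split.
    exists (@MkCAmor (existT _ P a) (existT _ P a) _ (CAcomp g2 (eta_hom a) (eta_hom_inv a))).
    by split; split=> //; [move=> *; exact: CAcompE|move=> c H x; exact: eta_etaK].
  exists (@MkCAmor (existT _ P _) (existT _ P _) _ (CAcomp g2 (eta_hom_inv a) (eta_hom a))).
  by split; split=> //; [move=> *; exact: CAcompE|move=> c H x; exact: eta_inv_etaK].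
- move=> [P s]; have g2 (c : P) : palmap_id P c = palmap_id P (palmap_id P c) by [].
  split.
    exists (@MkCOmor (existT _ P _) (existT _ P _) _ (COcomp g2 (nu_hom_inv s) (nu_hom s))).
    by split; split=> // X phi; exact: nuh_valK.
  exists (@MkCOmor (existT _ P s) (existT _ P s) _ (COcomp g2 (nu_hom s) (nu_hom_inv s))).
  by split; split=> // X phi; exact: nuhK.
- move=> [P a] [Q b] [g f] /=; have g2 (c : P) : g c = palmap_id Q (g c) by [].
  exists (@MkCAmor (existT _ P a) (existT _ Q (galg (foper b))) g (CAcomp g2 f (eta_hom b))).
  split; split=> // c c' c'' H1 H2 H3 x; first exact: (CAcompE g2 f (eta_hom b) H1 H2 H3).
  have H4 : map g c = map g c by [].
  have H5 : c'' = map (palmap_id Q) (map g c) by rewrite map_id; exact: H3.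
  by rewrite (CAcompE g2 _ _ H4 H5); apply: eta_square.
- move=> [P s] [Q t] [g f] /=; have g2 (c : P) : g c = palmap_id Q (g c) by [].
  exists (@MkCOmor (existT _ P (foper (galg s))) (existT _ Q t) g (COcomp g2 (fhom (ghom f)) (nu_hom_inv t))).
  by split; split=> // X phi; exact: epsn_square.
Defined.

(** Both equivalences use the same constructions on objects and morphisms, the global one merely
    pairing them with the palette, so the compatibilities hold by conversion. Heterogeneous equality
    appears because the two sides are typed over objects identified only by the first two
    clauses. *)
Theorem mainTheorem4 :
  exists (E : forall P : palette, CatEquiv (CAcat P) (COcat P))
         (Eg : CatEquiv CAgcat COgcat),
    (* the global equivalence extends the fibrewise ones *)
    (forall (P : palette) (a : CircAlg P),
       fob (eF Eg) (existT _ P a) = existT _ P (fob (eF (E P)) a)) /\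
    (forall (P : palette) (s : CircOp P),
       fob (eG Eg) (existT _ P s) = existT _ P (fob (eG (E P)) s)) /\
    (forall (P : palette) (a b : CircAlg P) (f : CAhom (palmap_id P) a b),
       JMeq (fmor (eF Eg) (X := existT _ P a) (Y := existT _ P b)
               (@MkCAmor (existT _ P a) (existT _ P b) (palmap_id P) f))
            (@MkCOmor (existT _ P (fob (eF (E P)) a))
                      (existT _ P (fob (eF (E P)) b))
                      (palmap_id P) (fmor (eF (E P)) f))) /\
    (forall (P : palette) (s t : CircOp P) (f : COhom (palmap_id P) s t),
       JMeq (fmor (eG Eg) (X := existT _ P s) (Y := existT _ P t)
               (@MkCOmor (existT _ P s) (existT _ P t) (palmap_id P) f))
            (@MkCAmor (existT _ P (fob (eG (E P)) s))
                      (existT _ P (fob (eG (E P)) t))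
                      (palmap_id P) (fmor (eG (E P)) f))).
Proof.
exists fibre_equiv, global_equiv.
split; first by move=> P a; reflexivity.
split; first by move=> P s; reflexivity.
split=> P x y f; exact: JMeq_refl.
Qed.
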